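(* Let $(A,\cdot,\circ)$ be a 3-dimensional Novikov--Poisson algebra over $\mathbb C$ whose commutative associative product $\cdot$ is not identically zero. Then $(A,\cdot,\circ)$ is isomorphic to one of the following algebras with basis $e_1,e_2,e_3$. Here $\alpha,\beta,\gamma\in\mathbb C$ are arbitrary parameters except for the restrictions indicated; for $\cdot$ only one of $e_i\cdot e_j=e_j\cdot e_i$ is listed; all products not listed are zero. **With $e_1\cdot e_3=e_2$:** - $NP01_{\alpha,\beta}$: $e_1\circ e_1=e_1,\ e_1\circ e_2=-e_2,\ e_1\circ e_3=e_1,\ e_2\circ e_1=e_2,\ e_2\circ e_3=e_2,\ e_3\circ e_1=\alpha e_2+e_3,\ e_3\circ e_2=-e_2,\ e_3\circ e_3=\beta e_2+e_3$. - $NP02_{\alpha}$: $e_1\circ e_1=e_1,\ e_1\circ e_2=-e_2,\ e_2\circ e_1=e_2,\ e_3\circ e_1=\alpha e_2+e_3,\ e_3\circ e_3=e_2$. - $NP03_{\alpha}$: $e_1\circ e_1=e_1,\ e_1\circ e_2=-e_2,\ e_2\circ e_1=e_2,\ e_3\circ e_1=\alpha e_2+e_3$. - $NP04_{\alpha,\beta,\gamma}$: $e_1\circ e_1=e_2,\ e_1\circ e_3=\alpha e_2,\ e_3\circ e_1=\beta e_2,\ e_3\circ e_3=\gamma e_2$. - $NP05_{\alpha,\beta}$: $e_1\circ e_3=\alpha e_2,\ e_3\circ e_1=\beta e_2$. **With $e_1\cdot e_1=e_2,\ e_1\cdot e_2=e_3$:** - $NP06_{\alpha,\beta}$ ($\alpha\ne2$):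 $e_1\circ e_1=\alpha e_1,\ e_1\circ e_2=e_2+\beta e_3,\ e_1\circ e_3=(2-\alpha)e_3,\ e_2\circ e_1=\alpha e_2,\ e_2\circ e_2=e_3,\ e_3\circ e_1=\alpha e_3$. - $NP07_{\alpha,\beta}$: $e_1\circ e_1=2e_1+\alpha e_3,\ e_1\circ e_2=e_2+\beta e_3,\ e_2\circ e_1=2e_2,\ e_2\circ e_2=e_3,\ e_3\circ e_1=2e_3$. - $NP08_{\alpha}$: $e_1\circ e_1=e_1+\alpha e_2,\ e_1\circ e_3=-e_3,\ e_2\circ e_1=e_2+\alpha e_3,\ e_3\circ e_1=e_3$. - $NP09_{\alpha,\beta}$: $e_1\circ e_1=\alpha e_2,\ e_1\circ e_2=\beta e_3,\ e_2\circ e_1=\alpha e_3$. - $NP10_{\alpha}$: $e_1\circ e_1=\alpha e_2+e_3,\ e_1\circ e_2=\alpha e_3,\ e_2\circ e_1=\alpha e_3$. **With $e_1\cdot e_3=e_1,\ e_2\cdot e_3=e_2,\ e_3\cdot e_3=e_3$:** - $NP11_{\alpha,\beta,\gamma}$: $e_1\circ e_3=\alpha e_1,\ e_2\circ e_3=\alpha e_2,\ e_3\circ e_1=e_2,\ e_3\circ e_2=\beta e_1+\gamma e_2,\ e_3\circ e_3=e_1+\alpha e_3$. - $NP12_{\alpha,\beta,\gamma}$: $e_1\circ e_3=\alpha e_1,\ e_2\circ e_3=\alpha e_2,\ e_3\circ e_1=\beta e_1,\ e_3\circ e_2=e_1+\gamma e_2,\ e_3\circ e_3=e_1+\alpha e_3$.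 - $NP13_{\alpha,\beta}$: $e_1\circ e_3=\alpha e_1,\ e_2\circ e_3=\alpha e_2,\ e_3\circ e_1=\beta e_1,\ e_3\circ e_2=\beta e_2,\ e_3\circ e_3=e_1+\alpha e_3$. - $NP14_{\alpha,\beta,\gamma}$: $e_1\circ e_3=\alpha e_1,\ e_2\circ e_3=\alpha e_2,\ e_3\circ e_1=\beta e_2,\ e_3\circ e_2=e_1+\gamma e_2,\ e_3\circ e_3=\alpha e_3$. - $NP15_{\alpha,\beta}$: $e_1\circ e_3=\alpha e_1,\ e_2\circ e_3=\alpha e_2,\ e_3\circ e_1=\beta e_1,\ e_3\circ e_2=\beta e_2,\ e_3\circ e_3=\alpha e_3$. **With $e_1\cdot e_3=e_2,\ e_2\cdot e_3=e_2,\ e_3\cdot e_3=e_3$:** - $NP16_{\alpha,\beta}$: $e_1\circ e_1=-e_1+e_2,\ e_1\circ e_3=\alpha e_2,\ e_2\circ e_3=\alpha e_2,\ e_3\circ e_1=\beta e_2,\ e_3\circ e_2=\beta e_2,\ e_3\circ e_3=e_2+\alpha e_3$. - $NP17_{\alpha,\beta}$: $e_1\circ e_3=\alpha e_2,\ e_2\circ e_3=\alpha e_2,\ e_3\circ e_1=\beta e_2,\ e_3\circ e_2=\beta e_2,\ e_3\circ e_3=e_2+\alpha e_3$. - $NP18_{\alpha,\beta}$: $e_1\circ e_1=-e_1+e_2,\ e_1\circ e_3=\alpha e_2,\ e_2\circ e_3=\alpha e_2,\ e_3\circ e_1=\beta e_2,\ e_3\circ e_2=\beta e_2,\ e_3\circ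 e_3=\alpha e_3$. - $NP19_{\alpha,\beta}$: $e_1\circ e_3=\alpha e_2,\ e_2\circ e_3=\alpha e_2,\ e_3\circ e_1=\beta e_2,\ e_3\circ e_2=\beta e_2,\ e_3\circ e_3=\alpha e_3$. **With $e_1\cdot e_1=e_2,\ e_1\cdot e_3=e_1,\ e_2\cdot e_3=e_2,\ e_3\cdot e_3=e_3$:** - $NP20_{\alpha,\beta,\gamma}$: $e_1\circ e_1=\frac{\alpha+\beta}{2}e_2,\ e_1\circ e_3=\beta e_1+e_2,\ e_2\circ e_3=\beta e_2,\ e_3\circ e_1=\frac{\alpha+\beta}{2}e_1+\gamma e_2,\ e_3\circ e_2=\alpha e_2,\ e_3\circ e_3=e_1+\beta e_3$. - $NP21_{\alpha,\beta}$: $e_1\circ e_1=\frac{\alpha+\beta}{2}e_2,\ e_1\circ e_3=\beta e_1,\ e_2\circ e_3=\beta e_2,\ e_3\circ e_1=\frac{\alpha+\beta}{2}e_1,\ e_3\circ e_2=\alpha e_2,\ e_3\circ e_3=e_2+\beta e_3$. - $NP22_{\alpha,\beta}$ ($\beta\ne0$): $e_1\circ e_1=\alpha e_2,\ e_1\circ e_3=\alpha e_1,\ e_2\circ e_3=\alpha e_2,\ e_3\circ e_1=\alpha e_1+\beta e_2,\ e_3\circ e_2=\alpha e_2,\ e_3\circ e_3=e_2+\alpha e_3$. - $NP23_{\alpha,\beta}$: $e_1\circ e_1=\frac{\alpha+\beta}{2}e_2,\ e_1\circ e_3=\alpha e_1,\ e_2\circ e_3=\alpha e_2,\ e_3\circ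 e_1=\frac{\alpha+\beta}{2}e_1,\ e_3\circ e_2=\beta e_2,\ e_3\circ e_3=\alpha e_3$. - $NP24_{\alpha}$: $e_1\circ e_1=\alpha e_2,\ e_1\circ e_3=\alpha e_1,\ e_2\circ e_3=\alpha e_2,\ e_3\circ e_1=\alpha e_1+e_2,\ e_3\circ e_2=\alpha e_2,\ e_3\circ e_3=\alpha e_3$. **With $e_1\cdot e_1=e_1,\ e_2\cdot e_2=e_2,\ e_3\cdot e_3=e_3$:** - $NP25_{\alpha,\beta,\gamma}$: $e_1\circ e_1=\alpha e_1,\ e_2\circ e_2=\beta e_2,\ e_3\circ e_3=\gamma e_3$. **With $e_1\cdot e_1=e_1,\ e_2\cdot e_2=e_2,\ e_1\cdot e_3=e_3$:** - $NP26_{\alpha,\beta,\gamma}$: $e_1\circ e_1=\alpha e_1+e_3,\ e_1\circ e_3=\beta e_3,\ e_2\circ e_2=\gamma e_2,\ e_3\circ e_1=\alpha e_3$. - $NP27_{\alpha,\beta,\gamma}$: $e_1\circ e_1=\alpha e_1,\ e_1\circ e_3=\beta e_3,\ e_2\circ e_2=\gamma e_2,\ e_3\circ e_1=\alpha e_3$. **With $e_1\cdot e_1=e_1,\ e_2\cdot e_2=e_2$:** - $NP28_{\alpha,\beta}$: $e_1\circ e_1=\alpha e_1,\ e_2\circ e_2=\beta e_2,\ e_3\circ e_3=e_3$. - $NP29_{\alpha,\beta}$: $e_1\circ e_1=\alpha e_1,\ e_2\circ e_2=\beta e_2$. **With $e_1\cdot e_1=e_1,\ e_2\cdot e_2=e_3$:**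 - $NP30_{\alpha,\beta}$: $e_1\circ e_1=\alpha e_1,\ e_2\circ e_2=\beta e_2,\ e_2\circ e_3=e_3,\ e_3\circ e_2=\beta e_3$. - $NP31_{\alpha,\beta}$: $e_1\circ e_1=\alpha e_1,\ e_2\circ e_2=e_2+\beta e_3,\ e_3\circ e_2=e_3$. - $NP32_{\alpha,\beta}$: $e_1\circ e_1=\alpha e_1,\ e_2\circ e_2=\beta e_3$. **With $e_1\cdot e_1=e_1$:** - $NP33_{\alpha,\beta}$: $e_1\circ e_1=\alpha e_1,\ e_2\circ e_2=\beta e_2,\ e_2\circ e_3=e_3,\ e_3\circ e_2=\beta e_3$. - $NP34_{\alpha}$: $e_1\circ e_1=\alpha e_1,\ e_2\circ e_2=e_2+e_3,\ e_3\circ e_2=e_3$. - $NP35_{\alpha}$: $e_1\circ e_1=\alpha e_1,\ e_2\circ e_2=e_2,\ e_3\circ e_2=e_3$. - $NP36_{\alpha}$: $e_1\circ e_1=\alpha e_1,\ e_2\circ e_2=e_3$. - $NP37_{\alpha}$: $e_1\circ e_1=\alpha e_1$. - $NP38_{\alpha}$: $e_1\circ e_1=\alpha e_1,\ e_2\circ e_2=e_2,\ e_3\circ e_3=e_3$. - $NP39_{\alpha}$: $e_1\circ e_1=\alpha e_1,\ e_2\circ e_2=e_2$. **With $e_1\cdot e_1=e_2$:** - $NP40_{\alpha,\beta}$ ($\alpha\ne\beta$): $e_1\circ e_1=e_1,\ e_1\circ e_2=\alpha e_2,\ e_1\circ e_3=\beta e_3,\ e_2\circ e_1=e_2,\ e_3\circ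 e_1=e_3$. - $NP41_{\alpha}$: $e_1\circ e_1=e_1,\ e_1\circ e_2=\alpha e_2,\ e_1\circ e_3=e_2+\alpha e_3,\ e_2\circ e_1=e_2,\ e_3\circ e_1=e_3$. - $NP42_{\alpha}$: $e_1\circ e_1=e_1,\ e_1\circ e_2=\alpha e_2,\ e_1\circ e_3=\alpha e_3,\ e_2\circ e_1=e_2,\ e_3\circ e_1=e_3$. - $NP43_{\alpha,\beta}$ ($\alpha\ne0$): $e_1\circ e_1=e_1+\alpha e_2,\ e_1\circ e_3=\beta e_3,\ e_2\circ e_1=e_2,\ e_3\circ e_1=e_3$. - $NP44_{\alpha,\beta}$ ($\beta\ne0$): $e_1\circ e_1=e_1,\ e_1\circ e_2=\alpha e_2+e_3,\ e_1\circ e_3=\beta e_2,\ e_2\circ e_1=e_2,\ e_3\circ e_1=e_3$. - $NP45_{\alpha,\beta}$: $e_1\circ e_1=e_1+\alpha e_2,\ e_1\circ e_2=\beta e_2+e_3,\ e_2\circ e_1=e_2,\ e_3\circ e_1=e_3$. - $NP46_{\alpha}$ ($\alpha\ne0$): $e_1\circ e_1=e_1+e_3,\ e_1\circ e_2=\alpha e_2,\ e_2\circ e_1=e_2,\ e_3\circ e_1=e_3$. - $NP47_{\alpha}$: $e_1\circ e_1=e_1+e_3,\ e_1\circ e_3=\alpha e_2,\ e_2\circ e_1=e_2,\ e_3\circ e_1=e_3$. - $NP48_{\alpha}$: $e_1\circ e_1=\alpha e_2,\ e_1\circ e_2=e_3,\ e_1\circ e_3=e_3$. - $NP49_{\alpha}$: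 $e_1\circ e_2=e_2,\ e_1\circ e_3=\alpha e_3$. - $NP50$: $e_1\circ e_2=e_2,\ e_1\circ e_3=e_2+e_3$. - $NP51_{\alpha}$: $e_1\circ e_1=\alpha e_2,\ e_1\circ e_3=e_3$. - $NP52_{\alpha}$: $e_1\circ e_2=\alpha e_2+e_3,\ e_1\circ e_3=e_2$. - $NP53$: $e_1\circ e_1=e_3,\ e_1\circ e_3=e_2$. - $NP54$: $e_1\circ e_3=e_2$. - $NP55_{\alpha}$: $e_1\circ e_1=\alpha e_2,\ e_1\circ e_2=e_3$. - $NP56$: $e_1\circ e_1=e_3,\ e_1\circ e_2=e_2$. - $NP57$: $e_1\circ e_1=e_3$. - $NP58_{\alpha}$: $e_1\circ e_1=\alpha e_2$. - $NP59_{\alpha}$: $e_1\circ e_1=\alpha e_2,\ e_1\circ e_3=e_1+e_2,\ e_2\circ e_3=e_2,\ e_3\circ e_2=-e_2,\ e_3\circ e_3=e_3$. - $NP60_{\alpha}$: $e_1\circ e_1=\alpha e_2,\ e_1\circ e_3=e_1,\ e_2\circ e_3=e_2,\ e_3\circ e_2=-e_2,\ e_3\circ e_3=e_3$. - $NP61_{\alpha}$ ($\alpha\ne1,2$): $e_1\circ e_1=\alpha e_1,\ e_1\circ e_2=(2-\alpha)e_2,\ e_1\circ e_3=e_3,\ e_2\circ e_1=\alpha e_2,\ e_3\circ e_1=\alpha e_3,\ e_3\circ e_3=e_2$. - $NP62_{\alpha}$: $e_1\circ e_1=e_1,\ e_1\circ e_2=e_2,\ e_1\circ e_3=\alpha e_2+e_3,\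 e_2\circ e_1=e_2,\ e_3\circ e_1=e_3,\ e_3\circ e_3=e_2$. - $NP63_{\alpha}$: $e_1\circ e_1=2e_1+\alpha e_2,\ e_1\circ e_3=e_3,\ e_2\circ e_1=2e_2,\ e_3\circ e_1=2e_3,\ e_3\circ e_3=e_2$. - $NP64$: $e_1\circ e_1=e_1,\ e_1\circ e_2=-e_2,\ e_2\circ e_1=e_2,\ e_3\circ e_1=e_3,\ e_3\circ e_3=e_2$. - $NP65_{\alpha,\beta}$: $e_1\circ e_1=\alpha e_2,\ e_1\circ e_3=\beta e_2,\ e_3\circ e_3=e_2$. - $NP66_{\alpha}$: $e_1\circ e_1=\alpha e_1,\ e_1\circ e_2=e_2,\ e_2\circ e_1=\alpha e_2,\ e_3\circ e_3=e_3$. - $NP67_{\alpha}$: $e_1\circ e_1=e_1+\alpha e_2,\ e_2\circ e_1=e_2,\ e_3\circ e_3=e_3$. - $NP68_{\alpha}$: $e_1\circ e_1=\alpha e_2,\ e_3\circ e_3=e_3$. - $NP69_{\alpha}$: $e_1\circ e_1=e_1+\alpha e_3,\ e_1\circ e_2=-e_2,\ e_2\circ e_1=e_2,\ e_3\circ e_1=e_2+e_3$. - $NP70_{\alpha}$: $e_1\circ e_1=e_3,\ e_1\circ e_3=\alpha e_2,\ e_3\circ e_1=e_2$. - $NP71_{\alpha}$ ($\alpha\ne-1$): $e_1\circ e_3=\alpha e_2,\ e_3\circ e_1=e_2$. - $NP72_{\alpha}$: $e_1\circ e_1=\alpha e_2,\ e_1\circ e_3=-e_2,\ e_3\circ e_1=e_2$.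 - $NP73_{\alpha}$ ($\alpha\ne0$): $e_1\circ e_1=e_1,\ e_1\circ e_2=\alpha e_2,\ e_2\circ e_1=e_2$. - $NP74_{\alpha}$: $e_1\circ e_1=e_1+\alpha e_2,\ e_2\circ e_1=e_2$. Moreover, within each family (for parameter values satisfying the indicated restrictions) the isomorphisms are as follows. - $NP01_{\alpha_1,\beta_1}\cong NP01_{\alpha_2,\beta_2}$ iff $(\alpha_1,\beta_1)=(\alpha_2,\beta_2)$ or $(\alpha_1,\beta_1)=(-\beta_2,-\alpha_2)$. - $NP04_{\alpha_1,\beta_1,0}\cong NP04_{\alpha_2,\beta_2,0}$ iff $(\alpha_1,\beta_1)=(\alpha_2,\beta_2)$; and for $\gamma_1,\gamma_2\ne0$, $NP04_{\alpha_1,\beta_1,\gamma_1}\cong NP04_{\alpha_2,\beta_2,\gamma_2}$ iff $(\alpha_1,\beta_1,\gamma_1)=(\alpha_2,\beta_2,\gamma_2)$ or $(\alpha_1,\beta_1,\gamma_1)=(\beta_2,\alpha_2,\gamma_2)$. - For each of the families $NP05$, $NP28$, $NP29$: the algebras with parameters $(\alpha_1,\beta_1)$ and $(\alpha_2,\beta_2)$ are isomorphic iff $(\alpha_1,\beta_1)=(\alpha_2,\beta_2)$ or $(\alpha_1,\beta_1)=(\beta_2,\alpha_2)$. - For each of the families $NP22$, $NP65$: the algebras with parameters $(\alpha_1,\beta_1)$ and $(\alpha_2,\beta_2)$ are isomorphic iff $\alpha_1=\alpha_2$ and $\beta_1=\pm\beta_2$. - $NP25_{\alpha_1,\beta_1,\gamma_1}\cong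 NP25_{\alpha_2,\beta_2,\gamma_2}$ iff $(\alpha_1,\beta_1,\gamma_1)$ is a permutation of $(\alpha_2,\beta_2,\gamma_2)$. - For each of the families $NP52$, $NP62$: the algebras with parameters $\alpha_1$ and $\alpha_2$ are isomorphic iff $\alpha_1=\pm\alpha_2$. - For every other family that depends on parameters, two members are isomorphic iff their parameter tuples are equal.
   Context: A Novikov algebra is a vector space with a bilinear product $\circ$ such that, for all $x,y,z$, $(x\circ y)\circ z-x\circ(y\circ z)=(y\circ x)\circ z-y\circ(x\circ z)$ and $(x\circ y)\circ z=(x\circ z)\circ y$. A Novikov--Poisson algebra is a triple $(A,\cdot,\circ)$ where $(A,\cdot)$ is a commutative associative algebra (not necessarily unital), $(A,\circ)$ is a Novikov algebra, and for all $x,y,z\in A$: $(x\cdot y)\circ z=x\cdot(y\circ z)$ and $(x\circ y)\cdot z-(y\circ x)\cdot z=x\circ(y\cdot z)-y\circ(x\cdot z)$. An isomorphism of Novikov--Poisson algebras is a linear bijection preserving both products $\cdot$ and $\circ$. All algebras are over $\mathbb C$. In the list, the products $\cdot$ are grouped: each bold heading gives the nonzero products $\cdot$ of basis elements (extended commutatively) shared by all families beneath it, up to the next bold heading. *)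

(* Defs.v *)
From HB Require Import structures.
From mathcomp Require Import all_boot all_order all_algebra.
From mathcomp Require Import reals complex.

Set Implicit Arguments.
Unset Strict Implicit.
Unset Printing Implicit Defensive.

Import GRing.Theory.
Local Open Scope ring_scope.

Definition bilinear_product (K : fieldType) (V : lmodType K)
    (m : V -> V -> V) : Prop :=
  (forall z, linear (m^~ z)) /\ (forall z, linear (m z)).

Definition novikov (K : fieldType) (V : lmodType K)
    (circ : V -> V -> V) : Prop :=
  [/\ bilinear_product circ,
      forall x y z, circ (circ x y) z - circ x (circ y z) =
                    circ (circ y x) z - circ y (circ x z)
    & forall x y z, circ (circ x y) z = circ (circ x z) y].

Definition novikov_poisson (K : fieldType) (V : lmodType K)
    (dot circ : V -> V -> V) : Prop :=
  [/\ [/\ bilinear_product dot, commutative dot & associative dot],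
      novikov circ,
      forall x y z, circ (dot x y) z = dot x (circ y z)
    & forall x y z, dot (circ x y) z - dot (circ y x) z =
                    circ x (dot y z) - circ y (dot x z)].

Definition np_isomorphic (K : fieldType) (V W : lmodType K)
    (dot circ : V -> V -> V) (dot' circ' : W -> W -> W) : Prop :=
  exists f : {linear V -> W},
    [/\ bijective f,
        {morph f : x y / dot x y >-> dot' x y}
      & {morph f : x y / circ x y >-> circ' x y}].

Definition i1 : 'I_3 := @Ordinal 3 0 isT.
Definition i2 : 'I_3 := @Ordinal 3 1 isT.
Definition i3 : 'I_3 := @Ordinal 3 2 isT.

Local Notation e1 := (delta_mx 0 i1).
Local Notation e2 := (delta_mx 0 i2).
Local Notation e3 := (delta_mx 0 i3).

(* An entry (i, j, v) says that the product of the i-th and the j-th basis    *)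
(* vectors of K^3 is v; pairs (i, j) without an entry have product zero.      *)
Definition prod_table (K : fieldType) := seq ('I_3 * 'I_3 * 'rV[K]_3).

Definition table_mul (K : fieldType) (t : prod_table K)
    (x y : 'rV[K]_3) : 'rV[K]_3 :=
  \sum_(ijv <- t) (x 0 ijv.1.1 * y 0 ijv.1.2) *: ijv.2.

(* Adds the mirror image (j, i, v) of each off-diagonal entry (i, j, v).      *)
Definition table_sym (K : fieldType) (t : prod_table K) : prod_table K :=
  t ++ [seq (ijv.1.2, ijv.1.1, ijv.2) | ijv <- t & ijv.1.1 != ijv.1.2].

Inductive np_family (K : Type) : Type :=
| NP01 of K & K
| NP02 of K
| NP03 of K
| NP04 of K & K & K
| NP05 of K & K
| NP06 of K & K
| NP07 of K & K
| NP08 of K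
| NP09 of K & K
| NP10 of K
| NP11 of K & K & K
| NP12 of K & K & K
| NP13 of K & K
| NP14 of K & K & K
| NP15 of K & K
| NP16 of K & K
| NP17 of K & K
| NP18 of K & K
| NP19 of K & K
| NP20 of K & K & K
| NP21 of K & K
| NP22 of K & K
| NP23 of K & K
| NP24 of K
| NP25 of K & K & K
| NP26 of K & K & K
| NP27 of K & K & K
| NP28 of K & K
| NP29 of K & K
| NP30 of K & K
| NP31 of K & K
| NP32 of K & K
| NP33 of K & K
| NP34 of K
| NP35 of K
| NP36 of K
| NP37 of K
| NP38 of K
| NP39 of K
| NP40 of K & K
| NP41 of K
| NP42 of K
| NP43 of K & K
| NP44 of K & K
| NP45 of K & K
| NP46 of K
| NP47 of K
| NP48 of K
| NP49 of K
| NP50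
| NP51 of K
| NP52 of K
| NP53
| NP54
| NP55 of K
| NP56
| NP57
| NP58 of K
| NP59 of K
| NP60 of K
| NP61 of K
| NP62 of K
| NP63 of K
| NP64
| NP65 of K & K
| NP66 of K
| NP67 of K
| NP68 of K
| NP69 of K
| NP70 of K
| NP71 of K
| NP72 of K
| NP73 of K
| NP74 of K.

Arguments NP50 {K}.
Arguments NP53 {K}.
Arguments NP54 {K}.
Arguments NP56 {K}.
Arguments NP57 {K}.
Arguments NP64 {K}.

Definition np_index (K : Type) (p : np_family K) : nat :=
  match p with
  | NP01 _ _ => 1
  | NP02 _ => 2
  | NP03 _ => 3
  | NP04 _ _ _ => 4
  | NP05 _ _ => 5
  | NP06 _ _ => 6
  | NP07 _ _ => 7
  | NP08 _ => 8
  | NP09 _ _ => 9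
  | NP10 _ => 10
  | NP11 _ _ _ => 11
  | NP12 _ _ _ => 12
  | NP13 _ _ => 13
  | NP14 _ _ _ => 14
  | NP15 _ _ => 15
  | NP16 _ _ => 16
  | NP17 _ _ => 17
  | NP18 _ _ => 18
  | NP19 _ _ => 19
  | NP20 _ _ _ => 20
  | NP21 _ _ => 21
  | NP22 _ _ => 22
  | NP23 _ _ => 23
  | NP24 _ => 24
  | NP25 _ _ _ => 25
  | NP26 _ _ _ => 26
  | NP27 _ _ _ => 27
  | NP28 _ _ => 28
  | NP29 _ _ => 29
  | NP30 _ _ => 30
  | NP31 _ _ => 31
  | NP32 _ _ => 32
  | NP33 _ _ => 33
  | NP34 _ => 34
  | NP35 _ => 35
  | NP36 _ => 36
  | NP37 _ => 37
  | NP38 _ => 38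
  | NP39 _ => 39
  | NP40 _ _ => 40
  | NP41 _ => 41
  | NP42 _ => 42
  | NP43 _ _ => 43
  | NP44 _ _ => 44
  | NP45 _ _ => 45
  | NP46 _ => 46
  | NP47 _ => 47
  | NP48 _ => 48
  | NP49 _ => 49
  | NP50 => 50
  | NP51 _ => 51
  | NP52 _ => 52
  | NP53 => 53
  | NP54 => 54
  | NP55 _ => 55
  | NP56 => 56
  | NP57 => 57
  | NP58 _ => 58
  | NP59 _ => 59
  | NP60 _ => 60
  | NP61 _ => 61
  | NP62 _ => 62
  | NP63 _ => 63
  | NP64 => 64
  | NP65 _ _ => 65
  | NP66 _ => 66
  | NP67 _ => 67
  | NP68 _ => 68
  | NP69 _ => 69
  | NP70 _ => 70
  | NP71 _ => 71
  | NP72 _ => 72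
  | NP73 _ => 73
  | NP74 _ => 74
  end.

Definition np_admissible (K : fieldType) (p : np_family K) : bool :=
  match p with
  | NP06 a _ => a != 2
  | NP22 _ b => b != 0
  | NP40 a b => a != b
  | NP43 a _ => a != 0
  | NP44 _ b => b != 0
  | NP46 a => a != 0
  | NP61 a => (a != 1) && (a != 2)
  | NP71 a => a != -1
  | NP73 a => a != 0
  | _ => true
  end.

Definition np_dot_table (K : fieldType) (p : np_family K) : prod_table K :=
  match p with
  | NP01 _ _ | NP02 _ | NP03 _ | NP04 _ _ _ | NP05 _ _ =>
      [:: (i1, i3, e2)]
  | NP06 _ _ | NP07 _ _ | NP08 _ | NP09 _ _ | NP10 _ =>
      [:: (i1, i1, e2); (i1, i2, e3)]
  | NP11 _ _ _ | NP12 _ _ _ | NP13 _ _ | NP14 _ _ _ | NP15 _ _ =>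
      [:: (i1, i3, e1); (i2, i3, e2); (i3, i3, e3)]
  | NP16 _ _ | NP17 _ _ | NP18 _ _ | NP19 _ _ =>
      [:: (i1, i3, e2); (i2, i3, e2); (i3, i3, e3)]
  | NP20 _ _ _ | NP21 _ _ | NP22 _ _ | NP23 _ _ | NP24 _ =>
      [:: (i1, i1, e2); (i1, i3, e1); (i2, i3, e2); (i3, i3, e3)]
  | NP25 _ _ _ =>
      [:: (i1, i1, e1); (i2, i2, e2); (i3, i3, e3)]
  | NP26 _ _ _ | NP27 _ _ _ =>
      [:: (i1, i1, e1); (i2, i2, e2); (i1, i3, e3)]
  | NP28 _ _ | NP29 _ _ =>
      [:: (i1, i1, e1); (i2, i2, e2)]
  | NP30 _ _ | NP31 _ _ | NP32 _ _ =>
      [:: (i1, i1, e1); (i2, i2, e3)]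
  | NP33 _ _ | NP34 _ | NP35 _ | NP36 _ | NP37 _ | NP38 _ | NP39 _ =>
      [:: (i1, i1, e1)]
  | NP40 _ _ | NP41 _ | NP42 _ | NP43 _ _ | NP44 _ _ | NP45 _ _ | NP46 _
  | NP47 _ | NP48 _ | NP49 _ | NP50 | NP51 _ | NP52 _ | NP53 | NP54 | NP55 _
  | NP56 | NP57 | NP58 _ | NP59 _ | NP60 _ | NP61 _ | NP62 _ | NP63 _ | NP64
  | NP65 _ _ | NP66 _ | NP67 _ | NP68 _ | NP69 _ | NP70 _ | NP71 _ | NP72 _
  | NP73 _ | NP74 _ =>
      [:: (i1, i1, e2)]
  end.

Definition np_circ_table (K : fieldType) (p : np_family K) : prod_table K :=
  match p with
  | NP01 a b =>
      [:: (i1, i1, e1); (i1, i2, - e2); (i1, i3, e1); (i2, i1, e2);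
          (i2, i3, e2); (i3, i1, a *: e2 + e3); (i3, i2, - e2);
          (i3, i3, b *: e2 + e3)]
  | NP02 a =>
      [:: (i1, i1, e1); (i1, i2, - e2); (i2, i1, e2); (i3, i1, a *: e2 + e3);
          (i3, i3, e2)]
  | NP03 a =>
      [:: (i1, i1, e1); (i1, i2, - e2); (i2, i1, e2); (i3, i1, a *: e2 + e3)]
  | NP04 a b c =>
      [:: (i1, i1, e2); (i1, i3, a *: e2); (i3, i1, b *: e2); (i3, i3, c *: e2)]
  | NP05 a b => [:: (i1, i3, a *: e2); (i3, i1, b *: e2)]
  | NP06 a b =>
      [:: (i1, i1, a *: e1); (i1, i2, e2 + b *: e3); (i1, i3, (2 - a) *: e3);
          (i2, i1, a *: e2); (i2, i2, e3); (i3, i1, a *: e3)]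
  | NP07 a b =>
      [:: (i1, i1, 2 *: e1 + a *: e3); (i1, i2, e2 + b *: e3);
          (i2, i1, 2 *: e2); (i2, i2, e3); (i3, i1, 2 *: e3)]
  | NP08 a =>
      [:: (i1, i1, e1 + a *: e2); (i1, i3, - e3); (i2, i1, e2 + a *: e3);
          (i3, i1, e3)]
  | NP09 a b => [:: (i1, i1, a *: e2); (i1, i2, b *: e3); (i2, i1, a *: e3)]
  | NP10 a =>
      [:: (i1, i1, a *: e2 + e3); (i1, i2, a *: e3); (i2, i1, a *: e3)]
  | NP11 a b c =>
      [:: (i1, i3, a *: e1); (i2, i3, a *: e2); (i3, i1, e2);
          (i3, i2, b *: e1 + c *: e2); (i3, i3, e1 + a *: e3)]
  | NP12 a b c =>
      [:: (i1, i3, a *: e1); (i2, i3, a *: e2); (i3, i1, b *: e1);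
          (i3, i2, e1 + c *: e2); (i3, i3, e1 + a *: e3)]
  | NP13 a b =>
      [:: (i1, i3, a *: e1); (i2, i3, a *: e2); (i3, i1, b *: e1);
          (i3, i2, b *: e2); (i3, i3, e1 + a *: e3)]
  | NP14 a b c =>
      [:: (i1, i3, a *: e1); (i2, i3, a *: e2); (i3, i1, b *: e2);
          (i3, i2, e1 + c *: e2); (i3, i3, a *: e3)]
  | NP15 a b =>
      [:: (i1, i3, a *: e1); (i2, i3, a *: e2); (i3, i1, b *: e1);
          (i3, i2, b *: e2); (i3, i3, a *: e3)]
  | NP16 a b =>
      [:: (i1, i1, - e1 + e2); (i1, i3, a *: e2); (i2, i3, a *: e2);
          (i3, i1, b *: e2); (i3, i2, b *: e2); (i3, i3, e2 + a *: e3)]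
  | NP17 a b =>
      [:: (i1, i3, a *: e2); (i2, i3, a *: e2); (i3, i1, b *: e2);
          (i3, i2, b *: e2); (i3, i3, e2 + a *: e3)]
  | NP18 a b =>
      [:: (i1, i1, - e1 + e2); (i1, i3, a *: e2); (i2, i3, a *: e2);
          (i3, i1, b *: e2); (i3, i2, b *: e2); (i3, i3, a *: e3)]
  | NP19 a b =>
      [:: (i1, i3, a *: e2); (i2, i3, a *: e2); (i3, i1, b *: e2);
          (i3, i2, b *: e2); (i3, i3, a *: e3)]
  | NP20 a b c =>
      [:: (i1, i1, ((a + b) / 2) *: e2); (i1, i3, b *: e1 + e2);
          (i2, i3, b *: e2); (i3, i1, ((a + b) / 2) *: e1 + c *: e2);
          (i3, i2, a *: e2); (i3, i3, e1 + b *: e3)]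
  | NP21 a b =>
      [:: (i1, i1, ((a + b) / 2) *: e2); (i1, i3, b *: e1); (i2, i3, b *: e2);
          (i3, i1, ((a + b) / 2) *: e1); (i3, i2, a *: e2);
          (i3, i3, e2 + b *: e3)]
  | NP22 a b =>
      [:: (i1, i1, a *: e2); (i1, i3, a *: e1); (i2, i3, a *: e2);
          (i3, i1, a *: e1 + b *: e2); (i3, i2, a *: e2); (i3, i3, e2 + a *: e3)]
  | NP23 a b =>
      [:: (i1, i1, ((a + b) / 2) *: e2); (i1, i3, a *: e1); (i2, i3, a *: e2);
          (i3, i1, ((a + b) / 2) *: e1); (i3, i2, b *: e2); (i3, i3, a *: e3)]
  | NP24 a =>
      [:: (i1, i1, a *: e2); (i1, i3, a *: e1); (i2, i3, a *: e2);
          (i3, i1, a *: e1 + e2); (i3, i2, a *: e2); (i3, i3, a *: e3)]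
  | NP25 a b c => [:: (i1, i1, a *: e1); (i2, i2, b *: e2); (i3, i3, c *: e3)]
  | NP26 a b c =>
      [:: (i1, i1, a *: e1 + e3); (i1, i3, b *: e3); (i2, i2, c *: e2);
          (i3, i1, a *: e3)]
  | NP27 a b c =>
      [:: (i1, i1, a *: e1); (i1, i3, b *: e3); (i2, i2, c *: e2);
          (i3, i1, a *: e3)]
  | NP28 a b => [:: (i1, i1, a *: e1); (i2, i2, b *: e2); (i3, i3, e3)]
  | NP29 a b => [:: (i1, i1, a *: e1); (i2, i2, b *: e2)]
  | NP30 a b =>
      [:: (i1, i1, a *: e1); (i2, i2, b *: e2); (i2, i3, e3); (i3, i2, b *: e3)]
  | NP31 a b => [:: (i1, i1, a *: e1); (i2, i2, e2 + b *: e3); (i3, i2, e3)]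
  | NP32 a b => [:: (i1, i1, a *: e1); (i2, i2, b *: e3)]
  | NP33 a b =>
      [:: (i1, i1, a *: e1); (i2, i2, b *: e2); (i2, i3, e3); (i3, i2, b *: e3)]
  | NP34 a => [:: (i1, i1, a *: e1); (i2, i2, e2 + e3); (i3, i2, e3)]
  | NP35 a => [:: (i1, i1, a *: e1); (i2, i2, e2); (i3, i2, e3)]
  | NP36 a => [:: (i1, i1, a *: e1); (i2, i2, e3)]
  | NP37 a => [:: (i1, i1, a *: e1)]
  | NP38 a => [:: (i1, i1, a *: e1); (i2, i2, e2); (i3, i3, e3)]
  | NP39 a => [:: (i1, i1, a *: e1); (i2, i2, e2)]
  | NP40 a b =>
      [:: (i1, i1, e1); (i1, i2, a *: e2); (i1, i3, b *: e3); (i2, i1, e2);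
          (i3, i1, e3)]
  | NP41 a =>
      [:: (i1, i1, e1); (i1, i2, a *: e2); (i1, i3, e2 + a *: e3);
          (i2, i1, e2); (i3, i1, e3)]
  | NP42 a =>
      [:: (i1, i1, e1); (i1, i2, a *: e2); (i1, i3, a *: e3); (i2, i1, e2);
          (i3, i1, e3)]
  | NP43 a b =>
      [:: (i1, i1, e1 + a *: e2); (i1, i3, b *: e3); (i2, i1, e2); (i3, i1, e3)]
  | NP44 a b =>
      [:: (i1, i1, e1); (i1, i2, a *: e2 + e3); (i1, i3, b *: e2);
          (i2, i1, e2); (i3, i1, e3)]
  | NP45 a b =>
      [:: (i1, i1, e1 + a *: e2); (i1, i2, b *: e2 + e3); (i2, i1, e2);
          (i3, i1, e3)]
  | NP46 a =>
      [:: (i1, i1, e1 + e3); (i1, i2, a *: e2); (i2, i1, e2); (i3, i1, e3)]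
  | NP47 a =>
      [:: (i1, i1, e1 + e3); (i1, i3, a *: e2); (i2, i1, e2); (i3, i1, e3)]
  | NP48 a => [:: (i1, i1, a *: e2); (i1, i2, e3); (i1, i3, e3)]
  | NP49 a => [:: (i1, i2, e2); (i1, i3, a *: e3)]
  | NP50 => [:: (i1, i2, e2); (i1, i3, e2 + e3)]
  | NP51 a => [:: (i1, i1, a *: e2); (i1, i3, e3)]
  | NP52 a => [:: (i1, i2, a *: e2 + e3); (i1, i3, e2)]
  | NP53 => [:: (i1, i1, e3); (i1, i3, e2)]
  | NP54 => [:: (i1, i3, e2)]
  | NP55 a => [:: (i1, i1, a *: e2); (i1, i2, e3)]
  | NP56 => [:: (i1, i1, e3); (i1, i2, e2)]
  | NP57 => [:: (i1, i1, e3)]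
  | NP58 a => [:: (i1, i1, a *: e2)]
  | NP59 a =>
      [:: (i1, i1, a *: e2); (i1, i3, e1 + e2); (i2, i3, e2); (i3, i2, - e2);
          (i3, i3, e3)]
  | NP60 a =>
      [:: (i1, i1, a *: e2); (i1, i3, e1); (i2, i3, e2); (i3, i2, - e2);
          (i3, i3, e3)]
  | NP61 a =>
      [:: (i1, i1, a *: e1); (i1, i2, (2 - a) *: e2); (i1, i3, e3);
          (i2, i1, a *: e2); (i3, i1, a *: e3); (i3, i3, e2)]
  | NP62 a =>
      [:: (i1, i1, e1); (i1, i2, e2); (i1, i3, a *: e2 + e3); (i2, i1, e2);
          (i3, i1, e3); (i3, i3, e2)]
  | NP63 a =>
      [:: (i1, i1, 2 *: e1 + a *: e2); (i1, i3, e3); (i2, i1, 2 *: e2);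
          (i3, i1, 2 *: e3); (i3, i3, e2)]
  | NP64 =>
      [:: (i1, i1, e1); (i1, i2, - e2); (i2, i1, e2); (i3, i1, e3); (i3, i3, e2)]
  | NP65 a b => [:: (i1, i1, a *: e2); (i1, i3, b *: e2); (i3, i3, e2)]
  | NP66 a =>
      [:: (i1, i1, a *: e1); (i1, i2, e2); (i2, i1, a *: e2); (i3, i3, e3)]
  | NP67 a => [:: (i1, i1, e1 + a *: e2); (i2, i1, e2); (i3, i3, e3)]
  | NP68 a => [:: (i1, i1, a *: e2); (i3, i3, e3)]
  | NP69 a =>
      [:: (i1, i1, e1 + a *: e3); (i1, i2, - e2); (i2, i1, e2);
          (i3, i1, e2 + e3)]
  | NP70 a => [:: (i1, i1, e3); (i1, i3, a *: e2); (i3, i1, e2)]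
  | NP71 a => [:: (i1, i3, a *: e2); (i3, i1, e2)]
  | NP72 a => [:: (i1, i1, a *: e2); (i1, i3, - e2); (i3, i1, e2)]
  | NP73 a => [:: (i1, i1, e1); (i1, i2, a *: e2); (i2, i1, e2)]
  | NP74 a => [:: (i1, i1, e1 + a *: e2); (i2, i1, e2)]
  end.

Definition np_dot (K : fieldType) (p : np_family K) :
    'rV[K]_3 -> 'rV[K]_3 -> 'rV[K]_3 :=
  table_mul (table_sym (np_dot_table p)).

Definition np_circ (K : fieldType) (p : np_family K) :
    'rV[K]_3 -> 'rV[K]_3 -> 'rV[K]_3 :=
  table_mul (np_circ_table p).

(* The parameter condition for two members of the same family to be           *)
(* isomorphic; only its values on pairs from the same family matter.  The     *)
(* parameterless families fall under the default clause, where p = q is       *)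
(* automatic.                                                                 *)
Definition np_same_class (K : fieldType) (p q : np_family K) : Prop :=
  match p, q with
  | NP01 a1 b1, NP01 a2 b2 =>
      (a1, b1) = (a2, b2) \/ (a1, b1) = (- b2, - a2)
  | NP04 a1 b1 c1, NP04 a2 b2 c2 =>
      [/\ c1 = 0, c2 = 0 & (a1, b1) = (a2, b2)] \/
      [/\ c1 <> 0, c2 <> 0
        & (a1, b1, c1) = (a2, b2, c2) \/ (a1, b1, c1) = (b2, a2, c2)]
  | NP05 a1 b1, NP05 a2 b2
  | NP28 a1 b1, NP28 a2 b2
  | NP29 a1 b1, NP29 a2 b2 =>
      (a1, b1) = (a2, b2) \/ (a1, b1) = (b2, a2)
  | NP22 a1 b1, NP22 a2 b2
  | NP65 a1 b1, NP65 a2 b2 =>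
      a1 = a2 /\ (b1 = b2 \/ b1 = - b2)
  | NP25 a1 b1 c1, NP25 a2 b2 c2 =>
      perm_eq [:: a1; b1; c1] [:: a2; b2; c2]
  | NP52 a1, NP52 a2
  | NP62 a1, NP62 a2 =>
      a1 = a2 \/ a1 = - a2
  | _, _ => p = q
  end.

(* Main.v *)
(** The commutative associative products on a 3-dimensional space fall into eleven
    nonzero isomorphism classes: a nilpotent product is found from a nonzero square
    or cube, and any other product has a nonzero idempotent, along which the algebra
    splits.  For a fixed product the two mixed identities are linear in [circ], and
    solving them leaves an explicit family of candidates for [circ].  The automorphism
    group of the product acts on these candidates; the Novikov identities and explicit
    changes of basis bring each of them to one of the listed tables.  Conversely, an
    isomorphism between two members of a family is an automorphism of their common
    product, so that comparing entries gives polynomial equations from which the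
    relation between the parameters follows. *)
Require Import Defs.
From HB Require Import structures.
From mathcomp Require Import all_boot all_order all_algebra.
From mathcomp Require Import reals complex boolp ring.
From Stdlib Require NsatzTactic.

Set Implicit Arguments.
Unset Strict Implicit.
Unset Printing Implicit Defensive.

Import Order.TTheory GRing.Theory Num.Theory.
Local Open Scope ring_scope.

(** * Multiplication tables in coordinates *)

(** The obstacle is the number of tables, so every argument is made once per product and not once
    per family. Each table is an instance of the general form of its product; one system of
    equations between two sets of parameters, coming from the automorphisms of that product,
    therefore serves all its families. [nsatz] extracts the relation wanted, with a variable such as
    [il] recording that a scale is invertible. In the other direction, the entries of a normalizing
    frame are found by solving the same equations for the automorphism.

    For [LineNull] and [Sq], where most of the space multiplies to zero, the mixed identities leave
    many parameters, and the Novikov identities steer the case analysis.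

    Algebraic closure enters twice. Eigenvectors are needed for multiplication operators, and square
    roots normalize coefficients that scale by a square; the two choices of a root cause the signs
    in [NP22], [NP52], [NP62] and [NP65]. *)

Lemma ord3P (P : 'I_3 -> Prop) : P i1 -> P i2 -> P i3 -> forall i, P i.
Proof.
move=> P1 P2 P3 [[|[|[|//]]] i_lt3].
- by rewrite (_ : Ordinal _ = i1) //; apply: val_inj.
- by rewrite (_ : Ordinal _ = i2) //; apply: val_inj.
- by rewrite (_ : Ordinal _ = i3) //; apply: val_inj.
Qed.

(* [vec], [vtable] and [vmul] mirror ['rV_3], [prod_table] and [table_mul] on bare
   triples, where products compute by reduction. *)
Definition vec (K : Type) : Type := (K * K * K)%type.
Definition vtable (K : Type) := seq ('I_3 * 'I_3 * vec K).

Section Vectors.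
Variable K : fieldType.
Implicit Types (x y z : vec K) (t : vtable K).

Definition vadd x y : vec K := (x.1.1 + y.1.1, x.1.2 + y.1.2, x.2 + y.2).
Definition vscale (a : K) x : vec K := (a * x.1.1, a * x.1.2, a * x.2).
Definition crd x (i : 'I_3) : K :=
  match nat_of_ord i with 0 => x.1.1 | 1 => x.1.2 | _ => x.2 end.
Definition unit3 (i : 'I_3) : vec K :=
  match nat_of_ord i with 0 => (1, 0, 0) | 1 => (0, 1, 0) | _ => (0, 0, 1) end.

Definition vmul t x y : vec K :=
  foldr (fun e v => vadd (vscale (crd x e.1.1 * crd y e.1.2) e.2) v)
    (0, 0, 0) t.

Definition frame3 (T : Type) (u v w : T) (i : 'I_3) : T :=
  match nat_of_ord i with 0 => u | 1 => v | _ => w end.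

Definition vcomb (P : 'I_3 -> vec K) x : vec K :=
  vadd (vadd (vscale x.1.1 (P i1)) (vscale x.1.2 (P i2))) (vscale x.2 (P i3)).

Definition det3 (P : 'I_3 -> vec K) : K :=
  let: (a1, a2, a3) := P i1 in
  let: (b1, b2, b3) := P i2 in
  let: (c1, c2, c3) := P i3 in
  a1 * (b2 * c3 - b3 * c2) - a2 * (b1 * c3 - b3 * c1)
  + a3 * (b1 * c2 - b2 * c1).

Definition full_vtable (c : 'I_3 -> 'I_3 -> vec K) : vtable K :=
  [:: (i1, i1, c i1 i1); (i1, i2, c i1 i2); (i1, i3, c i1 i3);
      (i2, i1, c i2 i1); (i2, i2, c i2 i2); (i2, i3, c i2 i3);
      (i3, i1, c i3 i1); (i3, i2, c i3 i2); (i3, i3, c i3 i3)].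

End Vectors.

Arguments unit3 {K} i.

Ltac vsimpl :=
  cbv beta iota zeta
    delta [vmul foldr vadd vscale crd unit3 vcomb det3 frame3 fst snd
           nat_of_ord i1 i2 i3 full_vtable].
Ltac vsimpl_in H :=
  cbv beta iota zeta
    delta [vmul foldr vadd vscale crd unit3 vcomb det3 frame3 fst snd
           nat_of_ord i1 i2 i3 full_vtable] in H.

Lemma vec_eq (T : Type) (a b c a' b' c' : T) :
  a = a' -> b = b' -> c = c' -> (a, b, c) = (a', b', c').
Proof. by move=> -> -> ->. Qed.

Lemma vecP (T : Type) (a b c a' b' c' : T) :
  (a, b, c) = (a', b', c') -> [/\ a = a', b = b' & c = c'].
Proof. by case. Qed.

(** * Bases as bijective coordinate maps *)

Section Frames.
Variables (K : fieldType) (A : vectType K).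
Implicit Types (m : A -> A -> A) (w : 'I_3 -> A) (x y : vec K) (t : vtable K).

Definition lin w x : A := x.1.1 *: w i1 + x.1.2 *: w i2 + x.2 *: w i3.

Definition has_table w m t : Prop :=
  forall x y, m (lin w x) (lin w y) = lin w (vmul t x y).

Lemma lin_vadd w x y : lin w (vadd x y) = lin w x + lin w y.
Proof. by rewrite /lin /= !scalerDl; rewrite [RHS]addrACA; congr (_ + _); exact: addrACA. Qed.

Lemma lin_vscale w a x : lin w (vscale a x) = a *: lin w x.
Proof. by rewrite /lin /= !scalerDr !scalerA. Qed.

Lemma lin_vcomb w (P : 'I_3 -> vec K) x :
  lin (fun i => lin w (P i)) x = lin w (vcomb P x).
Proof. by rewrite /vcomb !lin_vadd !lin_vscale. Qed.

Lemma lin_unit3 w i : lin w (unit3 i) = w i.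
Proof.
by elim/ord3P: i; rewrite /lin /= !scale0r scale1r ?add0r ?addr0.
Qed.

Lemma vecE x : x = vadd (vadd (vscale x.1.1 (unit3 i1))
  (vscale x.1.2 (unit3 i2))) (vscale x.2 (unit3 i3)).
Proof. by case: x => [[a b] c]; vsimpl; apply: vec_eq; ring. Qed.

Lemma vmulDl t x y z : vmul t (vadd x y) z = vadd (vmul t x z) (vmul t y z).
Proof.
elim: t => [|[[i j] v] t IHt] /=; first by rewrite /vadd /= !addr0.
rewrite IHt (_ : crd (vadd x y) i = crd x i + crd y i); last first.
  by elim/ord3P: i.
by apply: vec_eq; rewrite /=; ring.
Qed.

Lemma vmulDr t x y z : vmul t x (vadd y z) = vadd (vmul t x y) (vmul t x z).
Proof.
elim: t => [|[[i j] v] t IHt] /=; first by rewrite /vadd /= !addr0.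
rewrite IHt (_ : crd (vadd y z) j = crd y j + crd z j); last first.
  by elim/ord3P: j.
by apply: vec_eq; rewrite /=; ring.
Qed.

Lemma vmulZl t a x y : vmul t (vscale a x) y = vscale a (vmul t x y).
Proof.
elim: t => [|[[i j] v] t IHt] /=; first by rewrite /vscale /= !mulr0.
rewrite IHt (_ : crd (vscale a x) i = a * crd x i); last by elim/ord3P: i.
by apply: vec_eq; rewrite /=; ring.
Qed.

Lemma vmulZr t a x y : vmul t x (vscale a y) = vscale a (vmul t x y).
Proof.
elim: t => [|[[i j] v] t IHt] /=; first by rewrite /vscale /= !mulr0.
rewrite IHt (_ : crd (vscale a y) j = a * crd y j); last by elim/ord3P: j.
by apply: vec_eq; rewrite /=; ring.
Qed.

Section Products.
Variable m : A -> A -> A.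
Hypothesis m_bil : bilinear_product m.

Lemma bilDl (u v z : A) : m (u + v) z = m u z + m v z.
Proof. by case: m_bil => L _; have := L z 1 u v; rewrite !scale1r. Qed.
Lemma bilDr (z u v : A) : m z (u + v) = m z u + m z v.
Proof. by case: m_bil => _ L; have := L z 1 u v; rewrite !scale1r. Qed.
Lemma bil0l (z : A) : m 0 z = 0.
Proof. by apply: (addrI (m 0 z)); rewrite -bilDl !addr0. Qed.
Lemma bil0r (z : A) : m z 0 = 0.
Proof. by apply: (addrI (m z 0)); rewrite -bilDr !addr0. Qed.
Lemma bilZl a (u z : A) : m (a *: u) z = a *: m u z.
Proof. by case: m_bil => L _; have := L z a u 0; rewrite /= bil0l !addr0. Qed.
Lemma bilZr a (z u : A) : m z (a *: u) = a *: m z u.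
Proof. by case: m_bil => _ L; have := L z a u 0; rewrite /= bil0r !addr0. Qed.
Lemma bilNl (u z : A) : m (- u) z = - m u z.
Proof. by rewrite -scaleN1r bilZl scaleN1r. Qed.
Lemma bilNr (u z : A) : m z (- u) = - m z u.
Proof. by rewrite -scaleN1r bilZr scaleN1r. Qed.

Lemma has_tableP w t :
    (forall i j, m (w i) (w j) = lin w (vmul t (unit3 i) (unit3 j))) ->
  has_table w m t.
Proof.
move=> mw x y; rewrite [in RHS](vecE x) [in RHS](vecE y).
rewrite !(vmulDl, vmulDr, vmulZl, vmulZr, lin_vadd, lin_vscale) -!mw.
by rewrite /lin !(bilDl, bilDr, bilZl, bilZr).
Qed.

(** [P] lists the new basis vectors in old coordinates; by bilinearity their nine products
    decide. *)
Lemma has_table_change w t (P : 'I_3 -> vec K) t' :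
    has_table w m t ->
    (forall i j, vmul t (P i) (P j) = vcomb P (vmul t' (unit3 i) (unit3 j))) ->
  has_table (fun i => lin w (P i)) m t'.
Proof.
by move=> wt tP; apply: has_tableP => i j; rewrite wt tP lin_vcomb.
Qed.

End Products.

Definition frame w : Prop := bijective (lin w).

Lemma vcomb_bij (P : 'I_3 -> vec K) : det3 P != 0 -> bijective (vcomb P).
Proof.
rewrite /det3 /vcomb.
case: (P i1) => [[a1 a2] a3]; case: (P i2) => [[b1 b2] b3].
case: (P i3) => [[c1 c2] c3] nzd.
(* The inverse is the adjugate matrix over the determinant. *)
exists (fun y => let d := a1 * (b2 * c3 - b3 * c2) - a2 * (b1 * c3 - b3 * c1)
  + a3 * (b1 * c2 - b2 * c1) in
 ((y.1.1 * (b2 * c3 - b3 * c2) + y.1.2 * (b3 * c1 - b1 * c3)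
    + y.2 * (b1 * c2 - b2 * c1)) / d,
  (y.1.1 * (a3 * c2 - a2 * c3) + y.1.2 * (a1 * c3 - a3 * c1)
    + y.2 * (a2 * c1 - a1 * c2)) / d,
  (y.1.1 * (a2 * b3 - a3 * b2) + y.1.2 * (a3 * b1 - a1 * b3)
    + y.2 * (a1 * b2 - a2 * b1)) / d));
move=> [[x y] z]; rewrite /vadd /vscale /=; apply: vec_eq; field; exact: nzd.
Qed.

(** The rows [Q (unit3 i)] form a matrix whose product with [P] is the identity, and [det3] is
    multiplicative, which [ring] checks on entries. *)
Lemma vcomb_det (P : 'I_3 -> vec K) : bijective (vcomb P) -> det3 P != 0.
Proof.
case=> Q _ PQ; suff : det3 (fun i => Q (unit3 i)) * det3 P = 1.
  by move=> dd; apply/eqP => d0; move/eqP: dd; rewrite d0 mulr0 eq_sym oner_eq0.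
have -> : det3 (fun i => Q (unit3 i)) * det3 P =
    det3 (fun i => vcomb P (Q (unit3 i))).
  rewrite /det3 /vcomb.
  case: (P i1) => [[a1 a2] a3]; case: (P i2) => [[b1 b2] b3].
  case: (P i3) => [[c1 c2] c3].
  case: (Q (unit3 i1)) => [[d1 d2] d3]; case: (Q (unit3 i2)) => [[g1 g2] g3].
  by case: (Q (unit3 i3)) => [[h1 h2] h3]; rewrite /vadd /vscale /=; ring.
by rewrite /det3 !PQ /unit3 /=; ring.
Qed.

Lemma frame_change w (P : 'I_3 -> vec K) :
  frame w -> det3 P != 0 -> frame (fun i => lin w (P i)).
Proof.
move=> bw /vcomb_bij bP; apply: (eq_bij (bij_comp bw bP)) => x.
by rewrite /= lin_vcomb.
Qed.

Lemma linE (u v w : A) a b c :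
  lin (frame3 u v w) (a, b, c) = a *: u + b *: v + c *: w.
Proof. by []. Qed.

Lemma free3P (u v w : A) :
  reflect (forall a b c, a *: u + b *: v + c *: w = 0 ->
             [/\ a = 0, b = 0 & c = 0])
          (free [:: u; v; w]).
Proof.
apply: (iffP (@freeP _ _ _ [tuple u; v; w])) => [free_uvw a b c abc0 | free_uvw k].
  have k0 : \sum_(i < 3) crd (a, b, c) i *: [:: u; v; w]`_i = 0.
    by rewrite !big_ord_recl big_ord0 addr0 addrA.
  by split; [have := free_uvw _ k0 i1 | have := free_uvw _ k0 i2
    | have := free_uvw _ k0 i3].
rewrite !big_ord_recl big_ord0 addr0 addrA => /free_uvw[k1 k2 k3].
elim/ord3P.
- by rewrite -k1; congr (k _); apply: val_inj.
- by rewrite -k2; congr (k _); apply: val_inj.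
- by rewrite -k3; congr (k _); apply: val_inj.
Qed.

Lemma free_frame (u v w : A) :
  \dim {:A} = 3%N -> free [:: u; v; w] -> frame (frame3 u v w).
Proof.
move=> dimA free_uvw.
have bas : basis_of fullv [tuple u; v; w].
  by rewrite basisEfree free_uvw subvf dimA.
have linK (x : A) : lin (frame3 u v w) (coord [tuple u; v; w] i1 x,
    coord [tuple u; v; w] i2 x, coord [tuple u; v; w] i3 x) = x.
  rewrite linE [RHS](coord_basis bas (memvf x)).
  rewrite !big_ord_recl big_ord0 addr0 addrA; congr (_ *: _ + _ *: _ + _ *: _).
  - by congr (coord _ _ _); apply: val_inj.
  - by congr (coord _ _ _); apply: val_inj.
  - by congr (coord _ _ _); apply: val_inj.
have /free3P inj0 := free_uvw.
have inj : injective (lin (frame3 u v w)).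
  move=> [[a b] c] [[a' b'] c'] /eqP; rewrite -subr_eq0 !linE => /eqP e0.
  have [|a0 b0 c0] := inj0 (a - a') (b - b') (c - c').
    rewrite -e0 !scalerBl !opprD [RHS]addrACA; congr (_ + _); exact: addrACA.
  by move/subr0_eq: a0 => ->; move/subr0_eq: b0 => ->; move/subr0_eq: c0 => ->.
exists (fun x : A => (coord [tuple u; v; w] i1 x, coord [tuple u; v; w] i2 x,
  coord [tuple u; v; w] i3 x)) => [y|]; last exact: linK.
by apply: inj; rewrite linK.
Qed.
End Frames.

(* [Hyp]: x z = y.  [Pow]: x, x^2, x^3.  [Loc]: unital, square-zero maximal ideal.
   [DualNull]: K[t]/t^2 with a null line.  [Trunc]: K[t]/t^3.  [Split]: K x K x K.
   [SplitDual]: K[t]/t^2 x K.  [SplitNull]: K x K with a null line.  [LineSq]: K with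
   w, w^2.  [LineNull]: K with a null plane.  [Sq]: x^2 and a null line. *)
Inductive dot_type := Hyp | Pow | Loc | DualNull | Trunc | Split | SplitDual |
  SplitNull | LineSq | LineNull | Sq.

(** * The listed algebras in coordinates, and isomorphism as a change of basis *)

Section Families.
Variable K : numFieldType.

Definition dot_vtable (k : dot_type) : vtable K :=
  match k with
  | Hyp => [:: (i1, i3, (0, 1, 0)); (i3, i1, (0, 1, 0))]
  | Pow =>
      [:: (i1, i1, (0, 1, 0)); (i1, i2, (0, 0, 1)); (i2, i1, (0, 0, 1))]
  | Loc =>
      [:: (i1, i3, (1, 0, 0)); (i2, i3, (0, 1, 0)); (i3, i3, (0, 0, 1));
          (i3, i1, (1, 0, 0)); (i3, i2, (0, 1, 0))]
  | DualNull =>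
      [:: (i1, i3, (0, 1, 0)); (i2, i3, (0, 1, 0)); (i3, i3, (0, 0, 1));
          (i3, i1, (0, 1, 0)); (i3, i2, (0, 1, 0))]
  | Trunc =>
      [:: (i1, i1, (0, 1, 0)); (i1, i3, (1, 0, 0)); (i2, i3, (0, 1, 0));
          (i3, i3, (0, 0, 1)); (i3, i1, (1, 0, 0)); (i3, i2, (0, 1, 0))]
  | Split => [:: (i1, i1, (1, 0, 0)); (i2, i2, (0, 1, 0)); (i3, i3, (0, 0, 1))]
  | SplitDual =>
      [:: (i1, i1, (1, 0, 0)); (i2, i2, (0, 1, 0)); (i1, i3, (0, 0, 1));
          (i3, i1, (0, 0, 1))]
  | SplitNull => [:: (i1, i1, (1, 0, 0)); (i2, i2, (0, 1, 0))]
  | LineSq => [:: (i1, i1, (1, 0, 0)); (i2, i2, (0, 0, 1))]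
  | LineNull => [:: (i1, i1, (1, 0, 0))]
  | Sq => [:: (i1, i1, (0, 1, 0))]
  end.

Definition np_dot_type (p : np_family K) : dot_type :=
  match p with
  | NP01 _ _ | NP02 _ | NP03 _ | NP04 _ _ _ | NP05 _ _ => Hyp
  | NP06 _ _ | NP07 _ _ | NP08 _ | NP09 _ _ | NP10 _ => Pow
  | NP11 _ _ _ | NP12 _ _ _ | NP13 _ _ | NP14 _ _ _ | NP15 _ _ => Loc
  | NP16 _ _ | NP17 _ _ | NP18 _ _ | NP19 _ _ => DualNull
  | NP20 _ _ _ | NP21 _ _ | NP22 _ _ | NP23 _ _ | NP24 _ => Trunc
  | NP25 _ _ _ => Split
  | NP26 _ _ _ | NP27 _ _ _ => SplitDual
  | NP28 _ _ | NP29 _ _ => SplitNull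
  | NP30 _ _ | NP31 _ _ | NP32 _ _ => LineSq
  | NP33 _ _ | NP34 _ | NP35 _ | NP36 _ | NP37 _ | NP38 _ | NP39 _ => LineNull
  | NP40 _ _ | NP41 _ | NP42 _ | NP43 _ _ | NP44 _ _ | NP45 _ _ | NP46 _ |
  NP47 _ | NP48 _ | NP49 _ | NP50 | NP51 _ | NP52 _ | NP53 | NP54 | NP55 _ |
  NP56 | NP57 | NP58 _ | NP59 _ | NP60 _ | NP61 _ | NP62 _ | NP63 _ | NP64 |
  NP65 _ _ | NP66 _ | NP67 _ | NP68 _ | NP69 _ | NP70 _ | NP71 _ | NP72 _ |
  NP73 _ | NP74 _ => Sq
  end.

(* [T_circ] parametrizes the products [circ] that satisfy the two identities mixing
   [circ] with the product of type [T]; these identities are linear in [circ]. *)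
Definition Hyp_circ (a b p q r s : K) : vtable K :=
  [:: (i1, i1, (a, p, 0)); (i1, i2, (0, - a, 0)); (i1, i3, (b, q, 0));
      (i2, i1, (0, a, 0)); (i2, i3, (0, b, 0)); (i3, i1, (0, r, a));
      (i3, i2, (0, - b, 0)); (i3, i3, (0, s, b))].

Definition Pow_circ (a b p q r : K) : vtable K :=
  [:: (i1, i1, (a, p, q)); (i1, i2, (0, b, r)); (i1, i3, (0, 0, 2 * b - a));
      (i2, i1, (0, a, p)); (i2, i2, (0, 0, b)); (i3, i1, (0, 0, a))].

Definition Loc_circ (a p q r s t u : K) : vtable K :=
  [:: (i1, i3, (a, 0, 0)); (i2, i3, (0, a, 0)); (i3, i1, (p, q, 0));
      (i3, i2, (r, s, 0)); (i3, i3, (t, u, a))].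

Definition DualNull_circ (a b p q : K) : vtable K :=
  [:: (i1, i1, (- p, p, 0)); (i1, i3, (0, a, 0)); (i2, i3, (0, a, 0));
      (i3, i1, (0, b, 0)); (i3, i2, (0, b, 0)); (i3, i3, (0, q, a))].

Definition Trunc_circ (a b p q r : K) : vtable K :=
  [:: (i1, i1, (0, (a + b) / 2, 0)); (i1, i3, (b, p, 0)); (i2, i3, (0, b, 0));
      (i3, i1, ((a + b) / 2, r, 0)); (i3, i2, (0, a, 0)); (i3, i3, (p, q, b))].

Definition Split_circ (a b c : K) : vtable K :=
  [:: (i1, i1, (a, 0, 0)); (i2, i2, (0, b, 0)); (i3, i3, (0, 0, c))].

Definition SplitDual_circ (a b c p : K) : vtable K :=
  [:: (i1, i1, (a, 0, p)); (i1, i3, (0, 0, b)); (i2, i2, (0, c, 0));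
      (i3, i1, (0, 0, a))].

Definition SplitNull_circ (a b c : K) : vtable K :=
  [:: (i1, i1, (a, 0, 0)); (i2, i2, (0, b, 0)); (i3, i3, (0, 0, c))].

Definition LineSq_circ (a b p q : K) : vtable K :=
  [:: (i1, i1, (a, 0, 0)); (i2, i2, (0, b, p)); (i2, i3, (0, 0, q));
      (i3, i2, (0, 0, b))].

Definition LineNull_circ (a p q r s t u v w : K) : vtable K :=
  [:: (i1, i1, (a, 0, 0)); (i2, i2, (0, p, q)); (i2, i3, (0, r, s));
      (i3, i2, (0, t, u)); (i3, i3, (0, v, w))].

Definition Sq_circ (a b p q r s t u v w x y : K) : vtable K :=
  [:: (i1, i1, (a, p, q)); (i1, i2, (0, r, s)); (i1, i3, (b, t, u));
      (i2, i1, (0, a, 0)); (i2, i3, (0, b, 0)); (i3, i1, (0, v, w));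
      (i3, i2, (0, - b, 0)); (i3, i3, (0, x, y))].

(** Each table is written as an instance of the general form of its product, so that lemmas on
    general forms apply to a family by conversion. Arguments follow the general form and not the
    list: [NP23] has its two parameters exchanged. *)
Definition np_circ_vtable (p : np_family K) : vtable K :=
  match p with
  | NP01 a b => Hyp_circ 1 1 0 0 a b
  | NP02 a => Hyp_circ 1 0 0 0 a 1
  | NP03 a => Hyp_circ 1 0 0 0 a 0
  | NP04 a b c => Hyp_circ 0 0 1 a b c
  | NP05 a b => Hyp_circ 0 0 0 a b 0
  | NP06 a b => Pow_circ a 1 0 0 b
  | NP07 a b => Pow_circ 2 1 0 a b
  | NP08 a => Pow_circ 1 0 a 0 0
  | NP09 a b => Pow_circ 0 0 a 0 b
  | NP10 a => Pow_circ 0 0 a 1 a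
  | NP11 a b c => Loc_circ a 0 1 b c 1 0
  | NP12 a b c => Loc_circ a b 0 1 c 1 0
  | NP13 a b => Loc_circ a b 0 0 b 1 0
  | NP14 a b c => Loc_circ a 0 b 1 c 0 0
  | NP15 a b => Loc_circ a b 0 0 b 0 0
  | NP16 a b => DualNull_circ a b 1 1
  | NP17 a b => DualNull_circ a b 0 1
  | NP18 a b => DualNull_circ a b 1 0
  | NP19 a b => DualNull_circ a b 0 0
  | NP20 a b c => Trunc_circ a b 1 0 c
  | NP21 a b => Trunc_circ a b 0 1 0
  | NP22 a b => Trunc_circ a a 0 1 b
  | NP23 a b => Trunc_circ b a 0 0 0
  | NP24 a => Trunc_circ a a 0 0 1
  | NP25 a b c => Split_circ a b c
  | NP26 a b c => SplitDual_circ a b c 1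
  | NP27 a b c => SplitDual_circ a b c 0
  | NP28 a b => SplitNull_circ a b 1
  | NP29 a b => SplitNull_circ a b 0
  | NP30 a b => LineSq_circ a b 0 1
  | NP31 a b => LineSq_circ a 1 b 0
  | NP32 a b => LineSq_circ a 0 b 0
  | NP33 a b => LineNull_circ a b 0 0 1 0 b 0 0
  | NP34 a => LineNull_circ a 1 1 0 0 0 1 0 0
  | NP35 a => LineNull_circ a 1 0 0 0 0 1 0 0
  | NP36 a => LineNull_circ a 0 1 0 0 0 0 0 0
  | NP37 a => LineNull_circ a 0 0 0 0 0 0 0 0
  | NP38 a => LineNull_circ a 1 0 0 0 0 0 0 1
  | NP39 a => LineNull_circ a 1 0 0 0 0 0 0 0
  | NP40 a b => Sq_circ 1 0 0 0 a 0 0 b 0 1 0 0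
  | NP41 a => Sq_circ 1 0 0 0 a 0 1 a 0 1 0 0
  | NP42 a => Sq_circ 1 0 0 0 a 0 0 a 0 1 0 0
  | NP43 a b => Sq_circ 1 0 a 0 0 0 0 b 0 1 0 0
  | NP44 a b => Sq_circ 1 0 0 0 a 1 b 0 0 1 0 0
  | NP45 a b => Sq_circ 1 0 a 0 b 1 0 0 0 1 0 0
  | NP46 a => Sq_circ 1 0 0 1 a 0 0 0 0 1 0 0
  | NP47 a => Sq_circ 1 0 0 1 0 0 a 0 0 1 0 0
  | NP48 a => Sq_circ 0 0 a 0 0 1 0 1 0 0 0 0
  | NP49 a => Sq_circ 0 0 0 0 1 0 0 a 0 0 0 0
  | NP50 => Sq_circ 0 0 0 0 1 0 1 1 0 0 0 0
  | NP51 a => Sq_circ 0 0 a 0 0 0 0 1 0 0 0 0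
  | NP52 a => Sq_circ 0 0 0 0 a 1 1 0 0 0 0 0
  | NP53 => Sq_circ 0 0 0 1 0 0 1 0 0 0 0 0
  | NP54 => Sq_circ 0 0 0 0 0 0 1 0 0 0 0 0
  | NP55 a => Sq_circ 0 0 a 0 0 1 0 0 0 0 0 0
  | NP56 => Sq_circ 0 0 0 1 1 0 0 0 0 0 0 0
  | NP57 => Sq_circ 0 0 0 1 0 0 0 0 0 0 0 0
  | NP58 a => Sq_circ 0 0 a 0 0 0 0 0 0 0 0 0
  | NP59 a => Sq_circ 0 1 a 0 0 0 1 0 0 0 0 1
  | NP60 a => Sq_circ 0 1 a 0 0 0 0 0 0 0 0 1
  | NP61 a => Sq_circ a 0 0 0 (2 - a) 0 0 1 0 a 1 0
  | NP62 a => Sq_circ 1 0 0 0 1 0 a 1 0 1 1 0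
  | NP63 a => Sq_circ 2 0 a 0 0 0 0 1 0 2 1 0
  | NP64 => Sq_circ 1 0 0 0 (-1) 0 0 0 0 1 1 0
  | NP65 a b => Sq_circ 0 0 a 0 0 0 b 0 0 0 1 0
  | NP66 a => Sq_circ a 0 0 0 1 0 0 0 0 0 0 1
  | NP67 a => Sq_circ 1 0 a 0 0 0 0 0 0 0 0 1
  | NP68 a => Sq_circ 0 0 a 0 0 0 0 0 0 0 0 1
  | NP69 a => Sq_circ 1 0 0 a (-1) 0 0 0 1 1 0 0
  | NP70 a => Sq_circ 0 0 0 1 0 0 a 0 1 0 0 0
  | NP71 a => Sq_circ 0 0 0 0 0 0 a 0 1 0 0 0
  | NP72 a => Sq_circ 0 0 a 0 0 0 (-1) 0 1 0 0 0
  | NP73 a => Sq_circ 1 0 0 0 a 0 0 0 0 0 0 0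
  | NP74 a => Sq_circ 1 0 a 0 0 0 0 0 0 0 0 0
  end.

Definition row3 (x : vec K) : 'rV[K]_3 := lin (fun i => delta_mx 0 i) x.

Lemma row3_frame : frame (fun i : 'I_3 => delta_mx 0 i : 'rV[K]_3).
Proof.
exists (fun u : 'rV[K]_3 => (u 0 i1, u 0 i2, u 0 i3)) => [[[a b] c]|u].
  by rewrite /lin !mxE /=; apply: vec_eq; ring.
by apply/rowP; elim/ord3P; rewrite /lin !mxE /=; ring.
Qed.

Lemma row3_crd (x : vec K) i : (row3 x) 0 i = crd x i.
Proof. by elim/ord3P: i; rewrite /row3 /lin !mxE /crd /=; ring. Qed.

Lemma table_mul_row3 (t : vtable K) (x y : vec K) :
  table_mul [seq (e.1, row3 e.2) | e <- t] (row3 x) (row3 y) = row3 (vmul t x y).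
Proof.
elim: t => [|e t IHt]; rewrite /table_mul ?big_nil ?big_cons /=.
  by rewrite /row3 /lin !scale0r !addr0.
rewrite -/(table_mul _ _ _) IHt !row3_crd.
by rewrite /row3 lin_vadd lin_vscale.
Qed.

Local Notation rows s := [seq (e.1, row3 e.2) | e <- s].
Lemma row3_unit i : delta_mx 0 i = row3 (unit3 i) :> 'rV[K]_3.
Proof. by rewrite /row3 lin_unit3. Qed.

Lemma row3D M N u v : M = row3 u -> N = row3 v -> M + N = row3 (vadd u v).
Proof. by move=> -> ->; rewrite /row3 lin_vadd. Qed.

Lemma row3Z a M v : M = row3 v -> a *: M = row3 (vscale a v).
Proof. by move=> ->; rewrite /row3 lin_vscale. Qed.

Lemma row3N M v : M = row3 v -> - M = row3 (vscale (-1) v).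
Proof. by move=> ->; rewrite /row3 lin_vscale scaleN1r. Qed.

Lemma rows_cons i j M v (t : prod_table K) (s : vtable K) : M = row3 v -> t = rows s ->
  (i, j, M) :: t = rows ((i, j, v) :: s).
Proof. by move=> -> ->. Qed.

(** The list of triples is an existential variable filled entry by entry, then compared with
    [dot_vtable] by conversion. *)
Lemma np_dot_table_row3 (p : np_family K) :
  table_sym (np_dot_table p) = rows (dot_vtable (np_dot_type p)).
Proof.
suff [s [dotE ->]] : exists s, table_sym (np_dot_table p) = rows s /\
    dot_vtable (np_dot_type p) = s by [].
case: p => *; eexists; (split;
  [rewrite /table_sym /=; repeat (first [simple apply rows_cons
     | simple apply row3_unit]); exact (erefl (rows [::])) | reflexivity]).
Qed.

Lemma row3K (u : 'rV[K]_3) : row3 (u 0 i1, u 0 i2, u 0 i3) = u.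
Proof. by apply/rowP; elim/ord3P; rewrite row3_crd. Qed.

Lemma np_dot_row3 p (x y : vec K) :
  np_dot p (row3 x) (row3 y) = row3 (vmul (dot_vtable (np_dot_type p)) x y).
Proof. by rewrite /np_dot np_dot_table_row3 table_mul_row3. Qed.

(** A general form has extra zero entries and unsimplified coefficients, so the two tables are
    compared as products and not as lists. *)
Lemma np_circ_row3 p (x y : vec K) :
  np_circ p (row3 x) (row3 y) = row3 (vmul (np_circ_vtable p) x y).
Proof.
suff [s [circE ->]] : exists s, np_circ_table p = rows s /\
    vmul (np_circ_vtable p) x y = vmul s x y.
  by rewrite /np_circ circE table_mul_row3.
case: x y => [[x1 x2] x3] [[y1 y2] y3]; case: p => *; eexists; split.
all: try (rewrite /np_circ_table; repeat (first [simple apply rows_cons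
  | simple apply row3D | simple apply row3Z | simple apply row3N
  | simple apply row3_unit]); exact (erefl (rows [::]))).
all: cbv delta [np_circ_vtable Hyp_circ Pow_circ Loc_circ DualNull_circ
    Trunc_circ Split_circ SplitDual_circ SplitNull_circ LineSq_circ
    LineNull_circ Sq_circ]; vsimpl; apply: vec_eq; first [ring | field; rewrite ?pnatr_eq0 //].
Qed.

Lemma np_isomorphic_frame (A : vectType K) (dot circ : A -> A -> A) w p :
    frame w -> has_table w dot (dot_vtable (np_dot_type p)) ->
    has_table w circ (np_circ_vtable p) ->
  np_isomorphic dot circ (np_dot p) (np_circ p).
Proof.
move=> [g linK gK] wdot wcirc.
have lg : linear (row3 \o g).
  move=> a u v /=; rewrite -lin_vscale -lin_vadd; congr row3.
  apply: (can_inj linK); rewrite gK lin_vadd lin_vscale !gK //.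
pose f : {linear A -> 'rV[K]_3} :=
  HB.pack (row3 \o g) (GRing.isLinear.Build K A 'rV[K]_3 *:%R (row3 \o g) lg).
exists f; split.
- have rb : bijective (row3) := row3_frame.
  by apply: (@bij_comp _ _ _ row3 g rb); exists (lin w).
- move=> u v; rewrite /f /= np_dot_row3; congr row3.
  by apply: (can_inj linK); rewrite -wdot !gK.
- move=> u v; rewrite /f /= np_circ_row3; congr row3.
  by apply: (can_inj linK); rewrite -wcirc !gK.
Qed.

Lemma np_dot_bilinear (p : np_family K) : bilinear_product (np_dot p).
Proof.
by split=> z a u v; rewrite -(row3K u) -(row3K v) -(row3K z) /row3
  -lin_vscale -lin_vadd -/row3 !np_dot_row3 -lin_vscale -lin_vadd
  ?(vmulDl, vmulDr) ?(vmulZl, vmulZr).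
Qed.

Lemma np_circ_bilinear (p : np_family K) : bilinear_product (np_circ p).
Proof.
by split=> z a u v; rewrite -(row3K u) -(row3K v) -(row3K z) /row3
  -lin_vscale -lin_vadd -/row3 !np_circ_row3 -lin_vscale -lin_vadd
  ?(vmulDl, vmulDr) ?(vmulZl, vmulZr).
Qed.

(** [P] is read as a basis in which the product with table [t] acquires the table [t']. *)
Definition respects (P : 'I_3 -> vec K) (t t' : vtable K) : Prop :=
  forall i j, vmul t (P i) (P j) = vcomb P (vmul t' (unit3 i) (unit3 j)).

(** The rows of [P] are the preimages of the standard basis of the target; this is why the tables of
    [q] stand on the right. *)
Lemma np_isomorphicP (p q : np_family K) :
  np_isomorphic (np_dot p) (np_circ p) (np_dot q) (np_circ q) <->
  exists P, [/\ det3 P != 0,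
    respects P (dot_vtable (np_dot_type p)) (dot_vtable (np_dot_type q))
    & respects P (np_circ_vtable p) (np_circ_vtable q)].
Proof.
split=> [[f [[g fK gK] fdot fcirc]]|[P [nzd Pdot Pcirc]]]; last first.
  apply: (@np_isomorphic_frame _ _ _ (fun i => row3 (P i))).
  - exact: (frame_change (row3_frame) nzd).
  - apply: (has_table_change (np_dot_bilinear p) _ Pdot).
    by move=> x y; exact: np_dot_row3.
  - apply: (has_table_change (np_circ_bilinear p) _ Pcirc).
    by move=> x y; exact: np_circ_row3.
have [h row3h hK] := row3_frame.
pose P i := h (g (row3 (unit3 i))).
have rowP i : row3 (P i) = g (row3 (unit3 i)) by rewrite /row3 hK.
have glin x : g (row3 x) = row3 (vcomb P x).
  have fP i : f (row3 (P i)) = delta_mx 0 i by rewrite rowP gK /row3 lin_unit3.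
  have -> : row3 (vcomb P x) = lin (fun i => row3 (P i)) x.
    by rewrite lin_vcomb.
  by apply: (can_inj fK); rewrite gK /lin 2!linearD 3!linearZ /= !fP.
exists P; split.
- apply: vcomb_det; exists (fun x => h (f (row3 x))) => x.
    by rewrite -glin gK row3h.
  apply: (can_inj row3h); rewrite -/(row3 _) -glin /row3 hK -/(row3 _).
  by rewrite fK.
- move=> i j; apply: (can_inj row3h); rewrite -/(row3 _) -np_dot_row3.
  apply: (can_inj fK); rewrite fdot -/(row3 _) !rowP !gK np_dot_row3 -glin gK //.
- move=> i j; apply: (can_inj row3h); rewrite -/(row3 _) -np_circ_row3.
  apply: (can_inj fK); rewrite fcirc -/(row3 _) !rowP !gK np_circ_row3 -glin gK //.
Qed.

End Families.

Arguments dot_vtable {K} k.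
Arguments row3 {K} x.

(** * Setting up [nsatz] over a field of characteristic zero *)

Section Nsatz.
Variable K : numFieldType.

#[global] Instance field_ring_ops :
  @Ncring.Ring_ops K 0 1 +%R *%R (fun x y => x - y) -%R eq := {}.

#[global] Instance field_ring : Ncring.Ring (Ro := field_ring_ops).
Proof.
split; rewrite /Algebra_syntax.equality /Ncring.eq_notation //.
- exact: RelationClasses.eq_equivalence.
- by move=> ? ? -> ? ? ->.
- by move=> ? ? -> ? ? ->.
- by move=> ? ? -> ? ? ->.
- by move=> ? ? ->.
- exact: add0r.
- exact: addrC.
- exact: addrA.
- exact: mul1r.
- exact: mulr1.
- exact: mulrA.
- exact: mulrDl.
- by move=> x y z; exact: mulrDr.
- exact: addrN.
Qed.

#[global] Instance field_cring : Cring.Cring (Rr := field_ring).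
Proof. exact: mulrC. Qed.

#[global] Instance field_domain :
  Integral_domain.Integral_domain (Rcr := field_cring).
Proof.
split; last by apply/eqP/oner_neq0.
by move=> x y /eqP; rewrite mulf_eq0 => /orP[] /eqP; auto.
Qed.

(** Characteristic zero, in the form needed to cancel an integer constant. *)
Lemma IPR_gt0 (p : BinNums.positive) : 0 < NsatzTactic.IPR p :> K.
Proof.
have gt2 : (0 : K) < 1 + 1 by rewrite addr_gt0.
elim: p => [p IHp|p IHp|] /=; last exact: ltr01.
- by case: p IHp => [p|p|] IHp; rewrite addr_gt0 ?ltr01 ?mulr_gt0.
- by case: p IHp => [p|p|] IHp //; rewrite mulr_gt0.
Qed.

Lemma interpret3_const_neq0 (z : BinNums.Z) (l : seq K) :
  z <> BinNums.Z0 -> NsatzTactic.interpret3 (Ring_polynom.PEc z) l <> 0.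
Proof.
case: z => [|p|p] // _ e; have := IPR_gt0 p.
- by rewrite (e : NsatzTactic.IPR p = 0 :> K) ltxx.
- by rewrite -oppr_lt0 (e : - NsatzTactic.IPR p = 0 :> K) ltxx.
Qed.

End Nsatz.

(* Otherwise the numeral [2] is reified as an indeterminate. *)
Ltac Ncring_tac.extra_reify term ::=
  lazymatch term with
  | GRing.natmul (GRing.one _) 2%N =>
      open_constr:(Ring_polynom.PEc (BinNums.Zpos (BinNums.xO BinNums.xH)))
  | _ => open_constr:(tt)
  end.

(* The certificates found by nsatz hold up to a nonzero integer factor. *)
Ltac nsatz :=
  NsatzTactic.nsatz_default; try (apply: interpret3_const_neq0; discriminate).

(** * Isomorphisms within a family *)

(** Turns a linear step into a polynomial identity: once the differences of the sides of hypothesis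
    and goal agree, [ring] finishes. The tactic [by_eq] rests on it. *)
Lemma eq_of_sub (V : zmodType) (x y x' y' : V) :
  x = y -> x' - y' = x - y -> x' = y'.
Proof. by move=> -> /eqP; rewrite subrr subr_eq0 => /eqP. Qed.

Ltac entry Pc i j :=
  let E := fresh "E" in
  have E := Pc i j; vsimpl_in E;
  let e1 := fresh "e" in let e2 := fresh "e" in let e3 := fresh "e" in
  have [e1 e2 e3] := @vecP _ _ _ _ _ _ _ E; clear E.

Ltac by_eq e := apply: (eq_of_sub e); ring.

Ltac conj_by e := split; [by_eq e|].

Section Isomorphisms.
Variable K : numClosedFieldType.
Implicit Types F G : np_family K.

Lemma respects_entries (P : 'I_3 -> vec K) t t' : respects P t t' ->
  respects (frame3 (P i1) (P i2) (P i3)) t t'.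
Proof.
have PE i : frame3 (P i1) (P i2) (P i3) i = P i by elim/ord3P: i.
by move=> Pt i j; rewrite !PE Pt.
Qed.

Lemma np_isomorphic_entries F G k t t' :
    np_isomorphic (np_dot F) (np_circ F) (np_dot G) (np_circ G) ->
    np_dot_type F = k -> np_dot_type G = k ->
    np_circ_vtable F = t -> np_circ_vtable G = t' ->
  exists a b c : vec K,
   [/\ det3 (frame3 a b c) != 0,
    respects (frame3 a b c) (dot_vtable k) (dot_vtable k)
    & respects (frame3 a b c) t t'].
Proof.
move=> /np_isomorphicP[P [nzd Pd Pc]] dF dG cF cG; exists (P i1), (P i2), (P i3).
by split=> //; apply: respects_entries; rewrite -?cF -?cG // -{1}dF -dG.
Qed.

(** The image of [e2] is the square of the image of [e1], and the image of [e3] is annihilated by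
    the image of [e1], which kills its first coordinate. *)
Lemma Sq_aut (a b c : vec K) :
    det3 (frame3 a b c) != 0 ->
    respects (frame3 a b c) (dot_vtable Sq) (dot_vtable Sq) ->
  exists l m n g k, [/\ l != 0, k != 0, a = (l, m, n), b = (0, l * l, 0)
    & c = (0, g, k)].
Proof.
case: a b c => [[l m] n] [[b1 b2] b3] [[c1 g] k]; vsimpl => nz Pd.
rewrite /dot_vtable in Pd.
entry Pd i1 i1; entry Pd i1 i3.
have b10 : b1 = 0 by by_eq (esym e).
have b20 : b2 = l * l by by_eq (esym e0).
have b30 : b3 = 0 by by_eq (esym e1).
have lc0 : l * c1 = 0 by by_eq e3.
have nzl : l != 0 by apply: contraNneq nz => l0; rewrite b10 b20 b30 l0; apply/eqP; ring.
have c10 : c1 = 0 by apply: (mulfI nzl); rewrite lc0 mulr0.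
exists l, m, n, g, k; rewrite b10 b20 b30 c10; split=> //.
by apply: contraNneq nz => ->; rewrite b10 b30 c10; apply/eqP; ring.
Qed.

(* Here and below [il], [ik], [d] witness non-vanishing in the polynomial form that
   [nsatz] can use. *)
Lemma Sq_iso F G a b p q r s t u v w x y a' b' p' q' r' s' t' u' v' w' x' y' :
    np_isomorphic (np_dot F) (np_circ F) (np_dot G) (np_circ G) ->
    np_dot_type F = Sq -> np_dot_type G = Sq ->
    np_circ_vtable F = Sq_circ a b p q r s t u v w x y ->
    np_circ_vtable G = Sq_circ a' b' p' q' r' s' t' u' v' w' x' y' ->
  exists l m n g k il ik,
   l * il = 1 /\ k * ik = 1 /\
   l * l * a + l * n * b = a' * l /\
   l * l * p + l * m * r + l * n * t + m * l * a + l * n * v + n * n * x =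
     a' * m + p' * l * l + q' * g /\
   l * l * q + l * m * s + l * n * u + l * n * w + n * n * y = a' * n + q' * k /\
   l * l * l * r - n * l * l * b = r' * l * l + s' * g /\
   l * l * l * s = s' * k /\
   l * k * b = b' * l /\
   l * g * r + l * k * t + m * k * b - n * g * b + n * k * x = b' * m + t' * l * l + u' * g /\
   l * g * s + l * k * u + n * k * y = b' * n + u' * k /\
   g * l * a + g * n * b + k * l * v - k * m * b + k * n * x = v' * l * l + w' * g /\
   k * l * w + k * n * y = w' * k /\
   k * k * x = x' * l * l + y' * g /\
   k * k * y = y' * k.
Proof.
move=> FG dF dG cF cG.
have [aa [bb [cc [nz Pd Pc]]]] :=
  np_isomorphic_entries FG dF dG cF cG.
have [l [m [n [g [k [nzl nzk ea eb ec]]]]]] := Sq_aut nz Pd; subst.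
exists l, m, n, g, k, l^-1, k^-1; rewrite !divff //; do 2 split => //.
clear Pd nz; rewrite /Sq_circ in Pc.
entry Pc i1 i1; entry Pc i1 i2; entry Pc i1 i3; entry Pc i3 i1; entry Pc i3 i3.
conj_by e; conj_by e0; conj_by e1; conj_by e3; conj_by e4; conj_by e5.
conj_by e6; conj_by e7; conj_by e9; conj_by e10; conj_by e12; by_eq e13.
Qed.

(** The equations for a frame that keeps the lines of [e1] and [e3] modulo [e2]. They are named
    because, with permuted parameters, they also describe a frame that exchanges these lines. *)
Definition Hyp_rel (a b p q r s a' b' p' q' r' s' : K) : Prop :=
  exists l m g k il ik,
   l * il = 1 /\ k * ik = 1 /\
   l * l * a = a' * l /\ l * l * p = a' * m + p' * (l * k) /\
   l * k * b = b' * l /\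
   l * k * q + m * k * b - l * g * a = b' * m + q' * (l * k) /\
   g * l * a + k * l * r - k * m * b = r' * (l * k) + a' * g /\
   k * l * a = a' * k /\
   k * k * s = s' * (l * k) + b' * g /\ k * k * b = b' * k.

(** Modulo the line of [e2] the product is a hyperbolic form, whose two isotropic lines an
    automorphism either keeps or exchanges. *)
Lemma Hyp_aut (a b c : vec K) :
    det3 (frame3 a b c) != 0 ->
    respects (frame3 a b c) (dot_vtable Hyp) (dot_vtable Hyp) ->
  exists l m g k, [/\ l != 0, k != 0, b = (0, l * k, 0)
    & a = (l, m, 0) /\ c = (0, g, k) \/ a = (0, m, l) /\ c = (k, g, 0)].
Proof.
case: a b c => [[a1 a2] a3] [[b1 b2] b3] [[c1 c2] c3]; vsimpl => nz Pd.
rewrite /dot_vtable in Pd.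
entry Pd i1 i1; entry Pd i1 i3; entry Pd i3 i3.
have b10 : b1 = 0 by by_eq (esym e2).
have b2E : b2 = a1 * c3 + a3 * c1 by by_eq (esym e3).
have b30 : b3 = 0 by by_eq (esym e4).
have /eqP : a1 * a3 = 0 by nsatz.
have /eqP : c1 * c3 = 0 by nsatz.
rewrite !mulf_eq0 => /orP[]/eqP c0 /orP[]/eqP a0; rewrite b10 b2E b30 ?a0 ?c0 in nz *.
- by case/eqP: nz; ring.
- exists a1, a2, c2, c3; split; [..| by left]; last by congr (_, _, _); ring.
  + by apply: contraNneq nz => ->; apply/eqP; ring.
  + by apply: contraNneq nz => ->; apply/eqP; ring.
- exists a3, a2, c2, c1; split; [..| by right]; last by congr (_, _, _); ring.
  + by apply: contraNneq nz => ->; apply/eqP; ring.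
  + by apply: contraNneq nz => ->; apply/eqP; ring.
- by case/eqP: nz; ring.
Qed.

(** Exchanging [e1] and [e3] turns [Hyp_circ a b p q r s] into [Hyp_circ b a s r q p], whence the
    second alternative. *)
Lemma Hyp_iso F G (a b p q r s a' b' p' q' r' s' : K) :
    np_isomorphic (np_dot F) (np_circ F) (np_dot G) (np_circ G) ->
    np_dot_type F = Hyp -> np_dot_type G = Hyp ->
    np_circ_vtable F = Hyp_circ a b p q r s ->
    np_circ_vtable G = Hyp_circ a' b' p' q' r' s' ->
  Hyp_rel a b p q r s a' b' p' q' r' s' \/
  Hyp_rel b a s r q p a' b' p' q' r' s'.
Proof.
move=> FG dF dG cF cG; have [aa [bb [cc [nz Pd Pc]]]] :=
  np_isomorphic_entries FG dF dG cF cG.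
have [l [m [g [k [nzl nzk eb eac]]]]] := Hyp_aut nz Pd.
have ll : l * l^-1 = 1 by rewrite divff.
have kk : k * k^-1 = 1 by rewrite divff.
case: eac => -[ea ec]; subst; [left | right];
  exists l, m, g, k, l^-1, k^-1; do 2 split => //;
  clear Pd nz; rewrite /Hyp_circ in Pc;
  entry Pc i1 i1; entry Pc i1 i3; entry Pc i3 i1; entry Pc i3 i3.
  conj_by e; conj_by e0; conj_by e2; conj_by e3; conj_by e6; conj_by e7.
  by conj_by e9; by_eq e10.
conj_by e1; conj_by e0; conj_by e4; conj_by e3; conj_by e6; conj_by e5.
by conj_by e9; by_eq e8.
Qed.

(** The algebra is generated by [e1], so its image [(l, m, n)] determines the frame: [e2] goes to
    [(0, l^2, 2 l m)] and [e3] to [(0, 0, l^3)]. *)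
Lemma Pow_iso F G (a b p q r a' b' p' q' r' : K) :
    np_isomorphic (np_dot F) (np_circ F) (np_dot G) (np_circ G) ->
    np_dot_type F = Pow -> np_dot_type G = Pow ->
    np_circ_vtable F = Pow_circ a b p q r ->
    np_circ_vtable G = Pow_circ a' b' p' q' r' ->
  exists l m n il,
   l * il = 1 /\
   l * l * a = a' * l /\
   l * l * p + l * m * b + m * l * a = a' * m + p' * l * l /\
   l * l * q + l * m * r + l * n * (2 * b - a) + m * l * p + m * m * b
     + n * l * a = a' * n + p' * (2 * l * m) + q' * l * l * l /\
   l * l * l * b = b' * l * l /\
   l * l * l * r + 2 * l * l * m * (2 * b - a) + m * l * l * b =
     b' * (2 * l * m) + r' * l * l * l.
Proof.
move=> FG dF dG cF cG; have [aa [bb [cc [nz Pd Pc]]]] :=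
  np_isomorphic_entries FG dF dG cF cG.
case: aa nz Pd Pc => [[l m] n]; case: bb => [[b1 b2] b3].
case: cc => [[c1 c2] c3]; vsimpl => nz Pd Pc; rewrite /dot_vtable in Pd.
entry Pd i1 i1; entry Pd i1 i2.
have b10 : b1 = 0 by by_eq (esym e).
have b2E : b2 = l * l by by_eq (esym e0).
have b3E : b3 = 2 * l * m by by_eq (esym e1).
have c10 : c1 = 0 by by_eq (esym e2).
have c20 : c2 = 0 by apply: (eq_of_sub (esym e3)); rewrite b10; ring.
have c3E : c3 = l * l * l.
  by apply: (eq_of_sub (esym e4)); rewrite b10 b2E; ring.
clear e e0 e1 e2 e3 e4 Pd; subst.
have nzl : l != 0 by apply: contraNneq nz => ->; apply/eqP; ring.
exists l, m, n, l^-1; rewrite divff //; split=> //.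
rewrite /Pow_circ in Pc; entry Pc i1 i1; entry Pc i1 i2.
conj_by e; conj_by e0; conj_by e1; conj_by e3; by_eq e4.
Qed.

(** The unit [e3] is fixed and the square-zero plane of [e1], [e2] is preserved. An invertible
    matrix acts there: [(t, u)] changes as a row vector, and the matrix [(p, q; r, s)] by
    conjugation. *)
Lemma Loc_iso F G (a p q r s t u a' p' q' r' s' t' u' : K) :
    np_isomorphic (np_dot F) (np_circ F) (np_dot G) (np_circ G) ->
    np_dot_type F = Loc -> np_dot_type G = Loc ->
    np_circ_vtable F = Loc_circ a p q r s t u ->
    np_circ_vtable G = Loc_circ a' p' q' r' s' t' u' ->
  exists x11 x12 x21 x22 d,
   (x11 * x22 - x12 * x21) * d = 1 /\ a = a' /\
   t = t' * x11 + u' * x21 /\ u = t' * x12 + u' * x22 /\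
   x11 * p + x12 * r = p' * x11 + q' * x21 /\
   x11 * q + x12 * s = p' * x12 + q' * x22 /\
   x21 * p + x22 * r = r' * x11 + s' * x21 /\
   x21 * q + x22 * s = r' * x12 + s' * x22.
Proof.
move=> FG dF dG cF cG; have [aa [bb [cc [nz Pd Pc]]]] :=
  np_isomorphic_entries FG dF dG cF cG.
case: aa nz Pd Pc => [[a1 a2] a3]; case: bb => [[b1 b2] b3].
case: cc => [[c1 c2] c3]; vsimpl => nz Pd Pc; rewrite /dot_vtable in Pd.
entry Pd i1 i1; entry Pd i1 i3; entry Pd i2 i2; entry Pd i2 i3; entry Pd i3 i3.
have a30 : a3 = 0.
  have /eqP : a3 * a3 = 0 by by_eq e1.
  by rewrite mulf_eq0 orbb => /eqP.
have b30 : b3 = 0.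
  have /eqP : b3 * b3 = 0 by by_eq e7.
  by rewrite mulf_eq0 orbb => /eqP.
rewrite a30 b30 in nz.
have nzd : a1 * b2 - a2 * b1 != 0.
  apply: contraNneq nz => d0; apply/eqP.
  by apply: (eq_of_sub (congr1 ( *%R c3) d0)); ring.
have c31 : c3 = 1.
  have E1 : a1 * c3 = a1 by apply: (eq_of_sub e2); rewrite a30; ring.
  have E2 : a2 * c3 = a2 by apply: (eq_of_sub e3); rewrite a30; ring.
  apply: (mulfI nzd); transitivity (a1 * c3 * b2 - a2 * c3 * b1); first by ring.
  by rewrite E1 E2; ring.
have c10 : c1 = 0 by apply: (eq_of_sub e11); rewrite c31; ring.
have c20 : c2 = 0 by apply: (eq_of_sub e12); rewrite c31; ring.
clear - nzd Pc a30 b30 c31 c10 c20; subst.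
exists a1, a2, b1, b2, (a1 * b2 - a2 * b1)^-1; rewrite divff //; split=> //.
rewrite /Loc_circ in Pc; entry Pc i3 i1; entry Pc i3 i2; entry Pc i3 i3.
split; first by_eq e7.
conj_by e5; conj_by e6; conj_by e; conj_by e0; conj_by e2; by_eq e3.
Qed.

(** The null line is spanned by [e1 - e2]. An automorphism fixes [e3], scales [e2] by [l] and
    [e1 - e2] by [k]. *)
Lemma DualNull_iso F G (a b p q a' b' p' q' : K) :
    np_isomorphic (np_dot F) (np_circ F) (np_dot G) (np_circ G) ->
    np_dot_type F = DualNull -> np_dot_type G = DualNull ->
    np_circ_vtable F = DualNull_circ a b p q ->
    np_circ_vtable G = DualNull_circ a' b' p' q' ->
  exists l k il ik, l * il = 1 /\ k * ik = 1 /\ a = a' /\ q = q' * l /\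
    b = b' /\ k * p = p'.
Proof.
move=> FG dF dG cF cG; have [aa [bb [cc [nz Pd Pc]]]] :=
  np_isomorphic_entries FG dF dG cF cG.
case: aa nz Pd Pc => [[a1 a2] a3]; case: bb => [[b1 b2] b3].
case: cc => [[c1 c2] c3]; vsimpl => nz Pd Pc; rewrite /dot_vtable in Pd.
entry Pd i1 i1; entry Pd i1 i3; entry Pd i3 i3.
have a30 : a3 = 0.
  have /eqP : a3 * a3 = 0 by by_eq e1.
  by rewrite mulf_eq0 orbb => /eqP.
have b10 : b1 = 0 by by_eq (esym e2).
have b30 : b3 = 0 by apply: (eq_of_sub (esym e4)); rewrite a30; ring.
have c10 : c1 = 0 by by_eq (esym e5).
rewrite a30 b10 b30 c10 in nz.
have nzc3 : c3 != 0 by apply: contraNneq nz => ->; apply/eqP; ring.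
have nza1 : a1 != 0 by apply: contraNneq nz => ->; apply/eqP; ring.
have nzb2 : b2 != 0 by apply: contraNneq nz => ->; apply/eqP; ring.
have c31 : c3 = 1 by apply: (mulfI nzc3); by_eq e7.
have c20 : c2 = 0 by apply: (eq_of_sub e6); rewrite c31 c10; ring.
have a2E : a2 = b2 - a1 by apply: (eq_of_sub e3); rewrite a30 c31; ring.
clear - nza1 nzb2 Pc a30 b30 b10 c31 c10 c20 a2E; subst.
exists b2, a1, b2^-1, a1^-1; rewrite !divff //; do 2 split=> //.
rewrite /DualNull_circ in Pc; entry Pc i1 i1; entry Pc i3 i2; entry Pc i3 i3.
split; first by_eq e7.
split; first by_eq e6.
split; first by apply: (mulfI nzb2); by_eq e3.
by apply: (mulfI nza1); apply: oppr_inj; by_eq e.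
Qed.

(** The unit [e3] is fixed, [e1] goes to [l e1 + m e2], and its square [e2] to [l^2 e2]. *)
Lemma Trunc_iso F G (a b p q r a' b' p' q' r' : K) :
    np_isomorphic (np_dot F) (np_circ F) (np_dot G) (np_circ G) ->
    np_dot_type F = Trunc -> np_dot_type G = Trunc ->
    np_circ_vtable F = Trunc_circ a b p q r ->
    np_circ_vtable G = Trunc_circ a' b' p' q' r' ->
  exists l m il, l * il = 1 /\ a = a' /\ b = b' /\ p = p' * l /\
    q = p' * m + q' * l * l /\
    2 * l * r + 2 * m * a = (a' + b') * m + 2 * r' * l * l.
Proof.
move=> FG dF dG cF cG; have [aa [bb [cc [nz Pd Pc]]]] :=
  np_isomorphic_entries FG dF dG cF cG.
case: aa nz Pd Pc => [[a1 a2] a3]; case: bb => [[b1 b2] b3].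
case: cc => [[c1 c2] c3]; vsimpl => nz Pd Pc; rewrite /dot_vtable in Pd.
entry Pd i1 i1; entry Pd i1 i2; entry Pd i1 i3; entry Pd i3 i3.
have b3E : b3 = a3 * a3 by by_eq (esym e1).
have a30 : a3 = 0.
  have /eqP : a3 * (a3 * a3) = 0 by apply: (eq_of_sub e4); rewrite b3E; ring.
  by rewrite !mulf_eq0 !orbb => /eqP.
have b30 : b3 = 0 by rewrite b3E a30 mul0r.
have b10 : b1 = 0 by apply: (eq_of_sub (esym e)); rewrite a30; ring.
have b2E : b2 = a1 * a1 by apply: (eq_of_sub (esym e0)); rewrite a30; ring.
rewrite a30 b10 b30 b2E in nz.
have nza1 : a1 != 0 by apply: contraNneq nz => ->; apply/eqP; ring.
have c31 : c3 = 1.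
  by apply: (mulfI nza1); apply: (eq_of_sub e5); rewrite a30; ring.
have c10 : c1 = 0 by apply: (eq_of_sub e8); rewrite c31; ring.
have c20 : c2 = 0 by apply: (eq_of_sub e9); rewrite c31 c10; ring.
clear - nza1 Pc a30 b30 b10 b2E c31 c10 c20; subst.
exists a1, a2, a1^-1; rewrite !divff //; split=> //.
rewrite /Trunc_circ in Pc; entry Pc i3 i1; entry Pc i3 i2; entry Pc i3 i3.
have aE : a = a' by apply: (mulfI nza1); apply: (mulfI nza1); by_eq e3.
have bE : b = b' by by_eq e7.
split; first exact: aE.
split; first exact: bE.
split; first by_eq e5.
split; first by_eq e6.
(* Doubling clears the halves of [Trunc_circ]. *)
have E := congr1 ( *%R 2) e0; by apply: (eq_of_sub E); field.
Qed.

(** The idempotents [e1] and [e2] are told apart by their action on [e3], so only a scaling of [e3]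
    remains. *)
Lemma SplitDual_iso F G (a b c p a' b' c' p' : K) :
    np_isomorphic (np_dot F) (np_circ F) (np_dot G) (np_circ G) ->
    np_dot_type F = SplitDual -> np_dot_type G = SplitDual ->
    np_circ_vtable F = SplitDual_circ a b c p ->
    np_circ_vtable G = SplitDual_circ a' b' c' p' ->
  exists k ik, k * ik = 1 /\ a = a' /\ b = b' /\ c = c' /\ p = p' * k.
Proof.
move=> FG dF dG cF cG; have [aa [bb [cc [nz Pd Pc]]]] :=
  np_isomorphic_entries FG dF dG cF cG.
case: aa nz Pd Pc => [[a1 a2] a3]; case: bb => [[b1 b2] b3].
case: cc => [[c1 c2] c3]; vsimpl => nz Pd Pc; rewrite /dot_vtable in Pd.
entry Pd i1 i1; entry Pd i1 i2; entry Pd i2 i2; entry Pd i1 i3; entry Pd i3 i3.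
have c10 : c1 = 0.
  have /eqP : c1 * c1 = 0 by by_eq e11.
  by rewrite mulf_eq0 orbb => /eqP.
have c20 : c2 = 0.
  have /eqP : c2 * c2 = 0 by by_eq e12.
  by rewrite mulf_eq0 orbb => /eqP.
rewrite c10 c20 in nz e10.
have nzc3 : c3 != 0 by apply: contraNneq nz => ->; apply/eqP; ring.
have a11 : a1 = 1 by apply: (mulfI nzc3); by_eq e10.
have a30 : a3 = 0 by apply: (eq_of_sub e1); rewrite a11; ring.
have b10 : b1 = 0 by apply: (eq_of_sub e2); rewrite a11; ring.
have b30 : b3 = 0.
  by apply: (eq_of_sub e4); rewrite a11 a30 b10; ring.
rewrite a11 a30 b10 b30 in nz.
have nzb2 : b2 != 0 by apply: contraNneq nz => ->; apply/eqP; ring.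
have b21 : b2 = 1 by apply: (mulfI nzb2); by_eq e6.
have a20 : a2 = 0 by apply: (eq_of_sub e3); rewrite b21; ring.
clear - nzc3 Pc a11 a20 a30 b10 b21 b30 c10 c20; subst.
exists c3, c3^-1; rewrite divff //; split=> //.
rewrite /SplitDual_circ in Pc.
entry Pc i1 i1; entry Pc i1 i3; entry Pc i2 i2.
conj_by e; split; first by apply: (mulfI nzc3); by_eq e4.
conj_by e6; by_eq e1.
Qed.

(** The two idempotents may be exchanged, and the null line of [e3] is preserved. *)
Lemma SplitNull_iso F G (a b c a' b' c' : K) :
    np_isomorphic (np_dot F) (np_circ F) (np_dot G) (np_circ G) ->
    np_dot_type F = SplitNull -> np_dot_type G = SplitNull ->
    np_circ_vtable F = SplitNull_circ a b c ->
    np_circ_vtable G = SplitNull_circ a' b' c' ->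
  a = a' /\ b = b' \/ a = b' /\ b = a'.
Proof.
move=> FG dF dG cF cG; have [aa [bb [cc [nz Pd Pc]]]] :=
  np_isomorphic_entries FG dF dG cF cG.
case: aa nz Pd Pc => [[a1 a2] a3]; case: bb => [[b1 b2] b3].
case: cc => [[c1 c2] c3]; vsimpl => nz Pd Pc; rewrite /dot_vtable in Pd.
entry Pd i1 i1; entry Pd i1 i2; entry Pd i2 i2; entry Pd i3 i3.
have c10 : c1 = 0.
  have /eqP : c1 * c1 = 0 by by_eq e8.
  by rewrite mulf_eq0 orbb => /eqP.
have c20 : c2 = 0.
  have /eqP : c2 * c2 = 0 by by_eq e9.
  by rewrite mulf_eq0 orbb => /eqP.
have a30 : a3 = 0 by by_eq (esym e1).
have b30 : b3 = 0 by by_eq (esym e7).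
rewrite c10 c20 a30 b30 in nz.
have ab1 : a1 * b1 = 0 by by_eq e2.
have ab2 : a2 * b2 = 0 by by_eq e3.
have idem (z : K) : z * z = z -> z = 0 \/ z = 1.
  move=> zz; have /eqP : z * (z - 1) = 0 by by_eq zz.
  by rewrite mulf_eq0 subr_eq0 => /orP[] /eqP; [left | right].
have {e}a1E := idem a1 ltac:(by_eq e); have {e0}a2E := idem a2 ltac:(by_eq e0).
have {e5}b1E := idem b1 ltac:(by_eq e5); have {e6}b2E := idem b2 ltac:(by_eq e6).
clear - nz Pc a1E b2E a2E b1E ab1 ab2 a30 b30 c10 c20; subst.
rewrite /SplitNull_circ in Pc; entry Pc i1 i1; entry Pc i2 i2; clear Pc e1 e4.
case: a1E ab1 => a1E ab1; rewrite a1E in nz ab1 e e0.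
  right; case: a2E ab2 => a2E ab2; rewrite a2E in nz ab2 e e0.
    by case/eqP: nz; ring.
  have b20 : b2 = 0 by by_eq ab2.
  case: b1E => b1E; rewrite b1E b20 in nz e2 e3; first by case/eqP: nz; ring.
  by split; [by_eq e2 | by_eq e0].
have b10 : b1 = 0 by by_eq ab1.
left; case: b2E ab2 => b2E ab2; rewrite b2E b10 in nz ab2 e2 e3.
  by case/eqP: nz; ring.
by split; [by_eq e | by_eq e3].
Qed.

(** [e1] is fixed, [e2] goes to [l e2 + m e3], and its square [e3] to [l^2 e3]. *)
Lemma LineSq_iso F G (a b p q a' b' p' q' : K) :
    np_isomorphic (np_dot F) (np_circ F) (np_dot G) (np_circ G) ->
    np_dot_type F = LineSq -> np_dot_type G = LineSq ->
    np_circ_vtable F = LineSq_circ a b p q ->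
    np_circ_vtable G = LineSq_circ a' b' p' q' ->
  exists l m il, l * il = 1 /\ a = a' /\ l * b = b' /\
    l * l * p + l * m * q + m * l * b = b' * m + p' * l * l /\ l * q = q'.
Proof.
move=> FG dF dG cF cG; have [aa [bb [cc [nz Pd Pc]]]] :=
  np_isomorphic_entries FG dF dG cF cG.
case: aa nz Pd Pc => [[a1 a2] a3]; case: bb => [[b1 b2] b3].
case: cc => [[c1 c2] c3]; vsimpl => nz Pd Pc; rewrite /dot_vtable in Pd.
entry Pd i1 i1; entry Pd i1 i2; entry Pd i2 i2; entry Pd i3 i3; entry Pd i2 i3.
have c10 : c1 = 0.
  have /eqP : c1 * c1 = 0 by by_eq e8.
  by rewrite mulf_eq0 orbb => /eqP.
have b10 : b1 = 0.
  have /eqP : b1 * b1 = 0 by apply: (eq_of_sub e5); rewrite c10; ring.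
  by rewrite mulf_eq0 orbb => /eqP.
have a20 : a2 = 0 by by_eq (esym e0).
have a30 : a3 = 0 by apply: (eq_of_sub (esym e1)); rewrite a20; ring.
have c20 : c2 = 0 by by_eq (esym e6).
have c3E : c3 = b2 * b2 by by_eq (esym e7).
rewrite c10 c20 c3E b10 a20 a30 in nz.
have nza1 : a1 != 0 by apply: contraNneq nz => ->; apply/eqP; ring.
have nzb2 : b2 != 0 by apply: contraNneq nz => ->; apply/eqP; ring.
have a11 : a1 = 1 by apply: (mulfI nza1); by_eq e.
clear - nzb2 Pc a11 a20 a30 b10 c10 c20 c3E; subst.
exists b2, b3, b2^-1; rewrite divff //; split=> //.
rewrite /LineSq_circ in Pc; entry Pc i1 i1; entry Pc i2 i2; entry Pc i2 i3.
conj_by e; split; first by apply: (mulfI nzb2); by_eq e3.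
conj_by e4; do 2 apply: (mulfI nzb2); by_eq e7.
Qed.

(** [e1] is fixed, and an invertible matrix acts on the null plane of [e2] and [e3]. *)
Lemma LineNull_iso F G (a p q r s t u v w a' p' q' r' s' t' u' v' w' : K) :
    np_isomorphic (np_dot F) (np_circ F) (np_dot G) (np_circ G) ->
    np_dot_type F = LineNull -> np_dot_type G = LineNull ->
    np_circ_vtable F = LineNull_circ a p q r s t u v w ->
    np_circ_vtable G = LineNull_circ a' p' q' r' s' t' u' v' w' ->
  exists x y z k d, (x * k - y * z) * d = 1 /\ a = a' /\
   x * x * p + x * y * r + y * x * t + y * y * v = p' * x + q' * z /\
   x * x * q + x * y * s + y * x * u + y * y * w = p' * y + q' * k /\
   x * z * p + x * k * r + y * z * t + y * k * v = r' * x + s' * z /\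
   x * z * q + x * k * s + y * z * u + y * k * w = r' * y + s' * k /\
   z * x * p + z * y * r + k * x * t + k * y * v = t' * x + u' * z /\
   z * x * q + z * y * s + k * x * u + k * y * w = t' * y + u' * k /\
   z * z * p + z * k * r + k * z * t + k * k * v = v' * x + w' * z /\
   z * z * q + z * k * s + k * z * u + k * k * w = v' * y + w' * k.
Proof.
move=> FG dF dG cF cG; have [aa [bb [cc [nz Pd Pc]]]] :=
  np_isomorphic_entries FG dF dG cF cG.
case: aa nz Pd Pc => [[a1 a2] a3]; case: bb => [[b1 x] y].
case: cc => [[c1 z] k]; vsimpl => nz Pd Pc; rewrite /dot_vtable in Pd.
entry Pd i1 i1; entry Pd i2 i2; entry Pd i3 i3.
have c10 : c1 = 0.
  have /eqP : c1 * c1 = 0 by by_eq e5.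
  by rewrite mulf_eq0 orbb => /eqP.
have b10 : b1 = 0.
  have /eqP : b1 * b1 = 0 by by_eq e2.
  by rewrite mulf_eq0 orbb => /eqP.
have a20 : a2 = 0 by by_eq (esym e0).
have a30 : a3 = 0 by by_eq (esym e1).
rewrite c10 b10 a20 a30 in nz.
have nza1 : a1 != 0 by apply: contraNneq nz => ->; apply/eqP; ring.
have nzd : x * k - y * z != 0.
  apply: contraNneq nz => d0; apply/eqP.
  by apply: (eq_of_sub (congr1 ( *%R a1) d0)); ring.
have a11 : a1 = 1 by apply: (mulfI nza1); by_eq e.
clear - nzd Pc a11 a20 a30 b10 c10; subst.
exists x, y, z, k, (x * k - y * z)^-1; rewrite divff //; split=> //.
rewrite /LineNull_circ in Pc.
entry Pc i1 i1; entry Pc i2 i2; entry Pc i2 i3; entry Pc i3 i2; entry Pc i3 i3.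
conj_by e; conj_by e3; conj_by e4; conj_by e6; conj_by e7.
conj_by e9; conj_by e10; conj_by e12; by_eq e13.
Qed.

Lemma orthogonal_idempotents (x y z : K) :
    x * x = x -> y * y = y -> z * z = z ->
    x * y = 0 -> x * z = 0 -> y * z = 0 ->
  [\/ [/\ x = 0, y = 0 & z = 0], [/\ x = 1, y = 0 & z = 0],
      [/\ x = 0, y = 1 & z = 0] | [/\ x = 0, y = 0 & z = 1]].
Proof.
have idem (u : K) : u * u = u -> u = 0 \/ u = 1.
  move=> uu; have /eqP : u * (u - 1) = 0 by by_eq uu.
  by rewrite mulf_eq0 subr_eq0 => /orP[] /eqP; [left | right].
move=> /idem[]-> /idem[]-> /idem[]->; rewrite ?(mul0r, mul1r) => // /eqP e1 /eqP e2 /eqP e3;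
  by [constructor | move: e1 e2 e3; rewrite ?oner_eq0].
Qed.

(** In each coordinate, the images of the three idempotents give orthogonal idempotents of [K], at
    most one of which is 1. A nonzero determinant leaves the permutation matrices. *)
Lemma Split_iso F G (a b c a' b' c' : K) :
    np_isomorphic (np_dot F) (np_circ F) (np_dot G) (np_circ G) ->
    np_dot_type F = Split -> np_dot_type G = Split ->
    np_circ_vtable F = Split_circ a b c ->
    np_circ_vtable G = Split_circ a' b' c' ->
  perm_eq [:: a; b; c] [:: a'; b'; c'].
Proof.
move=> FG dF dG cF cG; have [aa [bb [cc [nz Pd Pc]]]] :=
  np_isomorphic_entries FG dF dG cF cG.
case: aa nz Pd Pc => [[a1 a2] a3]; case: bb => [[b1 b2] b3].
case: cc => [[c1 c2] c3]; vsimpl => nz Pd Pc; rewrite /dot_vtable in Pd.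
entry Pd i1 i1; entry Pd i2 i2; entry Pd i3 i3.
entry Pd i1 i2; entry Pd i1 i3; entry Pd i2 i3.
have C1 := @orthogonal_idempotents a1 b1 c1 ltac:(by_eq e) ltac:(by_eq e2)
  ltac:(by_eq e5) ltac:(by_eq e8) ltac:(by_eq e11) ltac:(by_eq e14).
have C2 := @orthogonal_idempotents a2 b2 c2 ltac:(by_eq e0) ltac:(by_eq e3)
  ltac:(by_eq e6) ltac:(by_eq e9) ltac:(by_eq e12) ltac:(by_eq e15).
have C3 := @orthogonal_idempotents a3 b3 c3 ltac:(by_eq e1) ltac:(by_eq e4)
  ltac:(by_eq e7) ltac:(by_eq e10) ltac:(by_eq e13) ltac:(by_eq e16).
clear - nz Pc C1 C2 C3.
rewrite /Split_circ in Pc; entry Pc i1 i1; entry Pc i2 i2; entry Pc i3 i3; clear Pc.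
case: C1 => -[*]; subst; (case: C2 => -[*]; subst; (case: C3 => -[*]; subst;
  try (case/eqP: nz; ring))).
all: first [have -> : a = a' by by_eq e | have -> : a = b' by by_eq e2
       | have -> : a = c' by by_eq e5].
all: first [have -> : b = a' by by_eq e0 | have -> : b = b' by by_eq e3
       | have -> : b = c' by by_eq e6].
all: first [have -> : c = a' by by_eq e1 | have -> : c = b' by by_eq e4
       | have -> : c = c' by by_eq e7].
all: by apply/permP => P /=; ring.
Qed.

End Isomorphisms.

Ltac relations H :=
  let E := fresh "E" in
  first [have E := Sq_iso H erefl erefl erefl erefl
    | have E := Pow_iso H erefl erefl erefl erefl
    | have E := Loc_iso H erefl erefl erefl erefl
    | have E := DualNull_iso H erefl erefl erefl erefl
    | have E := Trunc_iso H erefl erefl erefl erefl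
    | have E := SplitDual_iso H erefl erefl erefl erefl
    | have E := LineSq_iso H erefl erefl erefl erefl
    | have E := LineNull_iso H erefl erefl erefl erefl];
  clear H; repeat (match goal with
  | H : exists _, _ |- _ => destruct H
  | H : _ /\ _ |- _ => destruct H
  end).

Ltac unfold_tables :=
  unfold np_circ_vtable, np_dot_type, dot_vtable, Hyp_circ, Pow_circ, Loc_circ, DualNull_circ,
    Trunc_circ, Split_circ, SplitDual_circ, SplitNull_circ, LineSq_circ,
    LineNull_circ, Sq_circ.

Ltac respects_by :=
  do 2 apply: ord3P; unfold_tables; vsimpl; apply: vec_eq;
  first [ring | field; repeat (apply/andP; split); assumption | field].

Ltac relations_in E :=
  unfold Hyp_rel in E;
  repeat (match type of E with
  | exists _, _ => destruct E as [? E]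
  end); repeat (match goal with H : _ /\ _ |- _ => destruct H end).

Ltac det_tac :=
  vsimpl;
  rewrite ?(mulr0, mul0r, mulr1, mul1r, oppr0, subr0, sub0r, addr0, add0r,
    mulN1r, mulrN1, opprK)
    ?(oppr_eq0, oner_eq0) //.

(** * Deciding isomorphism by the parameters *)

Section SameClass.
Variable K : numClosedFieldType.
Implicit Types p q : np_family K.

Lemma eq_or_opp (x y : K) : x * x = y * y -> x = y \/ x = - y.
Proof.
move=> xy; have /eqP : (x - y) * (x + y) = 0 by by_eq xy.
rewrite mulf_eq0 subr_eq0 addr_eq0 => /orP[] /eqP; [by left | by right].
Qed.

Lemma same_class_of_isomorphic p q :
    np_admissible p -> np_admissible q -> np_index p = np_index q ->
    np_isomorphic (np_dot p) (np_circ p) (np_dot q) (np_circ q) ->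
  np_same_class p q.
Proof.
(* The common script settles the families whose parameters must be equal. The bullets treat those
   with a weaker relation, and those over [Hyp], where the equations come in two alternatives. *)
case: p; case: q => //;
  try (intros; match goal with H : np_isomorphic _ _ _ _ |- _ =>
    rewrite /np_same_class; solve [relations H; f_equal; nsatz] end).
- move=> c d a b _ _ _ H; case: (Hyp_iso H erefl erefl erefl erefl) => E; relations_in E.
  + by left; congr (_, _); nsatz.
  + by right; congr (_, _); nsatz.
- move=> b a _ _ _ H; rewrite /np_same_class; f_equal.
  by case: (Hyp_iso H erefl erefl erefl erefl) => E; relations_in E; nsatz.
- move=> b a _ _ _ H; rewrite /np_same_class; f_equal.
  by case: (Hyp_iso H erefl erefl erefl erefl) => E; relations_in E; nsatz.
- move=> a2 b2 c2 a1 b1 c1 _ _ _ H; rewrite /np_same_class.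
  case: (Hyp_iso H erefl erefl erefl erefl) => E; relations_in E.
  + have a12 : a1 = a2 by nsatz.
    have b12 : b1 = b2 by nsatz.
    have c12 : c1 = c2 by nsatz.
    rewrite a12 b12 c12; have [c0|/eqP nzc] := eqVneq c2 0; first by left.
    by right; split=> //; left.
  + have a12 : a1 = b2 by nsatz.
    have b12 : b1 = a2 by nsatz.
    have c12 : c1 = c2 by nsatz.
    (* The exchange carries the nonzero square [e1 ∘ e1] to that of [e3], which therefore cannot
       vanish. *)
    have nzc : c2 <> 0.
      move=> c0; rewrite c0 in c12; suff : 1 = 0 :> K by move/eqP; rewrite oner_eq0.
      by nsatz.
    by right; rewrite a12 b12 c12; split=> //; right.
- move=> c d a b _ _ _ H; case: (Hyp_iso H erefl erefl erefl erefl) => E; relations_in E.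
  + by left; congr (_, _); nsatz.
  + by right; congr (_, _); nsatz.
- move=> c d a b _ _ _ H; rewrite /np_same_class; relations H.
  by split; [|apply: eq_or_opp]; nsatz.
- by move=> a' b' c' a b c _ _ _ H; exact: Split_iso H erefl erefl erefl erefl.
- move=> c d a b _ _ _ H; rewrite /np_same_class.
  by case: (SplitNull_iso H erefl erefl erefl erefl) => -[-> ->]; [left | right].
- move=> c d a b _ _ _ H; rewrite /np_same_class.
  by case: (SplitNull_iso H erefl erefl erefl erefl) => -[-> ->]; [left | right].
- move=> b a _ _ _ H; rewrite /np_same_class; relations H.
  by apply: eq_or_opp; nsatz.
- move=> b a _ _ _ H; rewrite /np_same_class; relations H.
  by apply: eq_or_opp; nsatz.
- move=> c d a b _ _ _ H; rewrite /np_same_class; relations H.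
  by split; [|apply: eq_or_opp]; nsatz.
Qed.

Lemma respects_id t : respects (@unit3 K) t t.
Proof. by move=> i j; rewrite /vcomb -vecE. Qed.

Lemma np_isomorphic_refl p :
  np_isomorphic (np_dot p) (np_circ p) (np_dot p) (np_circ p).
Proof.
apply/np_isomorphicP; exists unit3; split; last exact: respects_id.
  by apply/eqP; vsimpl => e; move/eqP: (oner_neq0 K); apply; rewrite -[RHS]e; ring.
exact: respects_id.
Qed.

Ltac iso_by f :=
  apply/np_isomorphicP; exists f; split; [vsimpl | respects_by..].

Lemma isomorphic_NP25 (a b c a' b' c' : K) :
    perm_eq [:: a; b; c] [:: a'; b'; c'] ->
  np_isomorphic (np_dot (NP25 a b c)) (np_circ (NP25 a b c))
    (np_dot (NP25 a' b' c')) (np_circ (NP25 a' b' c')).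
Proof.
have iso3 (f : 'I_3 -> vec K) x y z x' y' z' :
    respects f (dot_vtable Split) (dot_vtable Split) ->
    respects f (Split_circ x y z) (Split_circ x' y' z') -> det3 f != 0 ->
  np_isomorphic (np_dot (NP25 x y z)) (np_circ (NP25 x y z))
    (np_dot (NP25 x' y' z')) (np_circ (NP25 x' y' z')).
  by move=> fd fc nz; apply/np_isomorphicP; exists f.
have perm2 (x y x' y' : K) : perm_eq [:: x; y] [:: x'; y'] ->
    x = x' /\ y = y' \/ x = y' /\ y = x'.
  move=> xy; have : x \in [:: x'; y'] by rewrite -(perm_mem xy) mem_head.
  have perm1 (u v : K) : perm_eq [:: u] [:: v] -> u = v.
    by move/perm_mem/(_ u); rewrite mem_head inE => /esym/eqP.
  rewrite !inE => /orP[] /eqP e; rewrite {}e in xy *.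
    by rewrite perm_cons in xy; left; split=> //; exact: perm1.
  by right; split=> //; apply: perm1; rewrite -(perm_cons y') (permPl xy);
    exact: permEl (perm_catC [:: _] [:: _]).
move=> abc; have : a \in [:: a'; b'; c'] by rewrite -(perm_mem abc) mem_head.
rewrite !inE => /or3P[] /eqP e; rewrite {}e in abc *.
- move: abc; rewrite perm_cons => /perm2[[-> ->]|[-> ->]].
    exact: np_isomorphic_refl.
  apply: (iso3 (frame3 (1, 0, 0) (0, 0, 1) (0, 1, 0))); [respects_by..|].
  by det_tac.
- have : perm_eq [:: b; c] [:: a'; c'].
    by rewrite -(perm_cons b') (permPl abc) (perm_catCA [:: _] [:: _]).
  case/perm2 => -[-> ->].
    by apply: (iso3 (frame3 (0, 1, 0) (1, 0, 0) (0, 0, 1))); [respects_by..|det_tac].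
  by apply: (iso3 (frame3 (0, 0, 1) (1, 0, 0) (0, 1, 0))); [respects_by..|det_tac].
- have : perm_eq [:: b; c] [:: a'; b'].
    by rewrite -(perm_cons c') (permPl abc) -(permPl (permEl (perm_catC [:: c'] [:: a'; b']))).
  case/perm2 => -[-> ->].
    by apply: (iso3 (frame3 (0, 1, 0) (0, 0, 1) (1, 0, 0))); [respects_by..|det_tac].
  by apply: (iso3 (frame3 (0, 0, 1) (0, 1, 0) (1, 0, 0))); [respects_by..|det_tac].
Qed.

Lemma isomorphic_of_same_class p q :
    np_index p = np_index q -> np_same_class p q ->
  np_isomorphic (np_dot p) (np_circ p) (np_dot q) (np_circ q).
Proof.
case: p; case: q => //;
  try by move=> *; match goal with H : np_same_class _ _ |- _ =>
    rewrite H; exact: np_isomorphic_refl end.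
all: try by move=> _ _; exact: np_isomorphic_refl.
- move=> c d a b _ [] [-> ->]; first exact: np_isomorphic_refl.
  (* The exchange of [e1] and [e3]; the multiples of [e2] restore [e1 ∘ e1 = e1 ∘ e3 = e1]. *)
  iso_by (frame3 (0, - c, 1) (0, 1, 0) (1, - d, 0) : 'I_3 -> vec K).
  by det_tac.
- move=> a2 b2 c2 a1 b1 c1 _ [].
    by case=> -> -> [-> ->]; exact: np_isomorphic_refl.
  case=> nzc1 nzc2 [] [a12 b12 c12]; subst; first exact: np_isomorphic_refl.
  (* The old [e3] becomes [e1], so its square [c2 e2] must become [e2]; scaling the new [e3] by [c2]
     keeps the product [e1 · e3 = e2]. *)
  iso_by (frame3 (0, 0, 1) (0, c2, 0) (c2, 0, 0) : 'I_3 -> vec K).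
  by det_tac; rewrite mulf_neq0 //; apply/eqP.
- move=> c d a b _ [] [-> ->]; first exact: np_isomorphic_refl.
  iso_by (frame3 (0, 0, 1) (0, 1, 0) (1, 0, 0) : 'I_3 -> vec K).
  by det_tac.
- move=> c d a b _ [-> []] ->; first exact: np_isomorphic_refl.
  iso_by (frame3 (-1, 0, 0) (0, 1, 0) (0, 0, 1) : 'I_3 -> vec K).
  by det_tac.
- by move=> a' b' c' a b c _; exact: isomorphic_NP25.
- move=> c d a b _ [] [-> ->]; first exact: np_isomorphic_refl.
  iso_by (frame3 (0, 1, 0) (1, 0, 0) (0, 0, 1) : 'I_3 -> vec K).
  by det_tac.
- move=> c d a b _ [] [-> ->]; first exact: np_isomorphic_refl.
  iso_by (frame3 (0, 1, 0) (1, 0, 0) (0, 0, 1) : 'I_3 -> vec K).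
  by det_tac.
- move=> b a _ [] ->; first exact: np_isomorphic_refl.
  iso_by (frame3 (-1, 0, 0) (0, 1, 0) (0, 0, -1) : 'I_3 -> vec K).
  by det_tac.
- move=> b a _ [] ->; first exact: np_isomorphic_refl.
  iso_by (frame3 (1, 0, 0) (0, 1, 0) (0, 0, -1) : 'I_3 -> vec K).
  by det_tac.
- move=> c d a b _ [-> []] ->; first exact: np_isomorphic_refl.
  iso_by (frame3 (1, 0, 0) (0, 1, 0) (0, 0, -1) : 'I_3 -> vec K).
  by det_tac.
Qed.

End SameClass.

(** * Commutative associative products in dimension 3 *)

Section VectorLemmas.
Variables (K : fieldType) (A : vectType K).
Implicit Types u v x y z : A.

(** Coordinate functionals separate vectors. Through them, [modring] below turns an identity of
    vectors into a [ring] identity in [K]. *)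
Lemma vec_ext u v :
    (forall f : A -> K, {morph f : x y / x + y} ->
       (forall a x, f (a *: x) = a * f x) -> {morph f : x / - x} ->
       f 0 = 0 -> f u = f v) ->
  u = v.
Proof.
move=> uv; rewrite (coord_vbasis (memvf u)) (coord_vbasis (memvf v)).
apply: eq_bigr => i _; congr (_ *: _); apply: uv => [x y|a x|x|].
- by rewrite linearD.
- by rewrite linearZ.
- by rewrite linearN.
- by rewrite linear0.
Qed.

Lemma mem_span1 x u : x \in <<[:: u]>>%VS -> exists a, x = a *: u.
Proof. by rewrite span_seq1 => /vlineP. Qed.

Lemma mem_span2 x u v :
  x \in <<[:: u; v]>>%VS -> exists a b, x = a *: u + b *: v.
Proof.
rewrite span_cons => /memv_addP[_ /vlineP[a ->] [_ /mem_span1[b ->] ->]].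
by exists a, b.
Qed.

Lemma mem_span3 x u v w :
  x \in <<[:: u; v; w]>>%VS -> exists a b c, x = a *: u + b *: v + c *: w.
Proof.
rewrite span_cons => /memv_addP[_ /vlineP[a ->] [_ /mem_span2[b [c ->]] ->]].
by exists a, b, c; rewrite addrA.
Qed.

Lemma free2P u v :
  reflect (forall a b, a *: u + b *: v = 0 -> a = 0 /\ b = 0)
          (free [:: u; v]).
Proof.
apply: (iffP idP) => [fuv a b ab0|ind]; last first.
  rewrite free_cons seq1_free; apply/andP; split.
    apply/negP => /mem_span1[a ua]; have [|/eqP] := ind 1 (- a).
      by rewrite ua scale1r scaleNr subrr.
    by rewrite oner_eq0.
  apply/eqP => v0; have [|_ /eqP] := ind 0 1; last by rewrite oner_eq0.
  by rewrite v0 scale0r scaler0 addr0.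
move: fuv; rewrite free_cons seq1_free => /andP[uNv nzv].
have a0 : a = 0.
  apply/eqP; apply: contraNT uNv => nza.
  have -> : u = (- (b / a)) *: v.
    have /(congr1 ( *:%R a^-1)) := ab0.
    rewrite scalerDr !scalerA mulVf // scale1r scaler0 => /eqP.
    by rewrite addr_eq0 => /eqP->; rewrite scaleNr [b / a]mulrC.
  by rewrite memvZ // memv_span1.
split=> //; move/eqP: ab0; rewrite a0 scale0r add0r scaler_eq0 (negPf nzv) orbF.
by move/eqP.
Qed.

Hypothesis dimA : \dim {:A} = 3%N.

Lemma free_size (X : seq A) : free X -> (size X <= 3)%N.
Proof. by move/eqP=> <-; rewrite -dimA dimvS ?subvf. Qed.

Lemma extend_free (X : seq A) :
  (size X < 3)%N -> exists z, z \notin <<X>>%VS.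
Proof.
move=> X3; have : ~~ (fullv <= <<X>>)%VS.
  by apply: contraL X3 => /dimvS; rewrite dimA -leqNgt => /leq_trans; apply;
    exact: dim_span.
by case/subvPn => z _ zX; exists z.
Qed.

Lemma free3_rot u v z :
  free [:: u; v; z] = (z \notin <<[:: u; v]>>%VS) && free [:: u; v].
Proof.
by rewrite -free_cons; apply: perm_free; apply: permEl (perm_catC [:: u; v] [:: z]).
Qed.

Lemma free3_AC u v z : free [:: u; v; z] = free [:: u; z; v].
Proof.
by apply: perm_free; rewrite perm_cons; apply: permEl (perm_catC [:: v] [:: z]).
Qed.

Lemma free3_rotl u v z : free [:: u; v; z] = free [:: v; z; u].
Proof. by apply: perm_free; apply: permEl (perm_catC [:: u] [:: v; z]). Qed.

Lemma free2C u v : free [:: u; v] = free [:: v; u].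
Proof. by apply: perm_free; apply: permEl (perm_catC [:: u] [:: v]). Qed.

Lemma free3_span u v w x :
  free [:: u; v; w] -> exists a b c, x = a *: u + b *: v + c *: w.
Proof.
move=> fuvw; apply: mem_span3; apply: contraT => xN.
by have := @free_size [:: x; u; v; w]; rewrite free_cons xN fuvw => /(_ isT).
Qed.

End VectorLemmas.

Ltac modring :=
  apply: vec_ext; let f := fresh "f" in let fD := fresh "fD" in
  let fZ := fresh "fZ" in let fN := fresh "fN" in let f0 := fresh "f0" in
  move=> f fD fZ fN f0; rewrite ?(fD, fZ, fN, f0); ring.
Definition sym6 (K : Type) (p11 p12 p13 p22 p23 p33 : vec K) (i j : 'I_3) :=
  frame3 (frame3 p11 p12 p13) (frame3 p12 p22 p23) (frame3 p13 p23 p33) i j.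

Ltac tab_tac :=
  do 2 apply: ord3P; rewrite /sym6 /dot_vtable; vsimpl; apply: vec_eq.

(** * Nilpotent products, unital products, and products with an idempotent but no unit *)

Section DotClass.
Variables (K : numClosedFieldType) (A : vectType K) (dot : A -> A -> A).
Hypotheses (dimA : \dim {:A} = 3%N) (dot_bil : bilinear_product dot).
Hypotheses (dotC : commutative dot) (dotA : associative dot).
Local Notation "x ** y" := (dot x y) (at level 40, left associativity).

Let DE := (bilDl dot_bil, bilDr dot_bil, bilZl dot_bil, bilZr dot_bil,
  bilNl dot_bil, bilNr dot_bil, bil0l dot_bil, bil0r dot_bil).

Let dotAC x y z : x ** y ** z = x ** z ** y.
Proof. by rewrite -dotA [y ** z]dotC dotA. Qed.

Let dotCA x y z : x ** (y ** z) = y ** (x ** z).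
Proof. by rewrite dotA [x ** y]dotC -dotA. Qed.

(* Nilpotency, since the dimension is 3. *)
Definition nil4 (x : A) : Prop := x ** (x ** (x ** x)) = 0.

(** [e] is built from [y] by scaling and multiplying, and [e] fixes [y]; hence [e] fixes [e]. *)
Lemma idempotent_of_factor (y g e : A) (c : K) :
  y <> 0 -> e = c *: y + y ** g -> y = y ** e -> e <> 0 /\ e ** e = e.
Proof.
move=> nzy eE ye; split=> [e0|]; first by apply: nzy; rewrite ye e0 DE.
have ey : e ** y = y by rewrite dotC -ye.
by rewrite {2}eE bilDr // bilZr // dotA ey -eE.
Qed.

(* A linear dependency between [x], [x^2], [x^3], [x^4] rewrites the lowest power [y]
   occurring in it as [y ** e], and [e] is then idempotent. *)
Lemma idempotent_or_nil (x : A) :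
  (exists e, [/\ e <> 0, e ** e = e & forall u, u ** x = 0 -> u ** e = 0])
  \/ nil4 x.
Proof.
have [xnil|xnn] := pselect (nil4 x); [by right | left].
pose x2 := x ** x; pose x3 := x ** x2; pose x4 := x ** x3.
have /negP : ~ free [:: x; x2; x3; x4].
  by move/(free_size dimA).
have nx4 : x4 <> 0 by [].
have main y g c : y <> 0 -> y = y ** (c *: y + y ** g) ->
    (forall u, u ** x = 0 -> u ** y = 0) ->
  exists e, [/\ e <> 0, e ** e = e & forall u, u ** x = 0 -> u ** e = 0].
  move=> nzy ye uy; have [nze ee] := idempotent_of_factor nzy erefl ye.
  exists (c *: y + y ** g); split=> // u /uy u0.
  by rewrite !DE dotA u0 DE scaler0 addr0.
have xn0 : x <> 0 by move=> x0; apply: nx4; rewrite /x4 /x3 /x2 x0 !DE.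
have x2n0 : x2 <> 0 by move=> x0; apply: nx4; rewrite /x4 /x3 x0 !DE.
have x3n0 : x3 <> 0 by move=> x0; apply: nx4; rewrite /x4 x0 !DE.
rewrite !free_cons nil_free andbT !negb_and !negbK.
case/or3P => [/mem_span3[a [b [c xE]]]|/mem_span2[a [b xE]]|].
- apply: (main x (b *: x + c *: x2) a) => //.
  by rewrite [LHS]xE !DE -addrA.
(* From [x2 = a x3 + b x4] one more factor [x] gives [x3 = a x4 + b x^5]; substituting writes [x2]
   with [x4] and [x^5], that is, with [x2 ** x2] and [x2 ** x3]. *)
- apply: (main x2 ((a * b) *: x) (a * a + b)) => // [|u u0]; last first.
    by rewrite /x2 dotA u0 DE.
  have x2x : x2 ** x = x3 by rewrite dotC.
  have x2x2 : x2 ** x2 = x4 by rewrite {1}/x2 -dotA.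
  have x3E : x3 = a *: x4 + b *: (x ** x4) by rewrite {1}/x3 xE !DE.
  have x2x3 : x2 ** x3 = x ** x4 by rewrite -[x2 ** x3]dotA.
  rewrite !DE x2x2 x2x x2x3 [LHS]xE {1}x3E; modring.
case/orP => [/mem_span1[a xE]|].
  (* Iterating [x3 = a x4] three times gives [x^3 = a^3 x^6], so [a^3 x^3] will be the
     idempotent. *)
  have x3E : x3 = (a * a * a) *: (x3 ** x3).
    have x4E : x4 = a *: (x ** x4) by rewrite {1}/x4 xE !DE.
    have x5E : x ** x4 = a *: (x ** (x ** x4)).
      by rewrite {1}x4E !DE.
    rewrite [LHS]xE x4E x5E !scalerA.
    by congr (_ *: _); rewrite /x4 /x3 /x2 -!dotA.
  apply: (main x3 0 (a * a * a)) => // [|u u0]; first by rewrite !DE addr0 [LHS]x3E.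
  by rewrite /x3 dotA u0 DE.
by rewrite span_nil memv0 => /eqP.
Qed.

(** The iterates of multiplication by [x] on [u] are dependent, which gives a monic polynomial
    killing [u]. For a root [r], its quotient by [T - r] applied to [u] is an eigenvector, unless it
    vanishes and thus provides a shorter dependency. *)
Lemma eigenvector (x u : A) : u <> 0 -> exists l v, v <> 0 /\ x ** v = l *: v.
Proof.
move=> nzu; pose u1 := x ** u; pose u2 := x ** u1; pose u3 := x ** u2.
have lin1 a : u1 = a *: u -> exists l v, v <> 0 /\ x ** v = l *: v.
  by exists a, u.
have lin2 a b : u2 = a *: u1 + b *: u ->
    exists l v, v <> 0 /\ x ** v = l *: v.
  move=> uE; have [r] := solve_monicpoly (fun i => [:: b; a]`_i) (isT : 0 < 2)%N.
  rewrite !big_ord_recl big_ord0 /= expr0 expr1 mulr1 addr0 => rE.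
  have [q0|nzq] := pselect (u1 + (r - a) *: u = 0).
    apply: (lin1 (a - r)); apply/eqP; rewrite -subr_eq0 -scaleNr opprB.
    exact/eqP.
  exists r, (u1 + (r - a) *: u); split=> //; rewrite !DE -/u2 -/u1 uE.
  have -> : b = r * r - a * r by rewrite -expr2 rE; ring.
  by modring.
have lin3 a b c : u3 = a *: u2 + b *: u1 + c *: u ->
    exists l v, v <> 0 /\ x ** v = l *: v.
  move=> uE; have [r] := solve_monicpoly (fun i => [:: c; b; a]`_i) (isT : 0 < 3)%N.
  rewrite !big_ord_recl big_ord0 /= expr0 expr1 mulr1 addr0 => rE.
  have [q0|nzq] := pselect (u2 + (r - a) *: u1 + (r * r - a * r - b) *: u = 0).
    apply: (lin2 (a - r) (a * r + b - r * r)); apply/eqP.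
    rewrite -subr_eq0; apply/eqP; rewrite -[RHS]q0; by modring.
  exists r, (u2 + (r - a) *: u1 + (r * r - a * r - b) *: u); split=> //.
  rewrite !DE -/u3 -/u2 -/u1 uE.
  have -> : c = r ^+ 3 - a * (r * r) - b * r by rewrite rE /bump /=; ring.
  by modring.
have /negP : ~ free [:: u3; u2; u1; u] by move/(free_size dimA).
rewrite !free_cons nil_free andbT !negb_and !negbK.
case/or3P => [/mem_span3[a [b [c]]]|/mem_span2[a [b]]|]; first exact: lin3.
  exact: lin2.
case/orP => [/mem_span1[a]|]; first exact: lin1.
by rewrite span_nil memv0 => /eqP.
Qed.

Definition realizes (t : vtable K) : Prop :=
  exists w, frame w /\ has_table w dot t.

Lemma realizes_products t x y z p11 p12 p13 p22 p23 p33 :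
    free [:: x; y; z] ->
    x ** x = lin (frame3 x y z) p11 -> x ** y = lin (frame3 x y z) p12 ->
    x ** z = lin (frame3 x y z) p13 -> y ** y = lin (frame3 x y z) p22 ->
    y ** z = lin (frame3 x y z) p23 -> z ** z = lin (frame3 x y z) p33 ->
    (forall i j, vmul t (unit3 i) (unit3 j) =
       sym6 p11 p12 p13 p22 p23 p33 i j) ->
  realizes t.
Proof.
move=> fxyz e11 e12 e13 e22 e23 e33 tp; exists (frame3 x y z); split.
  exact: free_frame.
apply: has_tableP => // i j; rewrite tp; move: i j.
do 2 apply: ord3P; rewrite /sym6 /frame3 //= -/(frame3 x y z) //.
- by rewrite dotC.
- by rewrite dotC.
- by rewrite dotC.
Qed.

Lemma realizes_change t t' P :
  realizes t -> det3 P != 0 -> respects P t t' -> realizes t'.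
Proof.
move=> [w [fw wt]] nzd Pt; exists (fun i => lin w (P i)); split.
  exact: frame_change.
exact: has_table_change wt Pt.
Qed.

(** A nonzero cube gives [Pow]. If all cubes vanish, polarization kills all triple products, and the
    product becomes a symmetric form with values in the line of one square [u = x ** x].
    Diagonalizing it gives [Sq] or, when the second square is nonzero, [Hyp]. *)
Lemma nil_class : (forall x, nil4 x) -> (exists x y, x ** y <> 0) ->
  exists k, realizes (dot_vtable k).
Proof.
rewrite /nil4 => xnil [x0 [y0 nz00]].
have [[x x3]|] := pselect (exists x, x ** (x ** x) <> 0).
  have x4 := xnil x; have x5 : x ** x ** (x ** (x ** x)) = 0.
    by rewrite -dotA x4 DE.
  exists Pow; apply: (@realizes_products _ x (x ** x) (x ** (x ** x))
    (0, 1, 0) (0, 0, 1) (0, 0, 0) (0, 0, 0) (0, 0, 0) (0, 0, 0)).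
  - apply/free3P => a b c e.
    have a0 : a = 0.
      have /(congr1 (dot (x ** x))) := e; rewrite !DE x5 scaler0 addr0.
      rewrite -[x ** x ** (x ** x)]dotA x4 scaler0 addr0 [x ** x ** x]dotC => /eqP.
      by rewrite scaler_eq0 => /orP[/eqP|/eqP].
    have b0 : b = 0.
      have /(congr1 (dot x)) := e; rewrite a0 scale0r add0r !DE x4 scaler0 addr0.
      by move=> /eqP; rewrite scaler_eq0 => /orP[/eqP|/eqP].
    move/eqP: e; rewrite a0 b0 !scale0r !add0r scaler_eq0 => /orP[/eqP|/eqP] //.
  - by rewrite linE; modring.
  - by rewrite linE; modring.
  - by rewrite linE x4; modring.
  - by rewrite linE -dotA x4; modring.
  - by rewrite linE x5; modring.
  - by rewrite linE -dotA x5 DE; modring.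
  by tab_tac; ring.
move=> Nx3; have x3 x : x ** (x ** x) = 0.
  by have [//|] := pselect (x ** (x ** x) = 0) => nx; case: Nx3; exists x.
have two0 (u : A) : u + u = 0 -> u = 0.
  move/eqP; rewrite -mulr2n -scaler_nat scaler_eq0 pnatr_eq0 => /eqP //.
have xxy x y : x ** x ** y = 0.
  have xyx : x ** (y ** x) = x ** x ** y by rewrite dotCA dotC.
  have xxy : x ** (x ** y) = x ** x ** y by rewrite dotA.
  have yxx : y ** (x ** x) = x ** x ** y by rewrite dotC.
  have yxy : y ** (x ** y) = x ** (y ** y) by rewrite dotCA.
  have yyx : y ** (y ** x) = x ** (y ** y).
    by rewrite [y ** x]dotC dotCA.
  (* The cubes of [x + y] and [x - y] separate [x^2 y] from [x y^2]. *)
  have e1 : 3 *: (x ** x ** y) + 3 *: (x ** (y ** y)) = 0.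
    rewrite -[RHS](x3 (x + y)) !DE !x3 xyx xxy yxx yxy yyx; modring.
  have e2 : - 3 *: (x ** x ** y) + 3 *: (x ** (y ** y)) = 0.
    rewrite -[RHS](x3 (x - y)) !DE !x3 xyx xxy yxx yxy yyx; modring.
  have : 6 *: (x ** x ** y) = 0.
    apply: etrans (_ : 0 - 0 = 0); last by rewrite subr0.
    by rewrite -{1}e1 -e2; modring.
  by move/eqP; rewrite scaler_eq0 pnatr_eq0 => /eqP.
have xyz x y z : x ** y ** z = 0.
  have := xxy (x + y) z; rewrite !DE !xxy [y ** x]dotC add0r addr0.
  exact: two0.
have [x nzu] : exists x, x ** x <> 0.
  have [//|Nx2] := pselect (exists x, x ** x <> 0); case: nz00.
  have x2 x : x ** x = 0.
    by have [//|nx] := pselect (x ** x = 0); case: Nx2; exists x.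
  have := x2 (x0 + y0); rewrite !DE !x2 [y0 ** x0]dotC add0r addr0.
  exact: two0.
pose u := x ** x.
have fxu : free [:: x; u].
  apply/free2P => a b e.
  have a0 : a = 0.
    have /(congr1 (dot x)) := e; rewrite !DE dotA xyz scaler0 addr0 => /eqP.
    by rewrite scaler_eq0 => /orP[/eqP|/eqP].
  by move/eqP: e; rewrite a0 scale0r add0r scaler_eq0 => /orP[/eqP|/eqP].
have [z zN] := @extend_free _ _ dimA [:: x; u] isT.
have fxuz : free [:: x; u; z] by rewrite free3_rot zN.
have /free3P ind := fxuz.
have [a [b [c xzE]]] := free3_span dimA (x ** z) fxuz.
(* Multiplying [x ** z = a x + b u + c z] by [x] makes the left side vanish; its [z]-coordinate
   gives [c^2 = 0], and then the [u]-coordinate gives [a = 0]. *)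
have [a0 c0] : a = 0 /\ c = 0.
  have := congr1 (dot x) xzE; rewrite dotA xyz !DE -/u /u dotA xyz xzE.
  rewrite -/u => e.
  have [|_ _ /eqP] := ind (c * a) (a + c * b) (c * c).
    by rewrite [RHS]e; modring.
  rewrite mulf_eq0 orbb => /eqP c0.
  have [|_ + _] := ind (c * a) (a + c * b) (c * c).
    by rewrite [RHS]e; modring.
  by rewrite c0 mul0r addr0.
have [y yE] : exists y, y = z - b *: x by exists (z - b *: x).
have xy : x ** y = 0.
  by rewrite yE !DE xzE a0 c0 -/u; modring.
have yu : y ** u = 0 by rewrite dotC xyz.
have fxuy : free [:: x; u; y].
  apply/free3P => k l m e; have [|k0 l0 m0] := ind (k - m * b) l m.
    by rewrite -[RHS]e yE; modring.
  by move: k0; rewrite m0 mul0r subr0.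
have [k [l [m yyE]]] := free3_span dimA (y ** y) fxuy.
have m0 : m = 0.
  have := congr1 (dot y) yyE; rewrite dotA xyz !DE [y ** x]dotC xy yu.
  rewrite !scaler0 !add0r => /esym/eqP; rewrite scaler_eq0 => /orP[/eqP //|/eqP yy0].
  by have /free3P/(_ k l m)[|] := fxuy; rewrite -?yyE.
have k0 : k = 0.
  have := congr1 (dot x) yyE; rewrite dotA xyz !DE xy [x ** u]dotA xyz.
  rewrite !scaler0 !addr0 => /esym/eqP; rewrite scaler_eq0.
  by move=> /orP[/eqP|/eqP].
have Dl : realizes [:: (i1, i1, (0, 1, 0)); (i3, i3, (0, l, 0))].
  apply: (@realizes_products _ x u y
    (0, 1, 0) (0, 0, 0) (0, 0, 0) (0, 0, 0) (0, 0, 0) (0, l, 0)) => //.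
  - by rewrite linE; modring.
  - by rewrite linE dotA xyz; modring.
  - by rewrite linE xy; modring.
  - by rewrite linE xyz; modring.
  - by rewrite linE xyz; modring.
  - by rewrite linE yyE k0 m0; modring.
  by tab_tac; ring.
have [l0|nzl] := eqVneq l 0.
  exists Sq; apply: (realizes_change (P := unit3) Dl).
    by vsimpl; apply/eqP => e; have /eqP := oner_neq0 K; apply; rewrite -[RHS]e; ring.
  by rewrite l0; tab_tac; ring.
pose s := sqrtC (- l).
have ss : s * s = - l by rewrite -expr2 sqrtCK.
have nzs : s != 0 by rewrite sqrtC_eq0 oppr_eq0.
(* The isotropic vectors [x + y / s] and [x - y / s], where [y ** y = - s^2 u]; their product is
   [2 u]. *)
exists Hyp; apply: (realizes_change
  (P := frame3 (1, 0, s^-1) (0, 2, 0) (1, 0, - s^-1)) Dl).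
  vsimpl; rewrite (_ : _ - _ + _ = - 4 * s^-1); last by ring.
  by rewrite mulf_neq0 ?invr_eq0 ?oppr_eq0 ?pnatr_eq0.
have lE : l = - (s * s) by rewrite ss opprK.
by rewrite lE; tab_tac; field.
Qed.

(** [v] is the last nonzero vector among [u], [y u], [y^2 u], [y^3 u]. Being a multiple of [u], it
    is killed by all that kills [u], so that applying the lemma twice gives a vector killed by two
    nilpotent elements. *)
Lemma nil_kernel (y u : A) : nil4 y -> u <> 0 ->
  exists v, [/\ v <> 0, y ** v = 0 & forall z, z ** u = 0 -> z ** v = 0].
Proof.
rewrite /nil4 => y4 nzu.
have [e1|n1] := pselect (y ** u = 0); first by exists u.
have [e2|n2] := pselect (y ** (y ** u) = 0).
  by exists (y ** u); split=> // z zu; rewrite dotCA zu DE.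
have [e3|n3] := pselect (y ** (y ** (y ** u)) = 0).
  by exists (y ** (y ** u)); split=> // z zu; rewrite dotCA [z ** _]dotCA zu !DE.
exists (y ** (y ** (y ** u))); split=> // [|z zu].
  by move: y4; rewrite !dotA => ->; rewrite DE.
by rewrite dotCA [z ** _]dotCA [z ** (y ** u)]dotCA zu !DE.
Qed.

(** By nilpotency [z] and [z^2] are independent, so they span the plane, and [z^3 = l z + m z^2].
    Then [z^4 = 0] reads [m l = 0] and [l + m^2 = 0], so [z^3 = 0]. *)
Lemma nil_plane_square (c a b z : A) :
    free [:: c; a; b] ->
    (exists p q, a ** a = p *: a + q *: b) ->
    (exists p q, a ** b = p *: a + q *: b) ->
    (exists p q, b ** b = p *: a + q *: b) ->
    nil4 z -> (exists p q, z = p *: a + q *: b) -> z ** z <> 0 ->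
  (exists p q, z ** z = p *: a + q *: b) /\
  (free [:: c; z; z ** z] /\ z ** (z ** z) = 0).
Proof.
move=> fcab [p1 [q1 aa]] [p2 [q2 ab]] [p3 [q3 bb]] z4 [p [q zE]] nzz.
have ba : b ** a = p2 *: a + q2 *: b by rewrite dotC.
have mulI x y k l m n : x = k *: a + l *: b -> y = m *: a + n *: b ->
    exists k' l', x ** y = k' *: a + l' *: b.
  move=> -> ->; rewrite !DE aa ab ba bb.
  by exists (k * m * p1 + k * n * p2 + l * m * p2 + l * n * p3),
    (k * m * q1 + k * n * q2 + l * m * q2 + l * n * q3); modring.
have [p' [q' zzE]] := mulI _ _ _ _ _ _ zE zE.
have [p'' [q'' zzzE]] := mulI _ _ _ _ _ _ zE zzE.
have /free3P ind := fcab.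
have z5 : z ** z ** (z ** z) = 0 by rewrite -dotA.
have indz l m : l *: z + m *: (z ** z) = 0 -> l = 0 /\ m = 0.
  move=> e; have l0 : l = 0.
    apply/eqP; apply/negP => /negP nzl.
    have z3 : z ** (z ** z) = 0.
      have /(congr1 (dot (z ** z))) := e; rewrite !DE z5 scaler0 addr0.
      by rewrite [z ** z ** z]dotC => /eqP; rewrite scaler_eq0 (negPf nzl) => /eqP.
    have /(congr1 (dot z)) := e; rewrite !DE z3 scaler0 addr0 => /eqP.
    by rewrite scaler_eq0 (negPf nzl) => /eqP.
  split=> //; move/eqP: e; rewrite l0 scale0r add0r scaler_eq0.
  by move=> /orP[/eqP|/eqP].
have fz : free [:: c; z; z ** z].
  apply/free3P => k l m e.
  have [|k0 _ _] := ind k (l * p + m * p') (l * q + m * q').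
    by rewrite -[RHS]e zzE [in RHS]zE; modring.
  by have [|l0 m0] := indz l m; first by rewrite -[RHS]e k0 scale0r add0r.
split; first by exists p', q'.
split=> //; have [k [l [m z3E]]] := free3_span dimA (z ** (z ** z)) fz.
have k0 : k = 0.
  have [|//] := ind k (l * p + m * p' - p'') (l * q + m * q' - q'').
  have -> : 0 = k *: c + l *: z + m *: (z ** z) - z ** (z ** z).
    by rewrite -z3E subrr.
  by rewrite zzzE zzE [in RHS]zE; modring.
rewrite k0 scale0r add0r in z3E.
have z4E : l *: (z ** z) + m *: (z ** (z ** z)) = 0.
  by rewrite -[RHS]z4 [in RHS]z3E !DE.
have [|lm0 llm0] := indz (m * l) (l + m * m).
  by rewrite -[RHS]z4E z3E; modring.
have l0 : l = 0.
  move/eqP: lm0; rewrite mulf_eq0 => /orP[/eqP m0|/eqP //].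
  by rewrite m0 mulr0 addr0 in llm0.
have m0 : m = 0.
  by move/eqP: llm0; rewrite l0 add0r mulf_eq0 orbb => /eqP.
by rewrite z3E l0 m0 !scale0r addr0.
Qed.

(* The nilpotent span of [a], [b], either has zero product or is generated by
   one element. *)
Lemma nil_plane (c a b : A) :
    free [:: c; a; b] ->
    (exists p q, a ** a = p *: a + q *: b) ->
    (exists p q, a ** b = p *: a + q *: b) ->
    (exists p q, b ** b = p *: a + q *: b) ->
    (forall p q, nil4 (p *: a + q *: b)) ->
  [/\ a ** a = 0, a ** b = 0 & b ** b = 0] \/
  exists z, [/\ exists p q, z = p *: a + q *: b, exists p q, z ** z = p *: a + q *: b,
    free [:: c; z; z ** z] & z ** (z ** z) = 0].
Proof.
move=> fcab [p1 [q1 aa]] [p2 [q2 ab]] [p3 [q3 bb]] abnil.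
have sq := nil_plane_square fcab (ex_intro _ p1 (ex_intro _ q1 aa))
  (ex_intro _ p2 (ex_intro _ q2 ab)) (ex_intro _ p3 (ex_intro _ q3 bb)).
have [[p [q nzz]]|N] := pselect (exists p q,
    (p *: a + q *: b) ** (p *: a + q *: b) <> 0).
  right; exists (p *: a + q *: b).
  have [|zz [fz z3]] := sq _ (abnil p q) _ nzz; first by exists p, q.
  by split=> //; exists p, q.
left; have z0 p q : (p *: a + q *: b) ** (p *: a + q *: b) = 0.
  have [//|nz] := pselect ((p *: a + q *: b) ** (p *: a + q *: b) = 0).
  by case: N; exists p, q.
have aa0 : a ** a = 0 by rewrite -[RHS](z0 1 0) !(scale0r, scale1r, addr0).
have bb0 : b ** b = 0 by rewrite -[RHS](z0 0 1) !(scale0r, scale1r, add0r).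
split=> //; have := z0 1 1; rewrite !scale1r !DE aa0 bb0 [b ** a]dotC add0r addr0.
by move/eqP; rewrite -mulr2n -scaler_nat scaler_eq0 pnatr_eq0 => /eqP.
Qed.

Lemma scale_eq0 (a : K) (v : A) : a *: v = 0 -> v <> 0 -> a = 0.
Proof. by move/eqP; rewrite scaler_eq0 => /orP[/eqP|/eqP]. Qed.

(* The algebra K[t]/(t^2 - c t - b) next to a line spanned by a vector of square [d]. *)
Definition quad_vtable (b c d : K) : vtable K :=
  [:: (i1, i1, (1, 0, 0)); (i1, i2, (0, 1, 0)); (i2, i1, (0, 1, 0));
      (i2, i2, (b, c, 0)); (i3, i3, (0, 0, d))].

(** Completing the square, [t - c/2] has square [D]. It is nilpotent for [D = 0]; otherwise, with
    [s^2 = D], the idempotents are [1/2 + (t - c/2)/(2 s)] and [1/2 - (t - c/2)/(2 s)]. *)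
Lemma quad_class b c d : d = 1 \/ d = 0 -> realizes (quad_vtable b c d) ->
  exists k, realizes (dot_vtable k).
Proof.
move=> d01 R0; pose D := b + c * c / 4.
have [D0|nzD] := eqVneq D 0.
  have bE : b = - (c * c / 4) by apply/eqP; rewrite -addr_eq0; apply/eqP.
  case: d01 => d_eq; rewrite {}d_eq in R0.
    exists SplitDual; apply: (realizes_change
      (P := frame3 (1, 0, 0) (0, 0, 1) (- (c / 2), 1, 0)) R0).
      by det_tac.
    by rewrite bE /quad_vtable; tab_tac; field.
  (* The vector [e2] is the nilpotent [t - c/2], and [e1] is its sum with the null vector, so that
     [e1 - e2] spans the null line. *)
  exists DualNull; apply: (realizes_change
    (P := frame3 (- (c / 2), 1, 1) (- (c / 2), 1, 0) (1, 0, 0)) R0).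
    by det_tac.
  by rewrite bE /quad_vtable; tab_tac; field.
pose s := sqrtC D.
have ss : s * s = D by rewrite -expr2 sqrtCK.
have nzs : s != 0 by rewrite sqrtC_eq0.
have bE : b = s * s - c * c / 4 by rewrite ss /D addrK.
have nzdet : det3 (frame3 (2^-1 - c / (4 * s), (2 * s)^-1, 0)
    (2^-1 + c / (4 * s), - (2 * s)^-1, 0) (0, 0, 1)) != 0.
  vsimpl; rewrite (_ : _ - _ + _ = - (2 * s)^-1); last by field.
  by rewrite oppr_eq0 invr_eq0 mulf_neq0 ?pnatr_eq0.
case: d01 => d_eq; rewrite {}d_eq in R0.
  exists Split; apply: (realizes_change R0 nzdet).
  by rewrite bE /quad_vtable; tab_tac; field.
exists SplitNull; apply: (realizes_change R0 nzdet).
by rewrite bE /quad_vtable; tab_tac; field.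
Qed.

Lemma free_idempotents (e f : A) : e <> 0 -> f <> 0 -> e ** e = e ->
  e ** f = 0 -> free [:: e; f].
Proof.
move=> nze nzf ee ef; apply/free2P => a b ab0.
have a0 : a = 0.
  apply: scale_eq0 nze; have /(congr1 (dot e)) := ab0.
  by rewrite !DE ee ef scaler0 addr0.
by split=> //; apply: scale_eq0 nzf; rewrite -[RHS]ab0 a0 scale0r add0r.
Qed.

(** The image of [f] is the plane of [f] and [t], a unital quadratic algebra next to the idempotent
    line of [e]. *)
Lemma split_unital (e f t : A) :
    e ** e = e -> f ** f = f -> e ** f = 0 -> e ** t = 0 -> f ** t = t ->
    free [:: f; t; e] ->
  exists k, realizes (dot_vtable k).
Proof.
move=> ee ff ef et ft ffte; have nze : e <> 0.
  by move=> e0; move: ffte; rewrite e0 free3_rot mem0v.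
have [b [c [k ttE]]] := free3_span dimA (t ** t) ffte.
have k0 : k = 0.
  apply: scale_eq0 nze; have /(congr1 (dot e)) := ttE.
  by rewrite dotA !DE ee ef et !DE !scaler0 !add0r.
apply: (@quad_class b c 1); first by left.
apply: (realizes_products (x := f) (y := t) (z := e)
  (p11 := (1, 0, 0)) (p12 := (0, 1, 0)) (p13 := (0, 0, 0))
  (p22 := (b, c, 0)) (p23 := (0, 0, 0)) (p33 := (0, 0, 1))) => //.
- by rewrite linE ff; modring.
- by rewrite linE ft; modring.
- by rewrite linE dotC ef; modring.
- by rewrite linE ttE k0; modring.
- by rewrite linE dotC et; modring.
- by rewrite linE ee; modring.
by rewrite /quad_vtable; tab_tac; ring.
Qed.

(** An idempotent [e] other than 0 and [one] splits the algebra into the images of [e] and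
    [one - e], one of which is a plane. Without such an idempotent the algebra is local, and its
    type is that of the product on the nilpotent plane. *)
Lemma unital_class (one : A) : (forall x, one ** x = x) ->
  exists k, realizes (dot_vtable k).
Proof.
move=> oneP; have nz1 : one <> 0.
  move=> one0; have [z] := @extend_free _ _ dimA [::] isT.
  by rewrite -[z]oneP one0 DE mem0v.
have [[e [ee nze ne1]]|N] := pselect (exists e, [/\ e ** e = e, e <> 0 & e <> one]).
  have [f fE] : exists f, f = one - e by exists (one - e).
  have nzf : f <> 0 by rewrite fE => /subr0_eq/esym.
  have ef : e ** f = 0 by rewrite fE !DE ee dotC oneP subrr.
  have ff : f ** f = f by rewrite {1}fE !DE oneP ef subr0.
  have fef := free_idempotents nze nzf ee ef.
  have fe : f ** e = 0 by rewrite dotC.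
  have [z zN] := @extend_free _ _ dimA [:: e; f] isT.
  have zE : z = e ** z + f ** z by rewrite -bilDl // fE addrC subrK oneP.
  have [ezS|ezN] := boolP (e ** z \in <<[:: e; f]>>%VS); last first.
    apply: (@split_unital f e (e ** z)) => //.
    - by rewrite dotA fe DE.
    - by rewrite dotA ee.
    by rewrite free3_AC free3_rot ezN.
  apply: (@split_unital e f (f ** z)) => //.
  - by rewrite dotA ef DE.
  - by rewrite dotA ff.
  have fzN : f ** z \notin <<[:: e; f]>>%VS.
    by apply: contra zN => fzS; rewrite zE rpredD.
  by rewrite -free3_rotl free3_rot fzN.
(* Subtracting an eigenvalue makes [x] nilpotent: otherwise the idempotent obtained would be [one],
   and yet kill an eigenvector. *)
have localP x : exists l, nil4 (x - l *: one).
  have [l [v [nzv xv]]] := eigenvector x nz1; exists l.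
  have [[e [nze ee eu]]|//] := idempotent_or_nil (x - l *: one).
  case: N; exists e; split=> // e1; apply: nzv.
  rewrite -(oneP v) -e1 dotC; apply: eu.
  by rewrite dotC !DE oneP xv subrr.
have [a1 a1N] := @extend_free _ _ dimA [:: one] isT.
have [b1 b1N] := @extend_free _ _ dimA [:: one; a1] isT.
have [la anil] := localP a1; have [lb bnil] := localP b1.
have f1 : free [:: one; a1; b1].
  by rewrite free3_rot b1N free2C free_cons a1N seq1_free; apply/eqP.
have [a aE] : exists a, a = a1 - la *: one by exists (a1 - la *: one).
have [b bE] : exists b, b = b1 - lb *: one by exists (b1 - lb *: one).
rewrite -aE -bE in anil bnil.
have fab : free [:: one; a; b].
  apply/free3P => x y z e; have /free3P ind := f1.
  have [|x0 y0 z0] := ind (x - y * la - z * lb) y z.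
    by rewrite -[RHS]e aE bE; modring.
  by move: x0; rewrite y0 z0 !mul0r !subr0.
(* A vector killed by both [a] and [b]: its annihilator is their plane, which is thereby an
   ideal. *)
have [v1 [nzv1 av1 _]] := nil_kernel anil nz1.
have [v [nzv bv /(_ a av1) av]] := nil_kernel bnil nzv1.
have inI x : x ** v = 0 -> exists p q, x = p *: a + q *: b.
  have [k [p [q ->]]] := free3_span dimA x fab.
  rewrite !DE oneP av bv !scaler0 !addr0 => /scale_eq0/(_ nzv) ->.
  by exists p, q; rewrite scale0r add0r.
(* Some [p a + q b - l] is nilpotent and acts on [v] as [- l], so [l = 0]. *)
have nilI p q : nil4 (p *: a + q *: b).
  have [l] := localP (p *: a + q *: b).
  have [n nE] : exists n, n = p *: a + q *: b - l *: one.
    by exists (p *: a + q *: b - l *: one).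
  rewrite -nE => n4; have nv : n ** v = - l *: v.
    by rewrite nE !DE av bv oneP !scaler0 addr0 sub0r scaleNr.
  have n4v : (l * l * l * l) *: v = 0.
    have : n ** (n ** (n ** n)) ** v = 0 by rewrite n4 DE.
    by rewrite -!dotA !(nv, DE) !scalerA => <-; congr (_ *: _); ring.
  have /eqP := scale_eq0 n4v nzv; rewrite !mulf_eq0 !orbb => /eqP l0.
  by move: n4; rewrite nE l0 scale0r subr0.
have pab x y : x ** v = 0 -> exists p q, x ** y = p *: a + q *: b.
  by move=> xv; apply: inI; rewrite dotAC xv DE.
case: (nil_plane fab (pab _ _ av) (pab _ _ av)
  (pab _ _ bv) nilI) => [[aa ab bb]|[z [_ _ fz z3]]].
  exists Loc; apply: (realizes_products (x := a) (y := b)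
    (z := one) (p11 := (0, 0, 0)) (p12 := (0, 0, 0)) (p13 := (1, 0, 0))
    (p22 := (0, 0, 0)) (p23 := (0, 1, 0)) (p33 := (0, 0, 1))) => //.
  - by rewrite -free3_rotl.
  - by rewrite linE aa; modring.
  - by rewrite linE ab; modring.
  - by rewrite linE dotC oneP; modring.
  - by rewrite linE bb; modring.
  - by rewrite linE dotC oneP; modring.
  - by rewrite linE oneP; modring.
  by tab_tac; ring.
exists Trunc; apply: (realizes_products (x := z) (y := z ** z)
  (z := one) (p11 := (0, 1, 0)) (p12 := (0, 0, 0)) (p13 := (1, 0, 0))
  (p22 := (0, 0, 0)) (p23 := (0, 1, 0)) (p33 := (0, 0, 1))) => //.
- by rewrite -free3_rotl.
- by rewrite linE; modring.
- by rewrite linE z3; modring.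
- by rewrite linE dotC oneP; modring.
- by rewrite linE -dotA z3 DE; modring.
- by rewrite linE dotC oneP; modring.
- by rewrite linE oneP; modring.
by tab_tac; ring.
Qed.

(** The space is the sum of the image and the annihilator of an idempotent [e], and the annihilator
    is nonzero in the absence of a unit. The image has dimension 2 or 1; in the second case the
    annihilator is a plane, either nilpotent or containing another idempotent. *)
Lemma dot_class : (exists x y, x ** y <> 0) -> exists k, realizes (dot_vtable k).
Proof.
move=> nz; have [anil|Nnil] := pselect (forall x, nil4 x).
  exact: nil_class.
have [[one oneP]|N1] := pselect (exists one, forall x, one ** x = x).
  exact: unital_class oneP.
have [e [nze ee]] : exists e, e <> 0 /\ e ** e = e.
  move/existsNP: Nnil => [x xN].
  by have [[e [nze ee _]]|//] := idempotent_or_nil x; exists e.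
(* Excludes a nonzero square on a leftover line: rescaled to an idempotent and added to the others,
   it would complete a unit. *)
have unit_frame u x y z : free [:: x; y; z] -> u ** x = x -> u ** y = y ->
    u ** z = z -> False.
  move=> fxyz ux uy uz; apply: N1; exists u => v.
  have [p [q [r ->]]] := free3_span dimA v fxyz.
  by rewrite !DE ux uy uz.
have [y0 [nzy0 ey0]] : exists y0, y0 <> 0 /\ e ** y0 = 0.
  have [x ex] : exists x, e ** x <> x.
    by apply/existsNP => eP; apply: N1; exists e.
  exists (x - e ** x); split; first by move=> /subr0_eq /esym.
  by rewrite !DE dotA ee subrr.
have fey := free_idempotents nze nzy0 ee ey0.
have [z zN] := @extend_free _ _ dimA [:: e; y0] isT.
have [ezS|ezN] := boolP (e ** z \in <<[:: e; y0]>>%VS); last first.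
  have [t tE] : exists t, t = e ** z by exists (e ** z).
  rewrite -tE in ezN; have et : e ** t = t by rewrite tE dotA ee.
  have ft : free [:: e; t; y0] by rewrite free3_AC free3_rot ezN.
  have ty : t ** y0 = 0 by rewrite -et dotAC ey0 DE.
  have /free3P ind := ft.
  have [p [q [r yyE]]] := free3_span dimA (y0 ** y0) ft.
  have [|p0 q0 _] := ind p q 0.
    have /(congr1 (dot e)) := yyE; rewrite dotA ey0 !DE ee et ey0 scaler0 scale0r.
    by move=> <-.
  rewrite p0 q0 !scale0r !add0r in yyE.
  have yy0 : y0 ** y0 = 0.
    have [r0|nzr] := eqVneq r 0; first by rewrite yyE r0 scale0r.
    case: (unit_frame (e + r^-1 *: y0) _ _ _ ft); rewrite !DE.
    - by rewrite ee [y0 ** e]dotC ey0 scaler0 addr0.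
    - by rewrite et [y0 ** t]dotC ty scaler0 addr0.
    - by rewrite ey0 add0r yyE scalerA mulVf // scale1r.
  have [b [c [k ttE]]] := free3_span dimA (t ** t) ft.
  have [|_ _ k0] := ind 0 0 k.
    have /(congr1 (dot e)) := ttE; rewrite dotA et !DE ee et ey0 scaler0 addr0.
    move=> ttE'; transitivity (b *: e + c *: t + k *: y0 - (b *: e + c *: t)).
      by modring.
    by rewrite -ttE -ttE' subrr.
  apply: (@quad_class b c 0); first by right.
  apply: (realizes_products (x := e) (y := t) (z := y0)
    (p11 := (1, 0, 0)) (p12 := (0, 1, 0)) (p13 := (0, 0, 0))
    (p22 := (b, c, 0)) (p23 := (0, 0, 0)) (p33 := (0, 0, 0))) => //.
  - by rewrite linE ee; modring.
  - by rewrite linE et; modring.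
  - by rewrite linE ey0; modring.
  - by rewrite linE ttE k0; modring.
  - by rewrite linE ty; modring.
  - by rewrite linE yy0; modring.
  by rewrite /quad_vtable; tab_tac; ring.
have [y1 y1E] : exists y1, y1 = z - e ** z by exists (z - e ** z).
have ey1 : e ** y1 = 0 by rewrite y1E !DE dotA ee subrr.
have y1N : y1 \notin <<[:: e; y0]>>%VS.
  by apply: contra zN => y1S; rewrite -[z](subrK (e ** z)) -y1E rpredD.
have fy : free [:: e; y0; y1] by rewrite free3_rot y1N.
have inI x : e ** x = 0 -> exists p q, x = p *: y0 + q *: y1.
  have [k [p [q ->]]] := free3_span dimA x fy.
  rewrite !DE ee ey0 ey1 !scaler0 !addr0 => /scale_eq0/(_ nze) ->.
  by exists p, q; rewrite scale0r add0r.
have pI x y : e ** x = 0 -> exists p q, x ** y = p *: y0 + q *: y1.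
  by move=> ex; apply: inI; rewrite dotA ex DE.
have [Inil|] := pselect (forall p q, nil4 (p *: y0 + q *: y1)).
  case: (nil_plane fy (pI _ _ ey0) (pI _ _ ey0)
    (pI _ _ ey1) Inil) => [[aa ab bb]|[w [[p [q wE]] _ fw w3]]].
    exists LineNull; apply: (realizes_products (x := e)
      (y := y0) (z := y1) (p11 := (1, 0, 0)) (p12 := (0, 0, 0))
      (p13 := (0, 0, 0)) (p22 := (0, 0, 0)) (p23 := (0, 0, 0))
      (p33 := (0, 0, 0))) => //.
    - by rewrite linE ee; modring.
    - by rewrite linE ey0; modring.
    - by rewrite linE ey1; modring.
    - by rewrite linE aa; modring.
    - by rewrite linE ab; modring.
    - by rewrite linE bb; modring.
    by tab_tac; ring.
  have ew : e ** w = 0 by rewrite wE !DE ey0 ey1 !scaler0 addr0.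
  exists LineSq; apply: (realizes_products (x := e)
    (y := w) (z := w ** w) (p11 := (1, 0, 0)) (p12 := (0, 0, 0))
    (p13 := (0, 0, 0)) (p22 := (0, 0, 1)) (p23 := (0, 0, 0))
    (p33 := (0, 0, 0))) => //.
  - by rewrite linE ee; modring.
  - by rewrite linE ew; modring.
  - by rewrite linE dotA ew DE; modring.
  - by rewrite linE; modring.
  - by rewrite linE w3; modring.
  - by rewrite linE -dotA w3 DE; modring.
  by tab_tac; ring.
move=> /existsNP[p /existsNP[q nN]].
have [e' [nze' ee' e'0]] : exists e', [/\ e' <> 0, e' ** e' = e' & e ** e' = 0].
  have [[e' [nze' ee' e'P]]|//] :=
    idempotent_or_nil (p *: y0 + q *: y1).
  by exists e'; split=> //; apply: e'P; rewrite !DE ey0 ey1 !scaler0 addr0.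
have fee := free_idempotents nze nze' ee e'0.
have [x xN] := @extend_free _ _ dimA [:: e; e'] isT.
have [a exE] : exists a, e ** x = a *: e.
  have [a [b [c ->]]] := free3_span dimA x fy.
  by exists a; rewrite !DE ee ey0 ey1 !scaler0 !addr0.
have [e'xS|e'xN] := boolP (e' ** x \in <<[:: e; e']>>%VS); last first.
  have f3 : free [:: e; e'; e' ** x] by rewrite free3_rot e'xN.
  case: (unit_frame (e + e') _ _ _ f3); rewrite !DE.
  - by rewrite ee dotC e'0 addr0.
  - by rewrite e'0 ee' add0r.
  - by rewrite !dotA e'0 ee' DE add0r.
(* The component of [x] killed by both idempotents. *)
have [w wE] : exists w, w = x - e ** x - e' ** x by exists (x - e ** x - e' ** x).
have ew : e ** w = 0 by rewrite wE !DE !dotA ee e'0 DE subr0 subrr.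
have e'w : e' ** w = 0.
  by rewrite wE !DE !dotA ee' [e' ** e]dotC e'0 DE subr0 subrr.
have f3 : free [:: e; e'; w].
  rewrite free3_rot fee andbT; apply: contra xN => wS.
  have -> : x = w + e ** x + e' ** x by rewrite wE; modring.
  by rewrite !rpredD // exE memvZ // memv_span ?mem_head.
have [b [c [d wwE]]] := free3_span dimA (w ** w) f3.
have b0 : b = 0.
  apply: scale_eq0 nze; have /(congr1 (dot e)) := wwE.
  by rewrite dotA !DE ee e'0 ew !DE !scaler0 !addr0.
have c0 : c = 0.
  apply: scale_eq0 nze'; have /(congr1 (dot e')) := wwE.
  by rewrite dotA !DE ee' [e' ** e]dotC e'0 e'w !DE !scaler0 !addr0 add0r.
rewrite b0 c0 !scale0r !add0r in wwE.
have [d0|nzd] := eqVneq d 0; last first.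
  case: (unit_frame (e + e' + d^-1 *: w) _ _ _ f3); rewrite !DE.
  - by rewrite ee [e' ** e]dotC e'0 [w ** e]dotC ew scaler0 !addr0.
  - by rewrite ee' e'0 [w ** e']dotC e'w scaler0 addr0 add0r.
  - by rewrite ew e'w wwE scalerA mulVf // scale1r !add0r.
exists SplitNull; apply: (realizes_products (x := e) (y := e')
  (z := w) (p11 := (1, 0, 0)) (p12 := (0, 0, 0)) (p13 := (0, 0, 0))
  (p22 := (0, 1, 0)) (p23 := (0, 0, 0)) (p33 := (0, 0, 0))) => //.
- by rewrite linE ee; modring.
- by rewrite linE e'0; modring.
- by rewrite linE ew; modring.
- by rewrite linE ee'; modring.
- by rewrite linE e'w; modring.
- by rewrite linE wwE d0; modring.
by tab_tac; ring.
Qed.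

End DotClass.

(** * Compatible Novikov products *)

Section Structure.
Variables (K : fieldType) (A : vectType K) (w : 'I_3 -> A).
Implicit Types (m dot circ : A -> A -> A) (c d : 'I_3 -> 'I_3 -> vec K).

Definition has_struct m c : Prop := forall i j, m (w i) (w j) = lin w (c i j).

(** In order: the two mixed identities, right commutativity, left symmetry. Terms are moved across
    so that no subtraction occurs. *)
Definition np_struct d c : Prop :=
  [/\ forall i j k, vcomb (c^~ k) (d i j) = vcomb (d i) (c j k),
      forall i j k, vadd (vcomb (d^~ k) (c i j)) (vcomb (c j) (d i k)) =
                    vadd (vcomb (d^~ k) (c j i)) (vcomb (c i) (d j k)),
      forall i j k, vcomb (c^~ k) (c i j) = vcomb (c^~ j) (c i k)
    & forall i j k, vadd (vcomb (c^~ k) (c i j)) (vcomb (c j) (c i k)) =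
                    vadd (vcomb (c^~ k) (c j i)) (vcomb (c i) (c j k))].

Lemma struct_mull m c x k : bilinear_product m -> has_struct m c ->
  m (lin w x) (w k) = lin w (vcomb (c^~ k) x).
Proof.
move=> mb mc; rewrite -lin_vcomb /lin !(bilDl mb) !(bilZl mb) !mc.
by [].
Qed.

Lemma struct_mulr m c x k : bilinear_product m -> has_struct m c ->
  m (w k) (lin w x) = lin w (vcomb (c k) x).
Proof.
move=> mb mc; rewrite -lin_vcomb /lin !(bilDr mb) !(bilZr mb) !mc.
by [].
Qed.

Lemma has_struct_np dot circ d c : novikov_poisson dot circ -> frame w ->
  has_struct dot d -> has_struct circ c -> np_struct d c.
Proof.
move=> [[dB dC dA] [cB N1 N2] P1 P2] fw wd wc.
have linI := bij_inj fw.
have addI (x y x' y' : vec K) :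
    lin w x + lin w y = lin w x' + lin w y' -> vadd x y = vadd x' y'.
  by rewrite -!lin_vadd => /linI.
split=> i j k.
- apply: linI; rewrite -(struct_mull (d i j) k cB wc) -(struct_mulr (c j k) i dB wd) -wd -wc.
  exact: P1.
- apply: addI; rewrite -(struct_mull (c i j) k dB wd) -(struct_mull (c j i) k dB wd).
  rewrite -(struct_mulr (d i k) j cB wc) -(struct_mulr (d j k) i cB wc) -!wd -!wc.
  by apply: (eq_of_sub (P2 (w i) (w j) (w k))); modring.
- apply: linI; rewrite -(struct_mull (c i j) k cB wc) -(struct_mull (c i k) j cB wc) -!wc.
  exact: N2.
- apply: addI; rewrite -(struct_mull (c i j) k cB wc) -(struct_mull (c j i) k cB wc).
  rewrite -(struct_mulr (c i k) j cB wc) -(struct_mulr (c j k) i cB wc) -!wc.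
  by apply: (eq_of_sub (N1 (w i) (w j) (w k))); modring.
Qed.

Definition tab9 (v11 v12 v13 v21 v22 v23 v31 v32 v33 : vec K) i : 'I_3 -> vec K :=
  frame3 (frame3 v11 v12 v13) (frame3 v21 v22 v23) (frame3 v31 v32 v33) i.

Lemma struct_ex m : bijective (lin w) -> exists v11 v12 v13 v21 v22 v23 v31 v32 v33,
   has_struct m (tab9 v11 v12 v13 v21 v22 v23 v31 v32 v33).
Proof.
move=> [g _ gK].
exists (g (m (w i1) (w i1))), (g (m (w i1) (w i2))), (g (m (w i1) (w i3))),
 (g (m (w i2) (w i1))), (g (m (w i2) (w i2))), (g (m (w i2) (w i3))),
 (g (m (w i3) (w i1))), (g (m (w i3) (w i2))), (g (m (w i3) (w i3))).
by do 2 apply: ord3P; rewrite /tab9 /frame3 /= gK.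
Qed.

End Structure.

(** Literal structure constants, which leave no sums with zeros in the instances of the identities,
    unlike [vmul] on [dot_vtable]. *)
Definition dot_struct (K : fieldType) (k : dot_type) : 'I_3 -> 'I_3 -> vec K :=
  let o := (0, 0, 0) in let x := (1, 0, 0) in
  let y := (0, 1, 0) in let z := (0, 0, 1) in
  match k with
  | Hyp => tab9 o o y o o o y o o
  | Pow => tab9 y z o z o o o o o
  | Loc => tab9 o o x o o y x y z
  | DualNull => tab9 o o y o o y y y z
  | Trunc => tab9 y o x o o y x y z
  | Split => tab9 x o o o y o o o z
  | SplitDual => tab9 x o z o y o z o o
  | SplitNull => tab9 x o o o y o o o o
  | LineSq => tab9 x o o o z o o o o
  | LineNull => tab9 x o o o o o o o o
  | Sq => tab9 y o o o o o o o o
  end.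

Lemma dot_structE (K : numFieldType) k i j :
  vmul (dot_vtable k) (unit3 i) (unit3 j) = dot_struct K k i j.
Proof.
by move: i j; case: k; do 2 apply: ord3P; rewrite /dot_struct /tab9 /dot_vtable;
  vsimpl; apply: vec_eq; ring.
Qed.

Ltac vclean H := rewrite ?(mul0r, mulr0, mul1r, mulr1, add0r, addr0) in H.
Ltac triv e := try (match type of e with ?x = ?x => clear e end).
Ltac instance H i j k :=
  let E := fresh "E" in have E := H i j k; unfold dot_struct, tab9 in E; vsimpl_in E; vclean E;
  let e1 := fresh "e" in let e2 := fresh "e" in let e3 := fresh "e" in
  have [e1 e2 e3] := @vecP _ _ _ _ _ _ _ E; clear E; triv e1; triv e2; triv e3; subst.
Ltac solve_form P1 P2 :=
  clear P1 P2; do 2 apply: ord3P; unfold tab9; unfold_tables; vsimpl;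
  apply: vec_eq; first [ring | solve [nsatz]].

(** * Solving the mixed identities for each product *)

Section Forms.
Variable K : numFieldType.

Lemma Hyp_form v11 v12 v13 v21 v22 v23 v31 v32 v33 :
    np_struct (dot_struct K Hyp) (tab9 v11 v12 v13 v21 v22 v23 v31 v32 v33) ->
  exists a b p q r s, forall i j,
    tab9 v11 v12 v13 v21 v22 v23 v31 v32 v33 i j =
      vmul (Hyp_circ a b p q r s) (unit3 i) (unit3 j).
Proof.
case: v11 v12 v13 v21 v22 v23 v31 v32 v33 =>
  [[c111 c112] c113] [[c121 c122] c123] [[c131 c132] c133]
  [[c211 c212] c213] [[c221 c222] c223] [[c231 c232] c233]
  [[c311 c312] c313] [[c321 c322] c323] [[c331 c332] c333]
  [P1 P2 _ _].
exists c111, c131, c112, c132, c312, c332.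
(* These triples of basis vectors suffice to determine all entries from the ones chosen as
   parameters. An equation that gives a variable is substituted by [instance], the others are left
   to [nsatz]; the remaining products follow the same scheme. *)
instance P1 i1 i1 i1; instance P1 i1 i1 i2; instance P1 i1 i1 i3.
instance P1 i1 i2 i1; instance P1 i1 i2 i2; instance P1 i1 i2 i3.
instance P1 i1 i3 i1; instance P1 i1 i3 i2; instance P1 i1 i3 i3.
instance P1 i3 i1 i1; instance P1 i3 i1 i2; instance P1 i3 i1 i3.
instance P1 i3 i3 i1; instance P1 i3 i3 i2; instance P1 i3 i3 i3.
instance P2 i1 i2 i3; instance P2 i1 i3 i1; instance P2 i1 i3 i3.
solve_form P1 P2.
Qed.

Lemma Pow_form v11 v12 v13 v21 v22 v23 v31 v32 v33 :
    np_struct (dot_struct K Pow) (tab9 v11 v12 v13 v21 v22 v23 v31 v32 v33) ->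
  exists a b p q r, forall i j,
    tab9 v11 v12 v13 v21 v22 v23 v31 v32 v33 i j =
      vmul (Pow_circ a b p q r) (unit3 i) (unit3 j).
Proof.
case: v11 v12 v13 v21 v22 v23 v31 v32 v33 =>
  [[c111 c112] c113] [[c121 c122] c123] [[c131 c132] c133]
  [[c211 c212] c213] [[c221 c222] c223] [[c231 c232] c233]
  [[c311 c312] c313] [[c321 c322] c323] [[c331 c332] c333]
  [P1 P2 _ _].
exists c111, c122, c112, c113, c123.
instance P1 i1 i1 i1; instance P1 i1 i1 i2; instance P1 i1 i1 i3.
instance P1 i1 i2 i1; instance P1 i1 i2 i2; instance P1 i1 i2 i3.
instance P2 i1 i2 i1; instance P2 i1 i2 i2.
solve_form P1 P2.
Qed.

Lemma Loc_form v11 v12 v13 v21 v22 v23 v31 v32 v33 :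
    np_struct (dot_struct K Loc) (tab9 v11 v12 v13 v21 v22 v23 v31 v32 v33) ->
  exists a p q r s t u, forall i j,
    tab9 v11 v12 v13 v21 v22 v23 v31 v32 v33 i j =
      vmul (Loc_circ a p q r s t u) (unit3 i) (unit3 j).
Proof.
case: v11 v12 v13 v21 v22 v23 v31 v32 v33 =>
  [[c111 c112] c113] [[c121 c122] c123] [[c131 c132] c133]
  [[c211 c212] c213] [[c221 c222] c223] [[c231 c232] c233]
  [[c311 c312] c313] [[c321 c322] c323] [[c331 c332] c333]
  [P1 P2 _ _].
exists c131, c311, c312, c321, c322, c331, c332.
instance P1 i1 i1 i1; instance P1 i1 i1 i2; instance P1 i1 i1 i3.
instance P1 i1 i2 i1; instance P1 i1 i2 i2; instance P1 i1 i2 i3.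
instance P1 i1 i3 i1; instance P1 i1 i3 i2; instance P1 i1 i3 i3.
instance P1 i2 i3 i1; instance P1 i2 i3 i2; instance P1 i2 i3 i3.
instance P2 i1 i3 i1; instance P2 i1 i3 i2.
solve_form P1 P2.
Qed.

Lemma DualNull_form v11 v12 v13 v21 v22 v23 v31 v32 v33 :
    np_struct (dot_struct K DualNull) (tab9 v11 v12 v13 v21 v22 v23 v31 v32 v33) ->
  exists a b p q, forall i j,
    tab9 v11 v12 v13 v21 v22 v23 v31 v32 v33 i j =
      vmul (DualNull_circ a b p q) (unit3 i) (unit3 j).
Proof.
case: v11 v12 v13 v21 v22 v23 v31 v32 v33 =>
  [[c111 c112] c113] [[c121 c122] c123] [[c131 c132] c133]
  [[c211 c212] c213] [[c221 c222] c223] [[c231 c232] c233]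
  [[c311 c312] c313] [[c321 c322] c323] [[c331 c332] c333]
  [P1 P2 _ _].
exists c132, c312, c112, c332.
instance P1 i1 i1 i1; instance P1 i1 i1 i2; instance P1 i1 i1 i3.
instance P1 i1 i2 i1; instance P1 i1 i2 i2; instance P1 i1 i2 i3.
instance P1 i1 i3 i1; instance P1 i1 i3 i2; instance P1 i1 i3 i3.
instance P1 i3 i1 i1; instance P1 i3 i1 i2; instance P1 i3 i1 i3.
instance P1 i3 i3 i1; instance P1 i3 i3 i2; instance P1 i3 i3 i3.
instance P2 i1 i2 i3; instance P2 i1 i3 i1; instance P2 i1 i3 i3.
solve_form P1 P2.
Qed.

Lemma Trunc_form v11 v12 v13 v21 v22 v23 v31 v32 v33 :
    np_struct (dot_struct K Trunc) (tab9 v11 v12 v13 v21 v22 v23 v31 v32 v33) ->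
  exists a b p q r, forall i j,
    tab9 v11 v12 v13 v21 v22 v23 v31 v32 v33 i j =
      vmul (Trunc_circ a b p q r) (unit3 i) (unit3 j).
Proof.
case: v11 v12 v13 v21 v22 v23 v31 v32 v33 =>
  [[c111 c112] c113] [[c121 c122] c123] [[c131 c132] c133]
  [[c211 c212] c213] [[c221 c222] c223] [[c231 c232] c233]
  [[c311 c312] c313] [[c321 c322] c323] [[c331 c332] c333]
  [P1 P2 _ _].
exists c322, c131, c132, c332, c312.
instance P1 i1 i1 i1; instance P1 i1 i1 i2; instance P1 i1 i1 i3.
instance P1 i1 i2 i1; instance P1 i1 i2 i2; instance P1 i1 i2 i3.
instance P1 i1 i3 i1; instance P1 i1 i3 i2; instance P1 i1 i3 i3.
instance P2 i1 i2 i1; instance P2 i1 i3 i1; instance P2 i1 i3 i2.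
(* For [nsatz] the inverse of 2 is an indeterminate; this is its defining relation. *)
have half : 2 * 2^-1 = 1 :> K by rewrite divff // pnatr_eq0.
solve_form P1 P2.
Qed.

Lemma Split_form v11 v12 v13 v21 v22 v23 v31 v32 v33 :
    np_struct (dot_struct K Split) (tab9 v11 v12 v13 v21 v22 v23 v31 v32 v33) ->
  exists a b c, forall i j,
    tab9 v11 v12 v13 v21 v22 v23 v31 v32 v33 i j =
      vmul (Split_circ a b c) (unit3 i) (unit3 j).
Proof.
case: v11 v12 v13 v21 v22 v23 v31 v32 v33 =>
  [[c111 c112] c113] [[c121 c122] c123] [[c131 c132] c133]
  [[c211 c212] c213] [[c221 c222] c223] [[c231 c232] c233]
  [[c311 c312] c313] [[c321 c322] c323] [[c331 c332] c333]
  [P1 P2 _ _].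
exists c111, c222, c333.
instance P1 i1 i1 i1; instance P1 i1 i1 i2; instance P1 i1 i1 i3.
instance P1 i1 i2 i1; instance P1 i1 i2 i2; instance P1 i1 i2 i3.
instance P1 i1 i3 i1; instance P1 i1 i3 i2; instance P1 i1 i3 i3.
instance P1 i2 i2 i1; instance P1 i2 i2 i2; instance P1 i2 i2 i3.
instance P1 i2 i3 i1; instance P1 i2 i3 i2; instance P1 i2 i3 i3.
instance P2 i1 i2 i1; instance P2 i1 i3 i1; instance P2 i2 i3 i2.
solve_form P1 P2.
Qed.

Lemma SplitDual_form v11 v12 v13 v21 v22 v23 v31 v32 v33 :
    np_struct (dot_struct K SplitDual) (tab9 v11 v12 v13 v21 v22 v23 v31 v32 v33) ->
  exists a b c p, forall i j,
    tab9 v11 v12 v13 v21 v22 v23 v31 v32 v33 i j =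
      vmul (SplitDual_circ a b c p) (unit3 i) (unit3 j).
Proof.
case: v11 v12 v13 v21 v22 v23 v31 v32 v33 =>
  [[c111 c112] c113] [[c121 c122] c123] [[c131 c132] c133]
  [[c211 c212] c213] [[c221 c222] c223] [[c231 c232] c233]
  [[c311 c312] c313] [[c321 c322] c323] [[c331 c332] c333]
  [P1 P2 _ _].
exists c111, c133, c222, c113.
instance P1 i1 i1 i1; instance P1 i1 i1 i2; instance P1 i1 i1 i3.
instance P1 i1 i2 i1; instance P1 i1 i2 i2; instance P1 i1 i2 i3.
instance P1 i1 i3 i1; instance P1 i1 i3 i2; instance P1 i1 i3 i3.
instance P1 i3 i1 i1; instance P1 i3 i1 i2; instance P1 i3 i1 i3.
instance P2 i1 i2 i1; instance P2 i1 i2 i3; instance P2 i1 i3 i3.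
solve_form P1 P2.
Qed.

Lemma SplitNull_form v11 v12 v13 v21 v22 v23 v31 v32 v33 :
    np_struct (dot_struct K SplitNull) (tab9 v11 v12 v13 v21 v22 v23 v31 v32 v33) ->
  exists a b c, forall i j,
    tab9 v11 v12 v13 v21 v22 v23 v31 v32 v33 i j =
      vmul (SplitNull_circ a b c) (unit3 i) (unit3 j).
Proof.
case: v11 v12 v13 v21 v22 v23 v31 v32 v33 =>
  [[c111 c112] c113] [[c121 c122] c123] [[c131 c132] c133]
  [[c211 c212] c213] [[c221 c222] c223] [[c231 c232] c233]
  [[c311 c312] c313] [[c321 c322] c323] [[c331 c332] c333]
  [P1 P2 _ _].
exists c111, c222, c333.
instance P1 i1 i1 i1; instance P1 i1 i1 i2; instance P1 i1 i1 i3.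
instance P1 i1 i2 i1; instance P1 i1 i2 i2; instance P1 i1 i2 i3.
instance P1 i1 i3 i1; instance P1 i1 i3 i2; instance P1 i1 i3 i3.
instance P1 i2 i2 i1; instance P1 i2 i2 i2; instance P1 i2 i2 i3.
instance P1 i2 i3 i1; instance P1 i2 i3 i2; instance P1 i2 i3 i3.
instance P2 i1 i2 i1; instance P2 i1 i3 i1; instance P2 i2 i3 i2.
solve_form P1 P2.
Qed.

Lemma LineSq_form v11 v12 v13 v21 v22 v23 v31 v32 v33 :
    np_struct (dot_struct K LineSq) (tab9 v11 v12 v13 v21 v22 v23 v31 v32 v33) ->
  exists a b p q, forall i j,
    tab9 v11 v12 v13 v21 v22 v23 v31 v32 v33 i j =
      vmul (LineSq_circ a b p q) (unit3 i) (unit3 j).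
Proof.
case: v11 v12 v13 v21 v22 v23 v31 v32 v33 =>
  [[c111 c112] c113] [[c121 c122] c123] [[c131 c132] c133]
  [[c211 c212] c213] [[c221 c222] c223] [[c231 c232] c233]
  [[c311 c312] c313] [[c321 c322] c323] [[c331 c332] c333]
  [P1 P2 _ _].
exists c111, c222, c223, c233.
instance P1 i1 i1 i1; instance P1 i1 i1 i2; instance P1 i1 i1 i3.
instance P1 i1 i2 i1; instance P1 i1 i2 i2; instance P1 i1 i2 i3.
instance P1 i1 i3 i1; instance P1 i1 i3 i2; instance P1 i1 i3 i3.
instance P1 i2 i2 i1; instance P1 i2 i2 i2; instance P1 i2 i2 i3.
instance P2 i1 i2 i1; instance P2 i1 i2 i2; instance P2 i2 i3 i2.
solve_form P1 P2.
Qed.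

Lemma LineNull_form v11 v12 v13 v21 v22 v23 v31 v32 v33 :
    np_struct (dot_struct K LineNull) (tab9 v11 v12 v13 v21 v22 v23 v31 v32 v33) ->
  exists a p q r s t u v w, forall i j,
    tab9 v11 v12 v13 v21 v22 v23 v31 v32 v33 i j =
      vmul (LineNull_circ a p q r s t u v w) (unit3 i) (unit3 j).
Proof.
case: v11 v12 v13 v21 v22 v23 v31 v32 v33 =>
  [[c111 c112] c113] [[c121 c122] c123] [[c131 c132] c133]
  [[c211 c212] c213] [[c221 c222] c223] [[c231 c232] c233]
  [[c311 c312] c313] [[c321 c322] c323] [[c331 c332] c333]
  [P1 P2 _ _].
exists c111, c222, c223, c232, c233, c322, c323, c332, c333.
instance P1 i1 i1 i1; instance P1 i1 i1 i2; instance P1 i1 i1 i3.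
instance P1 i1 i2 i1; instance P1 i1 i2 i2; instance P1 i1 i2 i3.
instance P1 i1 i3 i1; instance P1 i1 i3 i2; instance P1 i1 i3 i3.
instance P2 i1 i2 i1; instance P2 i1 i3 i1.
solve_form P1 P2.
Qed.

Lemma Sq_form v11 v12 v13 v21 v22 v23 v31 v32 v33 :
    np_struct (dot_struct K Sq) (tab9 v11 v12 v13 v21 v22 v23 v31 v32 v33) ->
  exists a b p q r s t u v w x y, forall i j,
    tab9 v11 v12 v13 v21 v22 v23 v31 v32 v33 i j =
      vmul (Sq_circ a b p q r s t u v w x y) (unit3 i) (unit3 j).
Proof.
case: v11 v12 v13 v21 v22 v23 v31 v32 v33 =>
  [[c111 c112] c113] [[c121 c122] c123] [[c131 c132] c133]
  [[c211 c212] c213] [[c221 c222] c223] [[c231 c232] c233]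
  [[c311 c312] c313] [[c321 c322] c323] [[c331 c332] c333]
  [P1 P2 _ _].
exists c111, c131, c112, c113, c122, c123, c132, c133, c312, c313, c332, c333.
instance P1 i1 i1 i1; instance P1 i1 i1 i2; instance P1 i1 i1 i3.
instance P1 i1 i3 i1; instance P1 i1 i3 i2; instance P1 i1 i3 i3.
instance P2 i1 i2 i1; instance P2 i1 i3 i1.
solve_form P1 P2.
Qed.

End Forms.

(** * Changing the frame of a classified pair of products *)

Section Classification.
Variables (K : numClosedFieldType) (A : vectType K) (dot circ : A -> A -> A).
Hypothesis np : novikov_poisson dot circ.

Definition realized (k : dot_type) (t : vtable K) : Prop :=
  exists w, [/\ frame w, has_table w dot (dot_vtable k) & has_table w circ t].

Definition classified : Prop := exists p : np_family K,
  np_admissible p /\ realized (np_dot_type p) (np_circ_vtable p).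

Lemma realized_change k t t' P : realized k t -> det3 P != 0 ->
  respects P (dot_vtable k) (dot_vtable k) -> respects P t t' -> realized k t'.
Proof.
case: np => [[dB _ _] [cB _ _] _ _] [w [fw wd wc]] nzP Pd Pc.
exists (fun i => lin w (P i)); split; first exact: frame_change.
  exact: has_table_change wd Pd.
exact: has_table_change wc Pc.
Qed.

Lemma classify k t p P : realized k t -> np_dot_type p = k -> np_admissible p ->
  det3 P != 0 -> respects P (dot_vtable k) (dot_vtable k) ->
  respects P t (np_circ_vtable p) -> classified.
Proof.
move=> R dk adm nzP Pd Pc; subst k; exists p; split=> //.
exact: realized_change R nzP Pd Pc.
Qed.

(** Brings the Novikov identities back as equations between the parameters of a general form. *)
Lemma realized_struct k t c : realized k t ->
    (forall i j, vmul t (unit3 i) (unit3 j) = c i j) ->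
  np_struct (dot_struct K k) c.
Proof.
move=> [w [fw wd wc]] tc; apply: (has_struct_np np fw) => i j.
  by rewrite -dot_structE -wd !lin_unit3.
by rewrite -tc -wc !lin_unit3.
Qed.

End Classification.

(** * Normal forms *)

Ltac nz_auto := repeat (first [assumption | exact: oner_neq0 | rewrite invr_eq0 |
  rewrite oppr_eq0 | apply: mulf_neq0]).
Ltac det_auto := det_tac; nz_auto.

Section NormalForms.
Variables (K : numClosedFieldType) (A : vectType K) (dot circ : A -> A -> A).
Hypothesis np : novikov_poisson dot circ.
Notation realized := (realized dot circ).
Notation classified := (classified dot circ).
Notation mx3 := (@frame3 (vec K)).

Ltac into p P :=
  apply: (classify np (p := p) (P := P));
  [eassumption | by [] | | | by respects_by | by respects_by].

(** The frames scale [e2] by [q] and [e1 - e2] by the inverse of [p], with 1 in place of a zero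
    parameter. *)
Lemma DualNull_classified a b p q :
  realized DualNull (DualNull_circ a b p q) -> classified.
Proof.
move=> R; have [p0|nzp] := eqVneq p 0; have [q0|nzq] := eqVneq q 0;
  rewrite ?p0 ?q0 in R.
- by exists (NP19 a b).
- by into (NP17 a b) (mx3 (1, q - 1, 0) (0, q, 0) (0, 0, 1)) => //; det_auto.
- by into (NP18 a b) (mx3 (p^-1, 1 - p^-1, 0) (0, 1, 0) (0, 0, 1)) => //; det_auto.
- by into (NP16 a b) (mx3 (p^-1, q - p^-1, 0) (0, q, 0) (0, 0, 1)) => //; det_auto.
Qed.

Lemma Split_classified a b c : realized Split (Split_circ a b c) -> classified.
Proof. by exists (NP25 a b c). Qed.

Lemma SplitDual_classified a b c p :
  realized SplitDual (SplitDual_circ a b c p) -> classified.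
Proof.
move=> R; have [p0|nzp] := eqVneq p 0; first by exists (NP27 a b c); rewrite p0 in R.
by into (NP26 a b c) (mx3 (1, 0, 0) (0, 1, 0) (0, 0, p)) => //; det_auto.
Qed.

Lemma SplitNull_classified a b c :
  realized SplitNull (SplitNull_circ a b c) -> classified.
Proof.
move=> R; have [c0|nzc] := eqVneq c 0; first by exists (NP29 a b); rewrite c0 in R.
by into (NP28 a b) (mx3 (1, 0, 0) (0, 1, 0) (0, 0, c^-1)) => //; det_auto.
Qed.

Lemma LineSq_classified a b p q :
  realized LineSq (LineSq_circ a b p q) -> classified.
Proof.
move=> R; have [q0|nzq] := eqVneq q 0; last first.
  by into (NP30 a (b / q)) (mx3 (1, 0, 0) (0, q^-1, - (p / (q * q))) (0, 0, (q * q)^-1)) => //;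
    det_auto.
have [b0|nzb] := eqVneq b 0.
  by exists (NP32 a p); rewrite q0 b0 in R.
rewrite q0 in R.
by into (NP31 a p) (mx3 (1, 0, 0) (0, b^-1, 0) (0, 0, (b * b)^-1)) => //;
    det_auto.
Qed.

(** The vector [e1 / a + p e2 / a^2] is idempotent for [circ], which removes [p]; adding a multiple
    of [e2] to [e3] removes [q]. *)
Lemma Hyp_classified_neq0 a b p q r s : a != 0 ->
  realized Hyp (Hyp_circ a b p q r s) -> classified.
Proof.
move=> nza R; have [b0|nzb] := eqVneq b 0; last first.
  into (NP01 (r - b * p / a) (a * s / b - q)) (mx3 (a^-1, p / (a * a), 0)
    (0, (a * b)^-1, 0) (0, q / (a * b), b^-1)) => //.
  by det_auto.
rewrite b0 in R; have [s0|nzs] := eqVneq s 0.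
  rewrite s0 in R.
  into (NP03 r) (mx3 (a^-1, p / (a * a), 0) (0, a^-1, 0) (0, q / a, 1)) => //.
  by det_auto.
into (NP02 r) (mx3 (a^-1, p / (a * a), 0) (0, (a * a * s)^-1, 0)
  (0, q / (a * a * s), (a * s)^-1)) => //.
by det_auto.
Qed.

Lemma Hyp_classified a b p q r s :
  realized Hyp (Hyp_circ a b p q r s) -> classified.
Proof.
move=> R; have [a0|nza] := eqVneq a 0; last exact: Hyp_classified_neq0 R.
have [b0|nzb] := eqVneq b 0; last first.
  (* Exchanging [e1] and [e3] exchanges [a] and [b]. *)
  apply: (@Hyp_classified_neq0 b a s r q p) => //.
  apply: (realized_change np R (P := mx3 (0, 0, 1) (0, 1, 0) (1, 0, 0))).
  - by det_auto.
  - by respects_by.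
  - by respects_by.
rewrite a0 b0 in R; have [p0|nzp] := eqVneq p 0; last first.
  by into (NP04 q r (s * p)) (mx3 (1, 0, 0) (0, p, 0) (0, 0, p)) => //;
    det_auto.
rewrite p0 in R; have [s0|nzs] := eqVneq s 0.
  by exists (NP05 q r); rewrite s0 in R.
by into (NP04 r q 0) (mx3 (0, 0, 1) (0, s, 0) (s, 0, 0)) => //;
  det_auto.
Qed.

Local Notation PF l m n := (mx3 (l, m, n) (0, l * l, 2 * l * m) (0, 0, l * l * l)).

(** For [b != 0], [l] makes [b = 1], [m] removes [p], and [n] removes [q]; the coefficient of [n] is
    proportional to [2 b - a], and its vanishing is the case of [NP07]. For [b = 0], [m] acts on [r]
    with a coefficient proportional to [a], or on [q] with coefficient [r - p] once [a = 0]. *)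
Lemma Pow_classified a b p q r : realized Pow (Pow_circ a b p q r) -> classified.
Proof.
have detP (l m n : K) : l != 0 -> det3 (PF l m n) != 0.
  by move=> nzl; det_auto.
move=> R; have [b0|nzb] := eqVneq b 0; last first.
  have [a2|na2] := eqVneq a (2 * b).
    rewrite a2 in R; into (NP07 (b * q - p * r) (r + p)) (PF b^-1 (- (p / (b * b))) 0) => //.
    by rewrite detP ?invr_eq0.
  have nz2 : 2 * b - a != 0 by rewrite subr_eq0 eq_sym.
  into (NP06 (a / b) (r - p * (3 - 2 * a / b)))
    (PF b^-1 (- (p / (b * b))) (- ((b * q - p * r) / (b * b * (2 * b - a))))).
    by apply: contra na2 => /eqP e; apply/eqP; rewrite -e divfK.
  by rewrite detP ?invr_eq0.
rewrite b0 in R; have [a0|nza] := eqVneq a 0; last first.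
  into (NP08 p) (PF a^-1 (r / (2 * (a * a)))
     (q / (a * a) + r * (r - p) / (2 * (a * a * a)))) => //.
  by rewrite detP ?invr_eq0.
rewrite a0 in R; have [rp|nrp] := eqVneq r p; last first.
  have nz : r - p != 0 by rewrite subr_eq0.
  by into (NP09 p r) (PF 1 (- q / (r - p)) 0) => //; rewrite detP ?oner_eq0.
rewrite rp in R; have [q0|nzq] := eqVneq q 0.
  by rewrite q0 in R; exists (NP09 p p).
by into (NP10 p) (PF q 0 0) => //; rewrite detP.
Qed.

(** Let [V = (t, u)], and let [M = (p, q; r, s)] be the left multiplication by [e3]. If [V] and
    [V M] are independent, they put [M] in companion form, given by the trace and minus the
    determinant. Otherwise [V] is an eigenvector and [M] becomes triangular in a frame starting with
    [V]. *)
Lemma Loc_classified_neq0 a p q r s t u : t != 0 ->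
  realized Loc (Loc_circ a p q r s t u) -> classified.
Proof.
move=> nzt R; pose x := t * p + u * r; pose y := t * q + u * s.
have [d0|nzd] := eqVneq (t * y - u * x) 0; last first.
  rewrite /x /y in nzd.
  into (NP11 a (q * r - p * s) (p + s)) (mx3 (t, u, 0)
    (t * p + u * r, t * q + u * s, 0) (0, 0, 1)) => //.
  by det_auto.
have qE : q = (u * x / t - u * s) / t.
  by do 2 apply: (mulfI nzt); apply: (eq_of_sub d0); rewrite /y /x; field.
rewrite {}qE /x in R.
have [r0|nzr] := eqVneq r 0; last first.
  into (NP12 a ((t * p + u * r) / t) (s - r * u / t))
    (mx3 (t, u, 0) (0, t / r, 0) (0, 0, 1)) => //.
  by det_auto.
rewrite r0 in R; have [ps|nps] := eqVneq p s.
  rewrite ps in R.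
  by into (NP13 a s) (mx3 (t, u, 0) (0, 1, 0) (0, 0, 1)) => //; det_auto.
have nz : p - s != 0 by rewrite subr_eq0.
into (NP12 a p s) (mx3 (t, u, 0) (t / (p - s), u / (p - s) + 1, 0) (0, 0, 1)) => //.
vsimpl; rewrite (_ : _ - _ + _ = t) //; by field.
Qed.

(** When [(t, u)] is zero, only the matrix up to conjugation remains: either scalar, or a companion
    matrix built on a cyclic vector. *)
Lemma Loc_classified a p q r s t u :
  realized Loc (Loc_circ a p q r s t u) -> classified.
Proof.
move=> R; have [t0|nzt] := eqVneq t 0; last exact: Loc_classified_neq0 R.
rewrite t0 in R; have [u0|nzu] := eqVneq u 0; last first.
  apply: (@Loc_classified_neq0 a s r q p u 0) => //.
  apply: (realized_change np R (P := mx3 (0, 1, 0) (1, 0, 0) (0, 0, 1))).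
  - by det_auto.
  - by respects_by.
  - by respects_by.
rewrite u0 in R; have [q0|nzq] := eqVneq q 0; last first.
  by into (NP14 a (q * r - p * s) (p + s))
    (mx3 (- s, q, 0) (1, 0, 0) (0, 0, 1)) => //; det_auto.
rewrite q0 in R; have [r0|nzr] := eqVneq r 0; last first.
  by into (NP14 a (- p * s) (p + s))
    (mx3 (r, - p, 0) (0, 1, 0) (0, 0, 1)) => //; det_auto.
rewrite r0 in R; have [ps|nps] := eqVneq p s.
  by rewrite ps in R; exists (NP15 a s).
into (NP14 a (- p * s) (p + s)) (mx3 (- s, - p, 0) (1, 1, 0) (0, 0, 1)) => //.
by vsimpl; rewrite (_ : _ - _ + _ = p - s) ?subr_eq0 //; ring.
Qed.

(** A nonzero [p] is scaled to 1 by [l], and [m] removes [q]. For [p = 0], [q] scales by a square,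
    and [m] moves [r] with coefficient proportional to [a - b], so [r] survives only for [a = b]. *)
Lemma Trunc_classified a b p q r :
  realized Trunc (Trunc_circ a b p q r) -> classified.
Proof.
move=> R; have [p0|nzp] := eqVneq p 0; last first.
  into (NP20 a b (r / p + q * (a - b) / (2 * (p * p))))
    (mx3 (p, q, 0) (0, p * p, 0) (0, 0, 1)) => //.
  by det_auto.
rewrite p0 in R; have [ab|nab] := eqVneq a b; last first.
  have nz : a - b != 0 by rewrite subr_eq0.
  have [q0|nzq] := eqVneq q 0.
    rewrite q0 in R; into (NP23 b a) (mx3 (1, - (2 * r / (a - b)), 0) (0, 1, 0) (0, 0, 1)) => //.
    by det_auto.
  have [l [nzl qE]] : exists l, l != 0 /\ q = l * l.
    by exists (sqrtC q); rewrite sqrtC_eq0 -expr2 sqrtCK.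
  rewrite qE in R.
  into (NP21 a b) (mx3 (l, - (2 * l * r / (a - b)), 0) (0, l * l, 0) (0, 0, 1)) => //.
  by det_auto.
rewrite ab in R; have [q0|nzq] := eqVneq q 0.
  rewrite q0 in R; have [r0|nzr] := eqVneq r 0.
    by exists (NP23 b b); rewrite r0 in R.
  into (NP24 b) (mx3 (r, 0, 0) (0, r * r, 0) (0, 0, 1)) => //.
  by det_auto.
have [l [nzl qE]] : exists l, l != 0 /\ q = l * l.
  by exists (sqrtC q); rewrite sqrtC_eq0 -expr2 sqrtCK.
rewrite qE in R; have [r0|nzr] := eqVneq r 0.
  rewrite r0 in R; into (NP21 b b) (mx3 (l, 0, 0) (0, l * l, 0) (0, 0, 1)) => //.
  by det_auto.
into (NP22 b (r / l)) (mx3 (l, 0, 0) (0, l * l, 0) (0, 0, 1)) => //.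
  by rewrite /= mulf_neq0 ?invr_eq0.
by det_auto.
Qed.

(** * Novikov products on the null plane of [LineNull] *)

Lemma LineNull_struct a p q r s t u v w :
    realized LineNull (LineNull_circ a p q r s t u v w) ->
  np_struct (dot_struct K LineNull) (tab9 (a, 0, 0) (0, 0, 0) (0, 0, 0)
    (0, 0, 0) (0, p, q) (0, r, s) (0, 0, 0) (0, t, u) (0, v, w)).
Proof.
move=> /(realized_struct np); apply; do 2 apply: ord3P.
all: by rewrite /LineNull_circ; unfold tab9; vsimpl; apply: vec_eq; ring.
Qed.

Lemma LineNull_commute a p q r s t u v w :
    realized LineNull (LineNull_circ a p q r s t u v w) ->
  [/\ q * v = s * t, (p - u) * s = q * (r - w) & (p - u) * v = t * (r - w)].
Proof.
move=> /LineNull_struct[_ _ N2 _].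
instance N2 i2 i2 i3; instance N2 i3 i2 i3.
split.
- by_eq e0.
- by_eq e1.
- by_eq (esym e2).
Qed.

Lemma quadratic_root (x y z : K) : x != 0 -> exists k, x * (k * k) + y * k + z = 0.
Proof.
move=> nzx; have [k kE] := solve_monicpoly (fun i => [:: - z / x; - y / x]`_i)
  (isT : 0 < 2)%N.
exists k; move: kE; rewrite !big_ord_recl big_ord0 /= expr0 expr1 mulr1 addr0 expr2.
by move=> ->; field.
Qed.

(* The right multiplications by the last two basis vectors commute, hence have a common
   eigenvector, which becomes the third basis vector. *)
Lemma LineNull_triangular a p q r s t u v w :
    realized LineNull (LineNull_circ a p q r s t u v w) ->
  exists p q r s u w, realized LineNull (LineNull_circ a p q r s 0 u 0 w).
Proof.
move=> R; have [e1 e2 e3] := LineNull_commute R.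
(* The two equations say that [e2 + z e3] is an eigenvector of the right multiplications by [e2] and
   by [e3]. *)
have main z : p * z + t * (z * z) = q + z * u -> r * z + v * (z * z) = s + z * w ->
    exists p q r s u w, realized LineNull (LineNull_circ a p q r s 0 u 0 w).
  move=> f1 f2; exists (w - z * v), v, (u + z * w - z * t - z * z * v), (t + z * v),
    (r + z * v), (p + z * t + z * r + z * z * v).
  have qE : q = p * z + t * (z * z) - z * u by rewrite f1 addrK.
  have sE : s = r * z + v * (z * z) - z * w by rewrite f2 addrK.
  rewrite qE sE in R.
  apply: (realized_change np R (P := mx3 (1, 0, 0) (0, 0, 1) (0, 1, z))).
  - by det_tac.
  - by respects_by.
  - by respects_by.
have [t0|nzt] := eqVneq t 0; last first.
  (* An eigenvector for the first operator is one for the second by the commutation relations. *)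
  have [z zE] := quadratic_root (p - u) (- q) nzt; apply: (main z).
    by apply: (eq_of_sub zE); ring.
  apply: (mulfI nzt); apply/eqP; rewrite -subr_eq0; apply/eqP.
  transitivity (v * (t * (z * z) + (p - u) * z - q)); last by rewrite zE mulr0.
  nsatz.
have [v0|nzv] := eqVneq v 0.
  by exists p, q, r, s, u, w; rewrite t0 v0 in R.
have q0 : q = 0 by apply: (mulIf nzv); rewrite e1 t0; ring.
have pu : p = u.
  by apply/eqP; rewrite -subr_eq0; apply/eqP; apply: (mulIf nzv); rewrite e3 t0; ring.
have [z zE] := quadratic_root (r - w) (- s) nzv; apply: (main z).
  by rewrite t0 q0 pu; ring.
by apply: (eq_of_sub zE); ring.
Qed.

Lemma LineNull_relations a p q r s u w :
    realized LineNull (LineNull_circ a p q r s 0 u 0 w) ->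
  [/\ p * s + q * w = r * q + s * u, r * p = u * r &
      r * q - u * u + p * u + q * w = 0 /\ r * r = w * r /\
      r * s + s * w - u * w + r * u = 0].
Proof.
move=> /LineNull_struct[_ _ N2 N1].
instance N2 i2 i2 i3; instance N1 i2 i3 i2; instance N1 i2 i3 i3.
by split; [by_eq e1 | by_eq e2 | split; [by_eq e3 | split; [by_eq e4 | by_eq e5]]].
Qed.

(** In triangular form [e3 ∘ e3 = w e3], and [r^2 = w r] leaves [r = 0] or [r = w]; the cases follow
    [w], then [r]. *)
Lemma LineNull_classified a p q r s t u v w :
  realized LineNull (LineNull_circ a p q r s t u v w) -> classified.
Proof.
move=> /LineNull_triangular[{}p [{}q [{}r [{}s [{}u [{}w R]]]]]].
have [e1 e2 [e3 [e4 e5]]] := LineNull_relations R.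
have [w0|nzw] := eqVneq w 0.
  have r0 : r = 0 by apply/eqP; rewrite -[_ == _]orbb -mulf_eq0 e4 w0 mul0r.
  subst w; subst r.
  have [pu|npu] := eqVneq p u; last first.
    have nz : p - u != 0 by rewrite subr_eq0.
    have s0 : s = 0 by apply: (mulfI nz); rewrite mulr0; by_eq e1.
    have u0 : u = 0 by apply: (mulfI nz); rewrite mulr0; by_eq e3.
    rewrite u0 subr0 in nz; subst s; subst u.
    into (NP39 a) (mx3 (1, 0, 0) (0, p^-1, q / (p * p)) (0, 0, 1)) => //.
    by det_auto.
  subst u; have [s0|nzs] := eqVneq s 0; last first.
    into (NP33 a (p / s)) (mx3 (1, 0, 0) (0, s^-1, - (q / (s * s))) (0, 0, 1)) => //.
    by det_auto.
  subst s; have [p0|nzp] := eqVneq p 0.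
    subst p; have [q0|nzq] := eqVneq q 0; first by subst q; exists (NP37 a).
    by into (NP36 a) (mx3 (1, 0, 0) (0, 1, 0) (0, 0, q)) => //; det_auto.
  have [q0|nzq] := eqVneq q 0.
    subst q; into (NP35 a) (mx3 (1, 0, 0) (0, p^-1, 0) (0, 0, 1)) => //.
    by det_auto.
  into (NP34 a) (mx3 (1, 0, 0) (0, p^-1, 0) (0, 0, q / (p * p))) => //.
  by det_auto.
have [r0|nzr] := eqVneq r 0.
  subst r; have su : s = u by apply: (mulIf nzw); by_eq e5.
  subst s; have qE : q = (u * u - p * u) / w.
    by apply: (mulIf nzw); rewrite mulfVK //; by_eq e3.
  subst q; have [p0|nzp] := eqVneq p 0; last first.
    into (NP38 a) (mx3 (1, 0, 0) (0, p^-1, - (u / w / p)) (0, 0, w^-1)) => //.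
    by det_auto.
  subst p.
  into (NP39 a) (mx3 (1, 0, 0) (0, 0, w^-1) (0, 1, - (u / w))) => //.
  by det_auto.
have rw : r = w by apply: (mulIf nzr).
subst w; have pu : p = u by apply: (mulIf nzr); by_eq e2.
subst u.
have nz2 : 2 != 0 :> K by rewrite pnatr_eq0.
have q0 : q = 0 by apply: (mulIf nzr); apply: (mulfI nz2); by_eq e3.
subst q; have s0 : s = 0 by apply: (mulIf nzr); apply: (mulfI nz2); by_eq e5.
subst s.
into (NP35 a) (mx3 (1, 0, 0) (0, 0, r^-1) (0, 1, - (p / r))) => //.
by det_auto.
Qed.

(** * Normal forms over the product [Sq] *)

Ltac sq_eqs := solve [ring | field; repeat (apply/andP; split); assumption | field].

(** The equations of [Sq_iso] are also sufficient, so a change of basis costs twelve scalar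
    identities. *)
Lemma Sq_change a b p q r s t u v w x y a' b' p' q' r' s' t' u' v' w' x' y'
    l m n g k :
    realized Sq (Sq_circ a b p q r s t u v w x y) -> l != 0 -> k != 0 ->
    l * l * a + l * n * b = a' * l ->
    l * l * p + l * m * r + l * n * t + m * l * a + l * n * v + n * n * x =
      a' * m + p' * l * l + q' * g ->
    l * l * q + l * m * s + l * n * u + l * n * w + n * n * y = a' * n + q' * k ->
    l * l * l * r - n * l * l * b = r' * l * l + s' * g ->
    l * l * l * s = s' * k ->
    l * k * b = b' * l ->
    l * g * r + l * k * t + m * k * b - n * g * b + n * k * x =
      b' * m + t' * l * l + u' * g ->
    l * g * s + l * k * u + n * k * y = b' * n + u' * k ->
    g * l * a + g * n * b + k * l * v - k * m * b + k * n * x =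
      v' * l * l + w' * g ->
    k * l * w + k * n * y = w' * k ->
    k * k * x = x' * l * l + y' * g ->
    k * k * y = y' * k ->
  realized Sq (Sq_circ a' b' p' q' r' s' t' u' v' w' x' y').
Proof.
move=> R nzl nzk E1 E2 E3 E4 E5 E6 E7 E8 E9 E10 E11 E12.
apply: (realized_change np R (P := mx3 (l, m, n) (0, l * l, 0) (0, g, k))).
- by det_auto.
- by respects_by.
(* Products involving [e2] repeat the equations for [a] and [b] with a further factor [l]. *)
have lE1 := congr1 ( *%R l) E1; have lE6 := congr1 ( *%R l) E6.
do 2 apply: ord3P; rewrite /Sq_circ; vsimpl; apply: vec_eq;
  first [ring | by_eq E1 | by_eq E2 | by_eq E3 | by_eq E4 | by_eq E5 | by_eq E6
    | by_eq E7 | by_eq E8 | by_eq E9 | by_eq E10 | by_eq E11 | by_eq E12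
    | by_eq lE1 | by_eq lE6 | by_eq (esym lE6)].
Qed.

Ltac sq l m n g k :=
  apply: (@Sq_change _ _ _ _ _ _ _ _ _ _ _ _ _ _ _ _ _ _ _ _ _ _ _ _ l m n g k);
  [eassumption | by nz_auto | by nz_auto | sq_eqs ..].
Ltac to p l m n g k :=
  exists p; split; [try by [] | rewrite /np_dot_type /np_circ_vtable; sq l m n g k].

Lemma Sq_struct a b p q r s t u v w x y :
    realized Sq (Sq_circ a b p q r s t u v w x y) ->
  np_struct (dot_struct K Sq) (tab9 (a, p, q) (0, r, s) (b, t, u)
    (0, a, 0) (0, 0, 0) (0, b, 0) (0, v, w) (0, - b, 0) (0, x, y)).
Proof.
move=> /(realized_struct np); apply; do 2 apply: ord3P.
all: by rewrite /Sq_circ; unfold tab9; vsimpl; apply: vec_eq; ring.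
Qed.

Lemma Sq_relations a b p q r s t u v w x y :
    realized Sq (Sq_circ a b p q r s t u v w x y) ->
  [/\ [/\ a * s = s * w, q * b + s * v = 0, s * x + u * b = 0 & s * y = b * s],
      [/\ q * x = u * v, a * u + q * y = b * q + u * w &
          v * b + w * x = x * a + y * v],
      s * x + w * b + b * r = u * b /\ 2 * b * s + s * y = 0 &
      [/\ b * a = b * w /\ b * b = b * y,
          t * a + u * v + q * x = w * v + v * r + w * t,
          b * q + a * w + q * y = w * w + v * s,
          b * t + 2 * u * x = w * x + x * r + y * t &
          b * u + u * y + b * w = w * y + x * s]].
Proof.
move=> /Sq_struct[_ _ N2 N1]; split.
- clear N1; instance N2 i1 i2 i1; instance N2 i1 i2 i3; clear N2.
  by split; [by_eq (esym e1) | by_eq e0 | by_eq e2 | by_eq e3].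
- clear N1; instance N2 i1 i1 i3; instance N2 i3 i1 i3; clear N2.
  by split; [by_eq e0 | by_eq e1 | by_eq e3].
- clear N2; instance N1 i1 i3 i2; clear N1.
  by split; [by_eq e0 | by_eq e1].
- clear N2; instance N1 i1 i3 i1; instance N1 i1 i3 i3; clear N1.
  by split; [split; [by_eq e | by_eq e2] | by_eq e0 | by_eq e1 | by_eq e3 | by_eq e4].
Qed.

Lemma Sq_classified_b1 p q r s t u v x :
  realized Sq (Sq_circ 0 1 p q r s t u v 0 x 1) -> classified.
Proof.
move=> R; have [[_ f1 f2 _] _ [f3 f4] _] := Sq_relations R.
have nz3 : 3 != 0 :> K by rewrite pnatr_eq0.
have s0 : s = 0 by apply: (mulfI nz3); by_eq f4.
subst s; have q0 : q = 0 by by_eq f1.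
have u0 : u = 0 by by_eq f2.
subst q u; have r0 : r = 0 by by_eq f3.
subst r; have [t0|nzt] := eqVneq t 0.
  by subst t; to (NP60 p) (1 : K) v (0 : K) x (1 : K).
by to (NP59 p) t (t * v) (0 : K) x (1 : K).
Qed.

Lemma Sq_classified_b a b p q r s t u v w x y : b != 0 ->
  realized Sq (Sq_circ a b p q r s t u v w x y) -> classified.
Proof.
move=> nzb R; have [_ _ _ [[f1 f2] _ _ _ _]] := Sq_relations R.
have {f1}aw : a = w := mulfI nzb f1; have {f2}b_y : b = y := mulfI nzb f2.
(* The frame [e1 - (a / b) e3], [e2], [e3 / b] gives [a = 0] and [b = 1]; the arguments are the
   transformed entries. *)
subst w y; apply: (@Sq_classified_b1 (p - a / b * (t + v) + a / b * (a / b) * x)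
  (b * q - a * u) (r + a) (s * b) (t / b - a * x / (b * b)) u
  (v / b - a * x / (b * b)) (x / (b * b))).
sq (1 : K) (0 : K) (- (a / b)) (0 : K) b^-1.
Qed.

Lemma Sq_classified_y a p q r s t u v w x y : y != 0 ->
  realized Sq (Sq_circ a 0 p q r s t u v w x y) -> classified.
Proof.
move=> nzy R; have [[_ _ _ f1] [_ f2 f3] _ [_ _ _ f4 f5]] := Sq_relations R.
have s0 : s = 0 by apply: (mulIf nzy); by_eq f1.
subst s; have uw : u = w by apply: (mulIf nzy); by_eq f5.
subst u; have qE : q = w * (w - a) / y by apply: (mulIf nzy); rewrite mulfVK //; by_eq f2.
have vE : v = x * (w - a) / y.
  by apply: (mulIf nzy); rewrite mulfVK //; by_eq (esym f3).
have tE : t = x * (w - r) / y.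
  by apply: (mulIf nzy); rewrite mulfVK //; by_eq (esym f4).
subst q v t.
(* Now [e3 / y + x e2 / y^2] is idempotent for [circ], and with [e1 - (w / y) e3] it splits off,
   leaving [a], [r] and one coefficient of [e2]. *)
have {}R : realized Sq (Sq_circ a 0
    (p - w / y * (x * (w - r) / y + x * (w - a) / y) + w * w * x / (y * y)) 0 r 0 0 0 0 0 0 1).
  by sq (1 : K) (0 : K) (- (w / y)) (x / (y * y)) y^-1.
move: (p - _ + _) R => {}p {f1 f2 f3 f4 f5}R.
have [r0|nzr] := eqVneq r 0; last first.
  by to (NP66 (a / r)) (r^-1) (- (p / (r * r))) (0 : K) (0 : K) (1 : K).
subst r; have [a0|nza] := eqVneq a 0; first by subst a; exists (NP68 p).
by to (NP67 p) (a^-1) (0 : K) (0 : K) (0 : K) (1 : K).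
Qed.

(** The relations on [s], [u] and [x] carry the factor [a - w], so these vanish, and then so does
    [w]. *)
Lemma Sq_classified_aw a p q r s t u v w x : a != w ->
  realized Sq (Sq_circ a 0 p q r s t u v w x 0) -> classified.
Proof.
rewrite -subr_eq0 => nz R.
have [[f1 _ _ _] [_ f2 f3] _ [_ f4 f5 _ _]] := Sq_relations R.
have s0 : s = 0 by apply: (mulIf nz); by_eq f1.
have u0 : u = 0 by apply: (mulIf nz); by_eq f2.
have x0 : x = 0 by apply: (mulIf nz); by_eq (esym f3).
subst s u x; have w0 : w = 0 by apply: (mulIf nz); by_eq f5.
subst w; rewrite subr0 in nz.
have tE : t = v * r / a by apply: (mulIf nz); rewrite mulfVK //; by_eq f4.
subst t; have [r0|nzr] := eqVneq r 0.
  subst r; by to (NP74 (p + q * v / a)) a^-1 (0 : K) (q / (a * a)) (- (v / a)) (1 : K).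
by to (NP73 (r / a)) a^-1 (- ((p / a + q / (a * a) * (v * r / a + v)) / r))
  (q / (a * a)) (- (v / a)) (1 : K); nz_auto.
Qed.

(** The root [z] of [x] scales [e3] so that [e3 ∘ e3 = e2]. With [u] scaled to 1, [p] is removed
    through division by [2 u - a], and [t - v] through division by [u - a]: hence the exceptions 2
    and 1 in [NP61]. *)
Lemma Sq_classified_x a p q r s t u v x : x != 0 ->
  realized Sq (Sq_circ a 0 p q r s t u v a x 0) -> classified.
Proof.
move=> nzx R; have [[_ _ f1 _] [f2 _ _] _ [_ _ _ f3 _]] := Sq_relations R.
have s0 : s = 0 by apply: (mulIf nzx); by_eq f1.
have rE : r = 2 * u - a by apply: (mulIf nzx); by_eq (esym f3).
have qE : q = u * v / x by apply: (mulIf nzx); rewrite mulfVK //; by_eq f2.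
have [z [nzz xE]] : exists z, z != 0 /\ x = z * z.
  by exists (sqrtC x); rewrite sqrtC_eq0 -expr2 sqrtCK.
subst s r q x => {f1 f2 f3 nzx}.
have [u0|nzu] := eqVneq u 0.
  subst u; have [a0|nza] := eqVneq a 0.
    subst a; by to (NP65 (p - v * t / (z * z)) ((t - v) / z)) (1 : K) (0 : K)
      (- (v / (z * z))) (0 : K) z^-1.
  by to (NP64 (K := K)) a^-1 ((p - v * t / (z * z)) / (a * a)) (- (v / a / (z * z)))
    ((t - v) / (z * a * a)) (a * z)^-1.
have [au|nau] := eqVneq a u.
  by subst a; to (NP62 ((t - v) / z)) u^-1 (- ((p - v * t / (z * z)) / (u * u)))
    (- (v / u / (z * z))) (0 : K) (u * z)^-1.
have [au2|nau2] := eqVneq a (2 * u).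
  by subst a; to (NP63 (p - v * t / (z * z))) u^-1 (0 : K)
    (- (v / u / (z * z))) ((t - v) / (z * u * u)) (u * z)^-1.
have nz : u - a != 0 by rewrite subr_eq0 eq_sym.
have nz2 : 2 * u - a != 0 by rewrite subr_eq0 eq_sym.
to (NP61 (a / u)) u^-1 (- ((p - v * t / (z * z)) / u / (2 * u - a)))
  (- (v / u / (z * z))) ((v - t) / (z * u * (u - a))) (u * z)^-1.
rewrite /np_admissible; apply/andP; split.
  by apply: contra nau => /eqP e; apply/eqP; rewrite -[a](mulfVK nzu) e mul1r.
by apply: contra nau2 => /eqP e; apply/eqP; rewrite -[a](mulfVK nzu) e.
Qed.

(** For [a = q = 0], replacing [e1] by [e1 + n e3] adds [n (t + v)] to [p], so [p] survives only for
    [t = - v], which is [NP72]. *)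
Lemma Sq_classified_v a p q r s t u v : v != 0 ->
  realized Sq (Sq_circ a 0 p q r s t u v a 0 0) -> classified.
Proof.
move=> nzv R; have [[_ f1 _ _] [f2 _ _] _ [_ f3 _ _ _]] := Sq_relations R.
have s0 : s = 0 by apply: (mulIf nzv); by_eq f1.
have u0 : u = 0 by apply: (mulIf nzv); by_eq (esym f2).
subst s u; have rE : r = - a by apply: (mulIf nzv); by_eq (esym f3).
subst r => {f1 f2 f3}; have [a0|nza] := eqVneq a 0; last first.
  by to (NP69 (q * v / a)) a^-1 (p / (a * a) - q * v * t / (a * a * a * v))
    (0 : K) (t / (a * a * v)) (a * v)^-1.
subst a; have [q0|nzq] := eqVneq q 0; last first.
  by to (NP70 (t / v)) (q * v)^-1 (0 : K) (0 : K) (p / (q * v * q * v)) (q * v * v)^-1.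
subst q; have [tv|ntv] := eqVneq t (- v).
  by subst t; to (NP72 p) (1 : K) (0 : K) (0 : K) (0 : K) v^-1.
have nz : t + v != 0 by rewrite addr_eq0.
to (NP71 (t / v)) (1 : K) (0 : K) (- (p / (t + v))) (0 : K) v^-1.
rewrite /np_admissible; apply: contra ntv => /eqP e; apply/eqP.
by rewrite -[t](mulfVK nzv) e mulN1r.
Qed.

(** There remain the vector [(p, q)] and the left multiplication by [e1] on the plane of [e2], [e3],
    with matrix [(r, s; t, u)]; the frame must keep the line of [e2]. For [s != 0] the vector [e2]
    is cyclic, which gives a companion form with trace [r + u] and minus determinant [s t - r u]; if
    the latter is nonzero, [(p, q)] can be removed. *)
Lemma Sq_classified_a1_s p q r s t u : s != 0 ->
  realized Sq (Sq_circ 1 0 p q r s t u 0 1 0 0) -> classified.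
Proof.
move=> nzs R; have [d0|nzd] := eqVneq (s * t - r * u) 0.
  have tE : t = r * u / s by apply: (mulfI nzs); apply: (eq_of_sub d0); field.
  subst t; by to (NP45 (p - q * r / s) (r + u)) (1 : K) (- (q / s)) (0 : K) (- u) s.
to (NP44 (r + u) (s * t - r * u)) (1 : K)
  (- ((q - (p * s - q * r) / (s * t - r * u) * u) / s))
  (- ((p * s - q * r) / (s * t - r * u))) (- u) s.
Qed.

Lemma Sq_classified_a1_ru p q r t :
  realized Sq (Sq_circ 1 0 p q r 0 t r 0 1 0 0) -> classified.
Proof.
move=> R; have [t0|nzt] := eqVneq t 0; have [r0|nzr] := eqVneq r 0.
- subst t r; have [q0|nzq] := eqVneq q 0.
    subst q; have [p0|nzp] := eqVneq p 0; last by exists (NP43 p 0).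
    by subst p; exists (NP42 0).
  by to (NP47 (0 : K)) (1 : K) (0 : K) (0 : K) p q.
- by subst t; to (NP42 r) (1 : K) (- (p / r)) (- (q / r)) (0 : K) (1 : K).
- subst r; have [q0|nzq] := eqVneq q 0.
    by subst q; to (NP41 (0 : K)) (1 : K) (0 : K) (- (p / t)) (0 : K) t^-1.
  by to (NP47 (q * t)) (1 : K) (0 : K) (- (p / t)) (0 : K) q.
- by to (NP41 r) (1 : K) (- ((p - q / r * t) / r)) (- (q / r)) (0 : K) t^-1.
Qed.

(** For [s = 0] the vector [e2] is an eigenvector. Distinct eigenvalues [r], [u] allow
    diagonalization by shifting [e3] by [t / (u - r)] times [e2]; a zero eigenvalue is what can keep
    a part of [(p, q)]. *)
Lemma Sq_classified_a1 p q r s t u :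
  realized Sq (Sq_circ 1 0 p q r s t u 0 1 0 0) -> classified.
Proof.
move=> R; have [s0|nzs] := eqVneq s 0; last exact: Sq_classified_a1_s nzs R.
subst s; have [ru|nru] := eqVneq r u; first by subst u; exact: Sq_classified_a1_ru R.
have nz : u - r != 0 by rewrite subr_eq0 eq_sym.
have [u0|nzu] := eqVneq u 0.
  subst u; have nzr : r != 0 by [].
  have [q0|nzq] := eqVneq q 0.
    by subst q; to (NP40 r 0) (1 : K) (- (p / r)) (0 : K) (- (t / r)) (1 : K).
  by to (NP46 r) (1 : K) (- ((q * t / r + p) / r)) (0 : K) (- (q * t / r)) q.
have [r0|nzr] := eqVneq r 0; last first.
  by to (NP40 r u) (1 : K) (- ((p - q / u * t) / r)) (- (q / u)) (t / (u - r)) (1 : K).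
subst r; have [d0|nzd] := eqVneq (p - q * t / u) 0.
  have pE : p = q * t / u by apply: (eq_of_sub d0); ring.
  by subst p; to (NP40 0 u) (1 : K) (0 : K) (- (q / u)) (t / u) (1 : K).
by to (NP43 (p - q * t / u) u) (1 : K) (0 : K) (- (q / u)) (t / u) (1 : K).
Qed.

(** With [a = 0] the scale [l] is free: it turns [s t - r u] into 1 through its root [z], or else a
    nonzero trace into 1. *)
Lemma Sq_classified_0_s p q r s t u : s != 0 ->
  realized Sq (Sq_circ 0 0 p q r s t u 0 0 0 0) -> classified.
Proof.
move=> nzs R; have [d0|nzd] := eqVneq (s * t - r * u) 0.
  have tE : t = r * u / s by apply: (mulfI nzs); apply: (eq_of_sub d0); field.
  subst t; have [ru|nru] := eqVneq (r + u) 0.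
    have uE : u = - r by apply: (eq_of_sub ru); ring.
    by subst u; to (NP55 (p - q * r / s)) (1 : K) (- (q / s)) (0 : K) r s.
  by to (NP48 (p - q * r / s)) (r + u)^-1 (- (q / (r + u) / s)) (0 : K)
    (r / ((r + u) * (r + u) * (r + u))) (s / ((r + u) * (r + u) * (r + u))).
have [z [nzz dE]] : exists z, z != 0 /\ s * t - r * u = z * z.
  by exists (sqrtC (s * t - r * u)); rewrite sqrtC_eq0 -expr2 sqrtCK.
have tE : t = (z * z + r * u) / s by apply: (mulfI nzs); apply: (eq_of_sub dE); field.
clear nzd dE; subst t.
by to (NP52 ((r + u) / z)) z^-1 (- ((q / z - (p * s - q * r) / (z * z * z) * u) / s))
  (- ((p * s - q * r) / (z * z * z))) (- (u / (z * z * z))) (s / (z * z * z)).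
Qed.

(** The eigenvalues of the left multiplication by [e1] are [r] and [u], and [l] scales [r] to 1. *)
Lemma Sq_classified_0_r p q r t u : r != 0 ->
  realized Sq (Sq_circ 0 0 p q r 0 t u 0 0 0 0) -> classified.
Proof.
move=> nzr R; have [ru|nru] := eqVneq r u.
  subst u; have [t0|nzt] := eqVneq t 0.
    by subst t; to (NP49 (1 : K)) r^-1 (- (p / (r * r))) (- (q / (r * r))) (0 : K) (1 : K).
  by to (NP50 (K := K)) r^-1 (- ((p / r - q * t / (r * r)) / r)) (- (q / (r * r)))
    (0 : K) (r * t)^-1.
have nz : u - r != 0 by rewrite subr_eq0 eq_sym.
have [u0|nzu] := eqVneq u 0; last first.
  by to (NP49 (u / r)) r^-1 (- ((p / r - q / (r * u) * t) / r)) (- (q / (r * u)))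
    (t / (u - r)) (1 : K).
subst u; have [q0|nzq] := eqVneq q 0.
  by subst q; to (NP49 (0 : K)) r^-1 (- (p / (r * r))) (0 : K) (- (t / r)) (1 : K).
by to (NP56 (K := K)) r^-1 (- (q * t / (r * r * r)) - p / (r * r)) (0 : K)
  (- (q * t / (r * r * r))) (q / (r * r)).
Qed.

Lemma Sq_classified_0 p q r s t u :
  realized Sq (Sq_circ 0 0 p q r s t u 0 0 0 0) -> classified.
Proof.
move=> R; have [s0|nzs] := eqVneq s 0; last exact: Sq_classified_0_s nzs R.
subst s; have [r0|nzr] := eqVneq r 0; last exact: Sq_classified_0_r nzr R.
subst r; have [u0|nzu] := eqVneq u 0; last first.
  by to (NP51 (p - q * t / u)) u^-1 (0 : K) (- (q / (u * u))) (t / u) (1 : K).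
subst u; have [t0|nzt] := eqVneq t 0; have [q0|nzq] := eqVneq q 0.
- by subst t q; exists (NP58 p).
- by subst t; to (NP57 (K := K)) (1 : K) (0 : K) (0 : K) p q.
- by subst q; to (NP54 (K := K)) (1 : K) (0 : K) (- (p / t)) (0 : K) t^-1.
- by to (NP53 (K := K)) (q * t)^-1 (0 : K) (- (p / (q * t * t))) (0 : K) (q * t * t)^-1.
Qed.

Lemma Sq_classified a b p q r s t u v w x y :
  realized Sq (Sq_circ a b p q r s t u v w x y) -> classified.
Proof.
move=> R; have [b0|nzb] := eqVneq b 0; last exact: Sq_classified_b nzb R.
subst b; have [y0|nzy] := eqVneq y 0; last exact: Sq_classified_y nzy R.
subst y; have [aw|naw] := eqVneq a w; last exact: Sq_classified_aw naw R.
subst w; have [x0|nzx] := eqVneq x 0; last exact: Sq_classified_x nzx R.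
subst x; have [v0|nzv] := eqVneq v 0; last exact: Sq_classified_v nzv R.
subst v; have [a0|nza] := eqVneq a 0; first by subst a; exact: Sq_classified_0 R.
(* Dividing [e1] by [a] gives [a = 1]. *)
apply: (@Sq_classified_a1 p (q / (a * a)) (r / a) (s / (a * a * a)) (a * t) (u / a)).
sq a^-1 (0 : K) (0 : K) (0 : K) (1 : K).
Qed.

End NormalForms.

Lemma np_classified (K : numClosedFieldType) (A : vectType K)
    (dot circ : A -> A -> A) :
    \dim {:A} = 3%N -> novikov_poisson dot circ -> (exists x y, dot x y <> 0) ->
  classified dot circ.
Proof.
move=> dimA np; have [[dB dC dA] [cB _ _] _ _] := np => nz.
have [k [w [fw wd]]] := dot_class dimA dB dC dA nz.
have [v11 [v12 [v13 [v21 [v22 [v23 [v31 [v32 [v33 wc]]]]]]]]] := struct_ex circ fw.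
have S : np_struct (dot_struct K k) (tab9 v11 v12 v13 v21 v22 v23 v31 v32 v33).
  apply: (has_struct_np np fw) => [i j|]; last exact: wc.
  by rewrite -dot_structE -wd !lin_unit3.
have real t : (forall i j, tab9 v11 v12 v13 v21 v22 v23 v31 v32 v33 i j =
    vmul t (unit3 i) (unit3 j)) -> realized dot circ k t.
  by move=> E; exists w; split=> //; apply: has_tableP => // i j; rewrite -E wc.
clear fw wd wc; case: k S real => S real.
- by have [? [? [? [? [? [? /real R]]]]]] := Hyp_form S; exact: Hyp_classified R.
- by have [? [? [? [? [? /real R]]]]] := Pow_form S; exact: Pow_classified R.
- by have [? [? [? [? [? [? [? /real R]]]]]]] := Loc_form S; exact: Loc_classified R.
- by have [? [? [? [? /real R]]]] := DualNull_form S; exact: DualNull_classified R.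
- by have [? [? [? [? [? /real R]]]]] := Trunc_form S; exact: Trunc_classified R.
- by have [? [? [? /real R]]] := Split_form S; exact: Split_classified R.
- by have [? [? [? [? /real R]]]] := SplitDual_form S; exact: SplitDual_classified R.
- by have [? [? [? /real R]]] := SplitNull_form S; exact: SplitNull_classified R.
- by have [? [? [? [? /real R]]]] := LineSq_form S; exact: LineSq_classified R.
- have [? [? [? [? [? [? [? [? [? /real R]]]]]]]]] := LineNull_form S.
  by exact: LineNull_classified R.
- have [? [? [? [? [? [? [? [? [? [? [? [? /real R]]]]]]]]]]]] := Sq_form S.
  by exact: Sq_classified R.
Qed.

Theorem theorem2p10 (R : realType) :
  (forall (A : vectType R[i]) (dot circ : A -> A -> A),
     \dim {:A} = 3%N ->
     novikov_poisson dot circ ->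
     (exists x y : A, dot x y <> 0) ->
     exists p : np_family R[i],
       np_admissible p /\
       np_isomorphic dot circ (np_dot p) (np_circ p)) /\
  (forall p q : np_family R[i],
     np_admissible p -> np_admissible q -> np_index p = np_index q ->
     (np_isomorphic (np_dot p) (np_circ p) (np_dot q) (np_circ q) <->
      np_same_class p q)).
Proof.
split=> [A dot circ dimA np nz|p q adm_p adm_q pq].
  have [p [adm [w [fw wd wc]]]] := np_classified dimA np nz.
  by exists p; split=> //; exact: np_isomorphic_frame fw wd wc.
by split=> [|pq']; [exact: same_class_of_isomorphic | exact: isomorphic_of_same_class].
Qed.
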